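(* Let $A$ be a Hermitian unital Banach $\ast$-algebra and $\psi:A\to\mathbb{C}$ a positive normalized linear functional. Let $f$ be analytic in an open subset $G$ of $\mathbb{C}$, let $I\subset G$ be a real interval, and suppose $f$ is convex (in the usual sense, as a real-valued function) on $I$. Let $m<M$ be real numbers with $[m,M]\subset I$, and let $c\in A$ be a selfadjoint element with $\sigma(c)\subseteq[m,M]$. Then $$0\le \psi(f(c))-f(\psi(c))\le\left(1+2\,\frac{\left|\psi(c)-\frac{m+M}{2}\right|}{M-m}\right)\left[\frac{f(m)+f(M)}{2}-f\left(\frac{m+M}{2}\right)\right]\le f(m)+f(M)-2f\left(\frac{m+M}{2}\right).$$
   Context: A unital Banach $\ast$-algebra $A$ (complex, with unit $1$) is called Hermitian if every selfadjoint element $a$ ($a^\ast=a$) has real spectrum $\sigma(a)\subset\mathbb{R}$. An element $a\in A$ is nonnegative, written $a\ge 0$, if $a^\ast=a$ and $\sigma(a)\subset[0,\infty)$. A linear functional $\psi:A\to\mathbb{C}$ is positive if $\psi(a)\ge0$ whenever $a\ge0$, and normalized if $\psi(1)=1$. For $f$ analytic on an open set $G\supset\sigma(c)$, $f(c)\in A$ is defined by the holomorphic functional calculus, $f(c)=\frac{1}{2\pi i}\int_\gamma f(z)(z-c)^{-1}dz$, where $\gamma$ is a closed rectifiable curve in $G$ with $\sigma(c)$ in its inside; the result does not depend on the choice of $\gamma$. *)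

(* Defs.v *)
From HB Require Import structures.
From mathcomp Require Import all_boot all_order all_algebra.
From mathcomp Require Import complex.
From mathcomp Require Import all_classical all_reals all_analysis.

Set Implicit Arguments.
Unset Strict Implicit.
Unset Printing Implicit Defensive.

Import Order.TTheory GRing.Theory Num.Theory.
Import numFieldNormedType.Exports.

Local Open Scope classical_set_scope.
Local Open Scope ring_scope.
Local Open Scope complex_scope.

(* Makes the modulus topology of the complex numbers canonical on [R[i]]. *)
HB.instance Definition _ (R : realType) := NormedModule.copy R[i] R[i]^o.

(* The ring operations are record fields over a Banach space, instead of coming
   from an HB structure, because HB rejects a structure that extends both
   normed modules and rings ([numDomainType] already extends both, with no
   intermediate join). The canonical instances below restore the usual notations.
   Neither [`|1| = 1] nor continuity of the involution is required. *)
Record banachStarAlgType (R : realType) := BanachStarAlg {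
  bsa_space : completeNormedModType R[i] ;
  bsa_one : bsa_space ;
  bsa_mul : bsa_space -> bsa_space -> bsa_space ;
  bsa_star : bsa_space -> bsa_space ;
  bsa_mulA : associative bsa_mul ;
  bsa_mul1l : left_id bsa_one bsa_mul ;
  bsa_mul1r : right_id bsa_one bsa_mul ;
  bsa_mulDl : left_distributive bsa_mul +%R ;
  bsa_mulDr : right_distributive bsa_mul +%R ;
  bsa_one_neq0 : bsa_one != 0 ;
  bsa_scaleAl : forall (k : R[i]) x y, k *: bsa_mul x y = bsa_mul (k *: x) y ;
  bsa_scaleAr : forall (k : R[i]) x y, k *: bsa_mul x y = bsa_mul x (k *: y) ;
  bsa_normM : forall x y, `|bsa_mul x y| <= `|x| * `|y| ;
  bsa_starK : involutive bsa_star ;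
  bsa_starD : {morph bsa_star : x y / x + y} ;
  bsa_starZ : forall (k : R[i]) x, bsa_star (k *: x) = k^* *: bsa_star x ;
  bsa_starM : forall x y,
    bsa_star (bsa_mul x y) = bsa_mul (bsa_star y) (bsa_star x) }.

Definition bsa_sort (R : realType) (A : banachStarAlgType R) : Type :=
  bsa_space A.
Coercion bsa_sort : banachStarAlgType >-> Sortclass.

Section BanachStarAlgInstances.
Variables (R : realType) (A : banachStarAlgType R).

HB.instance Definition _ := CompleteNormedModule.on (bsa_sort A).

HB.instance Definition _ := GRing.Zmodule_isNzRing.Build (bsa_sort A)
  (@bsa_mulA R A) (@bsa_mul1l R A) (@bsa_mul1r R A)
  (@bsa_mulDl R A) (@bsa_mulDr R A) (@bsa_one_neq0 R A).

HB.instance Definition _ :=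
  GRing.Lmodule_isLalgebra.Build R[i] (bsa_sort A) (@bsa_scaleAl R A).

HB.instance Definition _ :=
  GRing.Lalgebra_isAlgebra.Build R[i] (bsa_sort A) (@bsa_scaleAr R A).

Definition bsa_invs (x : bsa_sort A) : set (bsa_sort A) :=
  [set y | y * x = 1 /\ x * y = 1].

Definition bsa_unit : pred (bsa_sort A) :=
  fun x => `[< exists y, bsa_invs x y >].

Definition bsa_inv (x : bsa_sort A) : bsa_sort A := xget x (bsa_invs x).

Fact bsa_mulVr : {in bsa_unit, left_inverse 1 bsa_inv *%R}.
Proof.
by move=> x /asboolP[y xy]; rewrite /bsa_inv; case: xgetP => [z _ []|/(_ y)].
Qed.

Fact bsa_mulrV : {in bsa_unit, right_inverse 1 bsa_inv *%R}.
Proof.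
by move=> x /asboolP[y xy]; rewrite /bsa_inv; case: xgetP => [z _ []|/(_ y)].
Qed.

Fact bsa_unitP x y : y * x = 1 /\ x * y = 1 -> bsa_unit x.
Proof. by move=> xy; apply/asboolP; exists y. Qed.

Fact bsa_inv_out : {in [predC bsa_unit], bsa_inv =1 id}.
Proof.
move=> x /asboolPn nx; rewrite /bsa_inv; case: xgetP => // y _ xy.
by case: nx; exists y.
Qed.

HB.instance Definition _ := GRing.NzRing_hasMulInverse.Build (bsa_sort A)
  bsa_mulVr bsa_mulrV bsa_unitP bsa_inv_out.

End BanachStarAlgInstances.

Definition star (R : realType) (A : banachStarAlgType R) (a : A) : A :=
  bsa_star a.

Section Algebra.
Variables (R : realType) (A : banachStarAlgType R).
Implicit Types (a : A) (psi : {scalar A}).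

Definition spectrum a : set R[i] :=
  [set l | l%:A - a \isn't a @GRing.unit A].

Definition selfadjoint a : Prop := star a = a.

Definition hermitian_algebra : Prop :=
  forall a, selfadjoint a -> spectrum a `<=` [set l | l \is Num.real].

(* In the order of [R[i]], [0 <= l] means that [l] is real and nonnegative. *)
Definition nonneg a : Prop :=
  selfadjoint a /\ spectrum a `<=` [set l | 0 <= l].

Definition positive_functional psi : Prop :=
  forall a, nonneg a -> 0 <= psi a.

Definition normalized psi : Prop := psi 1 = 1.

End Algebra.

Section CurveIntegral.
Variable R : realType.
Implicit Types (g : R -> R[i]) (s : seq R).

(* Curves are parametrized by [0, 1], and a partition
   0 = t_0 < t_1 < ... < t_n = 1 is given by [s] = [:: t_1; ...; t_n]. *)
Definition pt s (i : nat) : R := nth 1 (0 :: s) i.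

Definition rectifiable g : Prop :=
  exists L : R, forall s, itv_partition 0 1 s ->
    \sum_(i < size s) `|g (pt s i.+1) - g (pt s i)| <= L%:C.

Definition closed_rectifiable_curve g : Prop :=
  [/\ {within `[0, 1], continuous g}, g 0 = g 1 & rectifiable g].

Definition trace g : set R[i] := g @` `[0, 1].

(* Riemann-Stieltjes sum of [F dz] along [g] with intermediate points [xi]. *)
Definition curve_sum (V : lmodType R[i]) g (F : R[i] -> V) s
    (xi : nat -> R) : V :=
  \sum_(i < size s) (g (pt s i.+1) - g (pt s i)) *: F (g (xi i)).

(* [v] is the limit of the sums as the mesh of the partition tends to 0. *)
Definition is_curve_integral (V : normedModType R[i]) g (F : R[i] -> V)
    (v : V) : Prop :=
  forall e : R, 0 < e -> exists2 d : R, 0 < d &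
    forall s (xi : nat -> R), itv_partition 0 1 s ->
      (forall i, (i < size s)%N ->
         pt s i.+1 - pt s i < d /\ pt s i <= xi i <= pt s i.+1) ->
      `|curve_sum g F s xi - v| < e%:C.

(* The default value 0 is irrelevant for continuous integrands on rectifiable
   curves, whose integrals exist. *)
Definition curve_integral (V : normedModType R[i]) g (F : R[i] -> V) : V :=
  xget 0 [set v | is_curve_integral g F v].

Definition twopii : R[i] := 0 +i* (2 * pi).

Definition winding_number g (w : R[i]) : R[i] :=
  twopii^-1 * curve_integral g (fun z => (z - w)^-1).

Definition inside g : set R[i] :=
  [set w | ~ trace g w /\ winding_number g w = 1].

(* [g] winds once around each point of [K], and not at all around the points
   outside [G]. The latter condition says that the curve does not enclose holes
   of [G]; without it the functional calculus would depend on the curve. *)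
Definition encloses (G K : set R[i]) g : Prop :=
  [/\ closed_rectifiable_curve g, trace g `<=` G, K `<=` inside g
    & forall w, ~ G w -> winding_number g w = 0].

End CurveIntegral.

Section FunctionalCalculus.
Variables (R : realType) (A : banachStarAlgType R).

Definition analytic_on (G : set R[i]) (f : R[i] -> R[i]) : Prop :=
  forall z, G z -> derivable f z 1.

Definition is_hol_calc (G : set R[i]) (f : R[i] -> R[i]) (c x : A) : Prop :=
  exists2 g : R -> R[i], encloses G (spectrum c) g &
    x = (twopii R)^-1 *: curve_integral g (fun z => f z *: (z%:A - c)^-1).

(* f(c). The default value 0 is only taken when no closed curve in [G] encloses
   the spectrum, which cannot happen if the latter lies in a compact real
   interval contained in [G]. *)
Definition hol_calc (G : set R[i]) (f : R[i] -> R[i]) (c : A) : A :=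
  xget 0 [set x | is_hol_calc G f c x].

End FunctionalCalculus.

(* [f] takes real values on [I] and is convex there. *)
Definition real_convex_on (R : realType) (I : interval R) (f : R[i] -> R[i]) :
    Prop :=
  (forall t : R, t \in I -> f t%:C \is Num.real) /\
  convex_function ([set` I] : set (convex_lmodType R^o))
    (fun t : R => complex.Re (f t%:C)).

(* Main.v *)
Require Import Defs.
From HB Require Import structures.
From mathcomp Require Import all_boot all_order all_algebra.
From mathcomp Require Import complex.
From mathcomp Require Import all_classical all_reals all_analysis.
From mathcomp Require Import ring lra.

Set Implicit Arguments.
Unset Strict Implicit.
Unset Printing Implicit Defensive.

Import Order.TTheory GRing.Theory Num.Theory.
Import numFieldNormedType.Exports.

Local Open Scope classical_set_scope.
Local Open Scope ring_scope.
Local Open Scope complex_scope.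

(** If [A] were a C*-algebra, [psi] composed with the functional calculus of [c]
    would be integration against a probability measure on the spectrum of [c],
    with barycentre [psi c], and the first two inequalities would be integrals of
    pointwise ones: a convex function lies above its tangent at [psi c] and below
    its chord over [m, M]. In a Hermitian Banach algebra neither the involution
    nor [psi] need be continuous, but comparing [f] with affine functions takes
    less than a measure. By [psi_affine_ge], if [|w| = 1] and
    [r <= Re (w * f t + al * t + be)] on the spectrum, then
    [r <= Re (w * psi (f(c)) + al * psi c + be)]. The tangent with [w = 1], the
    chord with [w = -1], and [w = 'i], [w = - 'i] for the imaginary part give
    [f (psi c) <= psi (f(c)) <= chord (psi c)]. What remains is convexity on the
    real line: [convex_chord_gap] and [convex_factor_le2].

    To prove [psi_affine_ge], let [S] be a Riemann sum of the contour integral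
    that defines [y = f(c)]. It is a rational function of [c], and the same sum
    with [c] replaced by a point [t] of the spectrum is close to [f t], uniformly
    in [t], by Cauchy's formula ([riemann_approx]). For rational functions the
    spectral mapping property is algebraic ([rational_spectrum]), so [psi]
    respects lower bounds on the spectrum ([psi_rational_ge]). The error
    [e = y - S] commutes with all that commutes with [c], hence with [star e].
    For such [e] one has [|Re (psi e)| <= r] as soon as [r] exceeds the norm of
    [e] ([psi_bound]), because the spectral radii of [e] and [star e] agree and
    the spectral radius is subadditive on commuting elements ([unit_sum]). The
    latter rests on a form of the spectral radius formula, [power_bound].

    Cauchy's formula is needed for a closed rectifiable curve that winds around no
    point outside [G] ([homology_cauchy]). Integrate [f z / (z - zeta)] over the
    boundaries of the cells of a fine grid that reach well inside [G]. By
    Cauchy's formula for rectangles ([cauchy_rect]) the result is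
    [2 pi i * f zeta] for [zeta] on the trace or of nonzero winding number; the
    edges that do not cancel lie close to the complement of [G], where the winding
    number is 0, so exchanging the two integrations ([ci_edge]) gives the formula
    along the curve. Finally, [hol_calc] is the value of such an
    integral only if an enclosing curve exists: [enclosing_curve] takes the
    boundary of a thin rectangle around [m, M], whose winding number is computed
    in polar coordinates ([winding_center]). *)

(** * Real-valued norms *)

Lemma le_of_eq (R : realType) (x y : R) : x = y -> x <= y.
Proof. by move->. Qed.

Section RealNorm.
Variables (R : realType).

(** The norm of a space over [R[i]] is itself a complex number; its real part is
    a real number, to which real arithmetic and decision procedures apply. *)
Definition nm (V : normedModType R[i]) (x : V) : R := complex.Re `|x|.

Variable V : normedModType R[i].
Implicit Types (x y : V) (k z w : R[i]).

Lemma nmE x : `|x| = (nm x)%:C.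
Proof. by rewrite /nm RRe_real// ger0_real. Qed.

Lemma nm_ge0 x : 0 <= nm x.
Proof. by rewrite -lecR -nmE normr_ge0. Qed.

Lemma nm0 : nm (0 : V) = 0.
Proof. by rewrite /nm normr0. Qed.

Lemma nm_le0 x : nm x <= 0 -> x = 0.
Proof. by rewrite -lecR -nmE normr_le0 => /eqP. Qed.

Lemma nmD x y : nm (x + y) <= nm x + nm y.
Proof. by rewrite -lecR rmorphD/= -!nmE ler_normD. Qed.

Lemma nmN x : nm (- x) = nm x.
Proof. by rewrite /nm normrN. Qed.

Lemma nmB x y : nm (x - y) = nm (y - x).
Proof. by rewrite -nmN opprB. Qed.

Lemma nm_sub x y : nm (x - y) <= nm x + nm y.
Proof. by rewrite -(nmN y) nmD. Qed.

Lemma nm_trans y x t : nm (x - t) <= nm (x - y) + nm (y - t).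
Proof. by rewrite (le_trans _ (nmD _ _))// subrKA. Qed.

Lemma nm_sum n (F : 'I_n -> V) : nm (\sum_(i < n) F i) <= \sum_(i < n) nm (F i).
Proof.
elim/big_ind2: _ => //; first by rewrite nm0.
by move=> a b c d ab cd; rewrite (le_trans (nmD _ _))// lerD.
Qed.

Lemma nm_unique x y : (forall e : R, 0 < e -> nm (x - y) <= e) -> x = y.
Proof.
move=> H; apply/subr0_eq/nm_le0/ler_addgt0Pl => e e0.
by rewrite addr0 H.
Qed.

Lemma lt_nmC x (e : R) : (`|x| < e%:C) = (nm x < e).
Proof. by rewrite nmE ltcR. Qed.

Lemma nm_ballE x y (e : R) : ball x e%:C y <-> nm (x - y) < e.
Proof. by rewrite -ball_normE/= lt_nmC. Qed.

End RealNorm.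

Section RealNormC.
Variables (R : realType).
Implicit Types (z w : R[i]).

Lemma nmZ (V : normedModType R[i]) z (x : V) : nm (z *: x) = nm z * nm x.
Proof. by apply: complexI; rewrite rmorphM/= -!nmE normrZ. Qed.

Lemma nmM z w : nm (z * w) = nm z * nm w.
Proof. exact: nmZ. Qed.

Lemma nmV z : nm z^-1 = (nm z)^-1.
Proof. by apply: complexI; rewrite fmorphV/= -!nmE normfV. Qed.

Lemma nmC (x : R) : nm x%:C = `|x|.
Proof. by rewrite /nm normc_def/= expr0n/= addr0 sqrtr_sqr. Qed.

Lemma nm1 : nm (1 : R[i]) = 1.
Proof. by rewrite (nmC 1) normr1. Qed.

Lemma nmE2 z : nm z = Num.sqrt (complex.Re z ^+ 2 + complex.Im z ^+ 2).
Proof. by rewrite /nm normc_def. Qed.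

Lemma Re_le_nm z : `|complex.Re z| <= nm z.
Proof. by rewrite nmE2 -sqrtr_sqr ler_wsqrtr// lerDl sqr_ge0. Qed.

Lemma Im_le_nm z : `|complex.Im z| <= nm z.
Proof. by rewrite nmE2 -sqrtr_sqr ler_wsqrtr// lerDr sqr_ge0. Qed.

Lemma nm_le_ReIm z : nm z <= `|complex.Re z| + `|complex.Im z|.
Proof.
case: z => a b /=; have -> : a +i* b = a%:C + 'i * b%:C by simpc.
by rewrite (le_trans (nmD _ _))// nmM !nmC nmE2/= expr0n/= expr1n add0r sqrtr1 mul1r.
Qed.

Lemma ReB z w : complex.Re (z - w) = complex.Re z - complex.Re w.
Proof. by case: z w => [? ?] [? ?]. Qed.

Lemma ImB z w : complex.Im (z - w) = complex.Im z - complex.Im w.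
Proof. by case: z w => [? ?] [? ?]. Qed.

Lemma nm_gt0 z : (0 < nm z) = (z != 0).
Proof.
rewrite lt0r nm_ge0 andbT; congr (~~ _).
by apply/eqP/eqP => [z0|->]; [apply: nm_le0; rewrite z0|exact: nm0].
Qed.

Lemma nm_invB z w (d : R) : 0 < d -> d <= nm z -> d <= nm w ->
  nm (z^-1 - w^-1) <= d ^- 2 * nm (z - w).
Proof.
move=> d0 dz dw; have z0 : z != 0 by rewrite -nm_gt0 (lt_le_trans d0).
have w0 : w != 0 by rewrite -nm_gt0 (lt_le_trans d0).
have -> : z^-1 - w^-1 = (z * w)^-1 * (w - z).
  by rewrite invfM mulrBr -mulrA mulVf// mulr1 [z^-1 * _]mulrC -mulrA mulVf// mulr1.
rewrite nmM nmV nmM nmB ler_wpM2r ?nm_ge0// lef_pV2 ?posrE ?exprn_gt0 ?mulr_gt0//.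
- by rewrite expr2 ler_pM// ltW.
- exact: lt_le_trans dz.
- exact: lt_le_trans dw.
Qed.

End RealNormC.

Section EpsDelta.
Variables (R : realType).

Lemma nbhs_nmP (V : normedModType R[i]) (x : V) (P : set V) :
  nbhs x P <-> exists2 e : R, 0 < e & forall y, nm (x - y) < e -> P y.
Proof.
split=> [/nbhs_ballP[/= e e0 xP]|[e e0 H]].
  exists (complex.Re e); first by move: e0; rewrite ltcE/= => /andP[].
  move=> y xy; apply: xP; rewrite -[e]RRe_real ?gtr0_real//.
  exact/nm_ballE.
apply/nbhs_ballP; exists e%:C => /=; first by rewrite ltcR.
by move=> y /nm_ballE; exact: H.
Qed.

(** Compactness of a segment: a property [P d t] that holds near every [t] at
    all small scales [d] holds at some scale for all [t]. *)
Lemma compact_uniform (a b : R) (P : R -> R -> Prop) :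
  (forall t, a <= t <= b -> exists2 d : R, 0 < d &
     forall s e, a <= s <= b -> `|s - t| < d -> 0 < e < d -> P e s) ->
  exists2 d : R, 0 < d & forall t, a <= t <= b -> P d t.
Proof.
move=> H; have K := @segment_compact R a b.
move/compact_near_coveringP/near_covering_withinP: K => K.
have := K _ ((0:R)^'+) (fun e s => P e s) _ => -/(_ _)[].
  move=> t /=; rewrite in_itv/= => tab; have [d d0 Hd] := H t tab.
  near=> u => /= abu; apply: Hd.
  - by move: abu; rewrite /= in_itv.
  - near: u; exists (ball t d, setT) => /=.
      by split; [exact: nbhsx_ballx|exact: filterT].
    by move=> [x y]/= []; rewrite /ball/= distrC.
  - near: u; exists (setT, [set e | 0 < e < d]) => /=.
      split; first exact: filterT.
      near=> e; apply/andP; split; near: e; first exact: nbhs_right_gt.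
      exact: nbhs_right_lt.
    by move=> [x y]/= [].
move=> /= e e0 He.
exists (e / 2); first by rewrite divr_gt0.
move=> t tab; apply: (He (e / 2)) => /=.
- by rewrite sub0r normrN gtr0_norm ?divr_gt0// ltr_pdivrMr// ltr_pMr// ltr1n.
- by rewrite divr_gt0.
- by rewrite in_itv.
Unshelve. all: by end_near. Qed.

End EpsDelta.

Lemma cauchy_lim (R : realType) (V : completeNormedModType R[i]) (S : nat -> V) :
  (forall e : R, 0 < e -> exists N, forall m n, (N <= m)%N -> (N <= n)%N ->
    nm (S m - S n) <= e) ->
  exists y, forall e : R, 0 < e -> exists N, forall n, (N <= n)%N -> nm (S n - y) <= e.
Proof.
move=> Sc; have : cvg (S @ \oo).
  apply/cauchy_cvgP/cauchy_exP => e e0.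
  have e'0 : 0 < complex.Re e by move: e0; rewrite ltcE/= => /andP[].
  have [N HN] := Sc (complex.Re e / 2) (divr_gt0 e'0 (ltr0Sn _ 1)).
  exists (S N); exists N => // n /= Nn.
  rewrite -[e]RRe_real ?gtr0_real//; apply/nm_ballE.
  by rewrite (le_lt_trans (HN _ _ _ _))// ltr_pdivrMr// ltr_pMr// ltr1n.
move=> cS; exists (lim (S @ \oo)) => e e0.
move/cvgrPdist_lt: cS => /(_ e%:C); rewrite ltcR => /(_ e0) [N _ HN].
by exists N => n Nn; rewrite nmB ltW// -lt_nmC HN.
Qed.

(** * Riemann-Stieltjes integrals along rectifiable curves *)

Lemma mul_frac_le (R : realType) (e L : R) : 0 <= e -> 0 <= L -> e / (L + 1) * L <= e.
Proof.
move=> e0 L0; rewrite mulrAC ler_pdivrMr ?ltr_wpDl//.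
by rewrite mulrDr mulr1 lerDl.
Qed.

Section Partitions.
Variable R : realType.
Implicit Types (s : seq R) (g : R -> R[i]).

Definition tagged s (xi : nat -> R) (d : R) : Prop :=
  forall i, (i < size s)%N ->
    pt s i.+1 - pt s i < d /\ pt s i <= xi i <= pt s i.+1.

Lemma pt_size s : itv_partition 0 1 s -> pt s (size s) = 1.
Proof. exact: itv_partition_nth_size. Qed.

Lemma pt_itv s i : itv_partition 0 1 s -> 0 <= pt s i <= 1.
Proof.
move=> s01; case: (ltnP i (size s).+1) => si.
  by rewrite /pt itv_partition_nth_ge// itv_partition_nth_le.
by rewrite /pt nth_default// ler01 lexx.
Qed.

Lemma pt_le s i : itv_partition 0 1 s -> (i < size s)%N -> pt s i <= pt s i.+1.
Proof. by move=> [s01 _] si; move/(pathP 1): s01 => /(_ _ si) /ltW. Qed.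

Lemma tagged_itv s xi d i : itv_partition 0 1 s -> tagged s xi d ->
  (i < size s)%N -> 0 <= xi i <= 1.
Proof.
move=> s01 st si; have [_ /andP[a b]] := st i si.
have /andP[u _] := pt_itv i s01; have /andP[_ w] := pt_itv i.+1 s01.
by rewrite (le_trans u a) (le_trans b w).
Qed.

Lemma pt_telescope (V : zmodType) s (h : R -> V) : itv_partition 0 1 s ->
  \sum_(i < size s) (h (pt s i.+1) - h (pt s i)) = h 1 - h 0.
Proof.
move=> s01; rewrite -(big_mkord xpredT (fun i => h (pt s i.+1) - h (pt s i))).
by rewrite (@telescope_sumr _ 0 _ (h \o pt s))//= pt_size.
Qed.

Definition upart (n : nat) : seq R := mkseq (fun i => i.+1%:R / n.+1%:R) n.+1.

Lemma size_upart n : size (upart n) = n.+1.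
Proof. by rewrite size_mkseq. Qed.

Lemma pt_upart n i : (i <= n.+1)%N -> pt (upart n) i = i%:R / n.+1%:R.
Proof.
case: i => [|i] ni; first by rewrite /pt/= mul0r.
by rewrite /pt/= nth_mkseq.
Qed.

Lemma upart_itv n : itv_partition 0 1 (upart n).
Proof.
split.
  apply/(pathP 1) => i; rewrite size_upart => ni.
  have := pt_upart (ltnW ni); have := pt_upart ni; rewrite /pt /= => -> ->.
  by rewrite ltr_pM2r ?invr_gt0 ?ltr0n// ltr_nat.
rewrite (last_nth 1) size_upart; have := pt_upart (leqnn n.+1).
by rewrite /pt => ->; rewrite divff// pnatr_eq0.
Qed.

Lemma upart_step n i : (i < n.+1)%N ->
  pt (upart n) i.+1 - pt (upart n) i = n.+1%:R^-1.
Proof.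
move=> ni; rewrite !pt_upart//; last exact: ltnW.
by rewrite -mulrBl -natrB// subSnn mul1r.
Qed.

Lemma upart_mesh (d : R) : 0 < d -> exists N, forall n, (N <= n)%N ->
  tagged (upart n) (pt (upart n)) d.
Proof.
move=> d0; exists (Num.truncn d^-1) => n Nn i; rewrite size_upart => ni.
rewrite upart_step//; split.
  rewrite -[ltRHS]invrK ltf_pV2 ?posrE ?invr_gt0 ?ltr0n//.
  rewrite (lt_le_trans (truncnS_gt _))// ler_nat//.
by rewrite lexx/= pt_le ?size_upart//; exact: upart_itv.
Qed.

Definition clamp (a b x : R) := Num.max a (Num.min x b).

(** Cutting [p, p'] by [q, q'] gives the same piece as cutting [q, q'] by
    [p, p']. This compares two partitions on their common refinement without
    building it. *)
Lemma clamp_overlap (V : zmodType) (h : R -> V) (p p' q q' : R) :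
  p <= p' -> q <= q' ->
  h (clamp p p' q') - h (clamp p p' q) = h (clamp q q' p') - h (clamp q q' p) /\
  (h (clamp p p' q') - h (clamp p p' q) = 0 \/ (q <= p' /\ p <= q')).
Proof.
move=> pp qq; rewrite /clamp.
have [pq|] := boolP (p' <= q).
  rewrite (min_r (le_trans pq qq)) (min_r pq) (max_r pp).
  rewrite (min_l (le_trans pq qq)) (max_l pq) (min_l (le_trans pp (le_trans pq qq))).
  by rewrite (max_l (le_trans pp pq)) !subrr; split => //; left.
rewrite -ltNge => qp; have [qp2|] := boolP (q' <= p).
  rewrite (min_l (le_trans qp2 pp)) (max_l qp2) (min_l (ltW qp)).
  rewrite (max_l (le_trans qq qp2)) (min_r (le_trans qp2 pp)) (max_r qq).
  by rewrite (min_r qp2) (max_r qq) !subrr; split => //; left.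
rewrite -ltNge => pq2; split; last by right; split; exact: ltW.
rewrite (minC q' p') (min_l (ltW qp)) (min_l (ltW pq2)) (maxC q p).
congr (h _ - _); rewrite !max_r//.
  by rewrite le_min qq ltW.
by rewrite le_min pp ltW.
Qed.

Lemma clamp_ge (a b x : R) : x <= a -> a <= b -> clamp a b x = a.
Proof. by move=> xa ab; rewrite /clamp (min_l (le_trans xa ab)) (max_l xa). Qed.

Lemma clamp_le (a b x : R) : b <= x -> a <= b -> clamp a b x = b.
Proof. by move=> bx ab; rewrite /clamp (min_r bx) (max_r ab). Qed.

Lemma le_clamp (a b : R) : {homo clamp a b : x y / x <= y}.
Proof. by move=> x y xy; rewrite /clamp le_max2// le_min2. Qed.

Lemma clamp_itv (a b x : R) : 0 <= a -> a <= b -> b <= 1 -> 0 <= clamp a b x <= 1.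
Proof.
move=> a0 ab b1; rewrite /clamp le_max a0/= ge_max (le_trans ab b1)/=.
by rewrite ge_min b1 orbT.
Qed.

End Partitions.
Arguments upart {R} n.
Arguments upart_itv {R} n.

Section Dominated.
Variable R : realType.
Implicit Types (s : seq R) (g : R -> R[i]) (v : R -> R).

(** [v] plays the role of the arc length function of [g]. *)
Definition dominates g v : Prop :=
  forall s t : R, 0 <= s -> s <= t -> t <= 1 -> nm (g t - g s) <= v t - v s.

Lemma dominates_nd g v (s t : R) : dominates g v -> 0 <= s -> s <= t -> t <= 1 -> v s <= v t.
Proof. by move=> gv s0 st t1; rewrite -subr_ge0 (le_trans (nm_ge0 _) (gv _ _ _ _ _)). Qed.

Lemma length_ge0 g v : dominates g v -> 0 <= v 1 - v 0.
Proof. by move=> gv; rewrite subr_ge0; exact: dominates_nd gv _ _ _. Qed.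

Lemma bv_dominates (u : R -> R) (L : R) :
  (forall s, itv_partition 0 1 s ->
    \sum_(i < size s) `|u (pt s i.+1) - u (pt s i)| <= L) ->
  exists v : R -> R, forall s t : R, 0 <= s -> s <= t -> t <= 1 ->
    `|u t - u s| <= v t - v s.
Proof.
move=> H; have bu : bounded_variation 0 1 u.
  exists L => _ [s s01 <-]; rewrite /variation.
  by rewrite big_mkord; exact: H.
exists (fun t => fine (total_variation 0 t u)) => s t s0 st t1.
have TVf a b : 0 <= a -> a <= b -> b <= 1 -> total_variation a b u \is a fin_num.
  move=> a0 ab b1; apply/bounded_variationP => //.
  apply: (@bounded_variationl _ _ _ 1) => //.
  by apply: (@bounded_variationr _ 0) => //; exact: le_trans b1.
rewrite (total_variationD u s0 st) fineD; last 2 first.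
- by apply: TVf => //; exact: le_trans t1.
- exact: TVf.
rewrite addrAC subrr add0r -lee_fin fineK; last exact: TVf.
exact: total_variation_ge.
Qed.

Lemma rectifiable_dominates g : rectifiable g -> exists v, dominates g v.
Proof.
move=> [L HL].
have HL' s : itv_partition 0 1 s ->
    \sum_(i < size s) nm (g (pt s i.+1) - g (pt s i)) <= L.
  move=> /HL; rewrite -lecR; apply: le_trans; rewrite rmorph_sum/= le_eqVlt.
  by apply/orP; left; apply/eqP; apply: eq_bigr => i _; rewrite nmE.
have [|v1 H1] := @bv_dominates (fun t => complex.Re (g t)) L.
  move=> s s01; apply: le_trans (HL' _ s01); apply: ler_sum => i _.
  by rewrite -ReB Re_le_nm.
have [|v2 H2] := @bv_dominates (fun t => complex.Im (g t)) L.
  move=> s s01; apply: le_trans (HL' _ s01); apply: ler_sum => i _.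
  by rewrite -ImB Im_le_nm.
exists (v1 \+ v2) => s t s0 st t1 /=.
rewrite (le_trans (nm_le_ReIm _))// ReB ImB opprD addrACA lerD//; first exact: H1.
exact: H2.
Qed.

End Dominated.

Lemma closed_curve_dominates (R : realType) (g : R -> R[i]) :
  closed_rectifiable_curve g -> exists v, dominates g v.
Proof. by case=> _ _; exact: rectifiable_dominates. Qed.

Section RiemannSums.
Variables (R : realType) (V : normedModType R[i]).
Variables (g : R -> R[i]) (v : R -> R).
Hypothesis gv : dominates g v.
Implicit Types (s : seq R) (F : R[i] -> V) (xi : nat -> R) (x : V).

Definition osc F (d e : R) : Prop :=
  forall u w, 0 <= u <= 1 -> 0 <= w <= 1 -> `|u - w| < d ->
    nm (F (g u) - F (g w)) <= e.

Lemma curve_sum_clamp F s s' xi : itv_partition 0 1 s -> itv_partition 0 1 s' ->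
  curve_sum g F s xi =
  \sum_(i < size s) \sum_(j < size s')
     (g (clamp (pt s i) (pt s i.+1) (pt s' j.+1)) -
      g (clamp (pt s i) (pt s i.+1) (pt s' j))) *: F (g (xi i)).
Proof.
move=> s01 s01'; apply: eq_bigr => i _; rewrite -scaler_suml.
rewrite (pt_telescope (fun t : R => g (clamp (pt s i) (pt s i.+1) t)) s01').
have /andP[pi0 _] := pt_itv i s01; have /andP[_ pi1] := pt_itv i.+1 s01.
by rewrite clamp_le ?pt_le// clamp_ge ?pt_le.
Qed.

Lemma sum_clamp_dom s s' : itv_partition 0 1 s -> itv_partition 0 1 s' ->
  \sum_(i < size s) \sum_(j < size s')
     nm (g (clamp (pt s i) (pt s i.+1) (pt s' j.+1)) -
      g (clamp (pt s i) (pt s i.+1) (pt s' j))) <= v 1 - v 0.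
Proof.
move=> s01 s01'; rewrite -(pt_telescope v s01); apply: ler_sum => i _.
have /andP[pi0 _] := pt_itv i s01; have /andP[_ pi1] := pt_itv i.+1 s01.
have pp := pt_le s01 (ltn_ord i).
have := pt_telescope (fun t : R => v (clamp (pt s i) (pt s i.+1) t)) s01'.
rewrite [in RHS]clamp_le// [in RHS]clamp_ge// => <-; apply: ler_sum => j _.
apply: gv.
- by have /andP[] := clamp_itv (pt s' j) pi0 pp pi1.
- by apply: le_clamp; exact: pt_le.
- by have /andP[] := clamp_itv (pt s' j.+1) pi0 pp pi1.
Qed.

(** On each piece of the common refinement that is not degenerate, the two tags
    are at distance less than [d]. *)
Lemma curve_sum_close F s s' xi xi' (d e : R) : osc F d e ->
  itv_partition 0 1 s -> itv_partition 0 1 s' ->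
  tagged s xi (d / 2) -> tagged s' xi' (d / 2) ->
  nm (curve_sum g F s xi - curve_sum g F s' xi') <= e * (v 1 - v 0).
Proof.
move=> Fde s01 s01' sx sx'.
rewrite (curve_sum_clamp F xi s01 s01') (curve_sum_clamp F xi' s01' s01).
rewrite [X in _ - X]exchange_big/= -sumrB.
have e_ge0 : 0 <= e.
  have d0 : 0 < d.
    case: (s) s01 sx => [[_ /=]|a l s01 /(_ 0%N)]; first by rewrite eq_sym oner_eq0.
    have := pt_le s01 (ltn0Sn (size l)).
    by move=> h /(_ isT) []; lra.
  have := Fde 0 0; rewrite !subrr nm0 normr0 lexx ler01; exact.
apply: le_trans (_ : _ <= \sum_(i < size s) \sum_(j < size s')
     e * nm (g (clamp (pt s i) (pt s i.+1) (pt s' j.+1)) -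
      g (clamp (pt s i) (pt s i.+1) (pt s' j)))) _.
  apply: le_trans (nm_sum _) _; apply: ler_sum => i _; rewrite -sumrB.
  apply: le_trans (nm_sum _) _; apply: ler_sum => j _.
  have [<- ov] := clamp_overlap g (pt_le s01 (ltn_ord i)) (pt_le s01' (ltn_ord j)).
  rewrite -scalerBr nmZ mulrC.
  case: ov => [->|[h1 h2]]; first by rewrite nm0 !mulr0.
  rewrite ler_wpM2r ?nm_ge0//; apply: Fde.
  - exact: tagged_itv sx (ltn_ord i).
  - exact: tagged_itv sx' (ltn_ord j).
  - have [] := sx i (ltn_ord i); have [] := sx' j (ltn_ord j).
    move=> m1 /andP[b1 b2] m2 /andP[b3 b4].
    by rewrite ltr_norml; apply/andP; split; lra.
under eq_bigr do rewrite -mulr_sumr.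
by rewrite -mulr_sumr ler_wpM2l// sum_clamp_dom.
Qed.

Lemma ci_unique F x y : is_curve_integral g F x -> is_curve_integral g F y -> x = y.
Proof.
move=> Fx Fy; apply: nm_unique => e e0.
have e20 : 0 < e / 2 by rewrite divr_gt0.
have [d1 d10 H1] := Fx _ e20; have [d2 d20 H2] := Fy _ e20.
have [|N HN] := @upart_mesh R (Num.min d1 d2).
  by rewrite lt_min d10.
have {HN} T := HN _ (leqnn N).
have {}H1 := H1 (upart N) (pt (upart N)) (upart_itv N) _.
have {}H2 := H2 (upart N) (pt (upart N)) (upart_itv N) _.
rewrite (le_trans (nm_trans (curve_sum g F (upart N) (pt (upart N))) _ _))//.
rewrite [e]splitr lerD//.
  rewrite nmB ltW// -lt_nmC H1// => i ii; have [m b] := T i ii; split => //.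
  by rewrite (lt_le_trans m)// ge_min lexx.
rewrite ltW// -lt_nmC H2// => i ii; have [m b] := T i ii; split => //.
by rewrite (lt_le_trans m)// ge_min lexx orbT.
Qed.

Lemma curve_integralE F x : is_curve_integral g F x -> curve_integral g F = x.
Proof. by move=> Fx; rewrite /curve_integral; case: xgetP => [y _ /ci_unique/(_ Fx)//|/(_ x)]. Qed.

Lemma ci_close F s xi (d e : R) x : osc F d e -> is_curve_integral g F x ->
  itv_partition 0 1 s -> tagged s xi (d / 2) ->
  nm (curve_sum g F s xi - x) <= e * (v 1 - v 0).
Proof.
move=> Fde Fx s01 sx; apply/ler_addgt0Pr => e1 e10.
have [d1 d10 H1] := Fx _ e10.
have d0 : 0 < d / 2.
  case: (s) s01 sx => [[_ /=]|a l s01 /(_ 0%N)]; first by rewrite eq_sym oner_eq0.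
  have := pt_le s01 (ltn0Sn (size l)).
  by move=> h /(_ isT) []; lra.
have [|N HN] := @upart_mesh R (Num.min d1 (d / 2)); first by rewrite lt_min d10.
have {HN} T := HN _ (leqnn N).
rewrite (le_trans (nm_trans (curve_sum g F (upart N) (pt (upart N))) _ _))//.
apply: lerD.
  apply: curve_sum_close Fde s01 (upart_itv N) sx _ => i ii.
  by have [m b] := T i ii; split => //; rewrite (lt_le_trans m)// ge_min lexx orbT.
rewrite ltW// -lt_nmC H1//; first exact: upart_itv.
move=> i ii; have [m b] := T i ii; split => //.
by rewrite (lt_le_trans m)// ge_min lexx.
Qed.

Definition curve_cont F := forall e : R, 0 < e -> exists2 d : R, 0 < d & osc F d e.

(** Sums over fine partitions are close to one another, so the limit along one
    sequence of partitions is the integral. *)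
Lemma ci_upart F x : curve_cont F ->
  (forall e : R, 0 < e -> exists N, forall n, (N <= n)%N ->
     nm (curve_sum g F (upart n) (pt (upart n)) - x) <= e) ->
  is_curve_integral g F x.
Proof.
move=> Fc Hx e e0; pose L := v 1 - v 0.
have L0 : 0 <= L := length_ge0 gv.
have [|d d0 Fd] := Fc (e / 3 / (L + 1)); first by rewrite !divr_gt0// ltr_wpDl.
exists (d / 2); first by rewrite divr_gt0.
move=> s xi s01 sx.
have [N1 HN1] := @upart_mesh R (d / 2) (divr_gt0 d0 (ltr0Sn _ 1)).
have [|N2 HN2] := Hx (e / 3); first by rewrite divr_gt0.
pose n := maxn N1 N2; have {}HN1 := HN1 n (leq_maxl _ _).
have {}HN2 := HN2 n (leq_maxr _ _).
have H := curve_sum_close Fd s01 (upart_itv n) sx HN1.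
rewrite lt_nmC (le_lt_trans (nm_trans (curve_sum g F (upart n) (pt (upart n))) _ _))//.
have : e / 3 / (L + 1) * L <= e / 3.
  by apply: mul_frac_le => //; rewrite ltW// divr_gt0.
rewrite /L in H *; lra.
Qed.

End RiemannSums.

Section Existence.
Variables (R : realType) (V : completeNormedModType R[i]).
Variables (g : R -> R[i]) (v : R -> R).
Hypothesis gv : dominates g v.

Lemma ci_exists (F : R[i] -> V) : curve_cont g F -> exists x, is_curve_integral g F x.
Proof.
move=> Fc; pose S n := curve_sum g F (upart n) (pt (upart n)).
pose L := v 1 - v 0.
have L0 : 0 <= L := length_ge0 gv.
have Scauchy (e : R) : 0 < e -> exists N, forall m n, (N <= m)%N -> (N <= n)%N ->
    nm (S m - S n) <= e.
  move=> e0; have [|d d0 Fd] := Fc (e / (L + 1)); first by rewrite !divr_gt0// ltr_wpDl.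
  have [N HN] := @upart_mesh R (d / 2) (divr_gt0 d0 (ltr0Sn _ 1)).
  exists N => m n Nm Nn.
  have := curve_sum_close gv Fd (upart_itv m) (upart_itv n) (HN _ Nm) (HN _ Nn).
  by move/le_trans; apply; apply: mul_frac_le => //; exact: ltW.
by have [x Hx] := cauchy_lim Scauchy; exists x; apply: (ci_upart gv).
Qed.

End Existence.

Section ComplexComplete.
Variable R : realType.

(** Completeness lets integrals of complex-valued functions and integrals with
    values in the algebra be treated by the same theorems. *)
Lemma complex_complete (F : set_system R[i]) :
  ProperFilter F -> cauchy F -> cvg F.
Proof.
move=> FF /cauchyP Fc.
have proj (p : R[i] -> R) : (forall z w, `|p z - p w| <= nm (z - w)) -> cvg (p @ F).
  move=> Hp; apply/cauchy_cvgP/cauchy_exP => e e0.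
  have [|z Fz] := Fc e%:C; first by rewrite ltcR.
  exists (p z); rewrite /fmap/=; apply: filterS Fz => w /nm_ballE zw.
  by rewrite -ball_normE/= (le_lt_trans (Hp _ _)).
have /cvg_ex[a Fa] : cvg (@complex.Re R @ F).
  by apply: proj => z w; rewrite -ReB Re_le_nm.
have /cvg_ex[b Fb] : cvg (@complex.Im R @ F).
  by apply: proj => z w; rewrite -ImB Im_le_nm.
apply/cvg_ex; exists (a +i* b) => /= A /nbhs_nmP[e e0 eA].
have e20 : 0 < e / 2 by rewrite divr_gt0.
move/cvgrPdist_lt: Fa => /(_ _ e20) Fa; move/cvgrPdist_lt: Fb => /(_ _ e20) Fb.
apply: filterS (filterI Fa Fb) => z [/= za zb]; apply: eA.
by rewrite (le_lt_trans (nm_le_ReIm _))// ReB ImB/= [e]splitr ltrD.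
Qed.

HB.instance Definition _ := Uniform_isComplete.Build R[i] complex_complete.

End ComplexComplete.

Section IntegralTheory.
Variables (R : realType) (V : normedModType R[i]).
Variables (g : R -> R[i]) (v : R -> R).
Hypothesis gv : dominates g v.
Implicit Types (s : seq R) (F : R[i] -> V) (xi : nat -> R) (x : V).

Lemma curve_sum_bound F s xi (d e : R) : (forall t, 0 <= t <= 1 -> nm (F (g t)) <= e) ->
  itv_partition 0 1 s -> tagged s xi d -> nm (curve_sum g F s xi) <= e * (v 1 - v 0).
Proof.
move=> Fe s01 sx; rewrite -(pt_telescope v s01) mulr_sumr.
apply: le_trans (nm_sum _) _; apply: ler_sum => i _; rewrite nmZ mulrC.
have /andP[pi0 _] := pt_itv i s01; have /andP[_ pi1] := pt_itv i.+1 s01.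
rewrite ler_pM ?nm_ge0//; first by apply: Fe; exact: tagged_itv sx (ltn_ord i).
by apply: gv => //; exact: pt_le.
Qed.

Lemma curve_sumD F F' s xi :
  curve_sum g (fun z => F z + F' z) s xi = curve_sum g F s xi + curve_sum g F' s xi.
Proof. by rewrite -big_split; apply: eq_bigr => i _; rewrite scalerDr. Qed.

Lemma curve_sumZ (k : R[i]) F s xi :
  curve_sum g (fun z => k *: F z) s xi = k *: curve_sum g F s xi.
Proof. by rewrite scaler_sumr; apply: eq_bigr => i _; rewrite !scalerA mulrC. Qed.

Lemma ci_lim F x : (forall e : R, 0 < e -> exists F' x', [/\ is_curve_integral g F' x',
    forall t, 0 <= t <= 1 -> nm (F (g t) - F' (g t)) <= e & nm (x' - x) <= e]) ->
  is_curve_integral g F x.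
Proof.
move=> H e e0; pose L := v 1 - v 0; have L0 : 0 <= L := length_ge0 gv.
have [|F' [x' [F'x' FF' xx']]] := H (e / 3 / (L + 1)); first by rewrite !divr_gt0// ltr_wpDl.
have [|d d0 Hd] := F'x' (e / 3); first by rewrite divr_gt0.
exists d => // s xi s01 sx; rewrite lt_nmC.
rewrite (le_lt_trans (nm_trans (curve_sum g F' s xi) _ _))//.
have h1 : nm (curve_sum g F s xi - curve_sum g F' s xi) <= e / 3.
  rewrite -scaleN1r -curve_sumZ -curve_sumD.
  rewrite (le_trans (curve_sum_bound (d := d) _ s01 sx) (@mul_frac_le _ (e / 3) L _ _))//.
    by move=> t t01; rewrite scaleN1r FF'.
  by rewrite divr_ge0// ltW.
have h2 : nm (curve_sum g F' s xi - x') < e / 3 by rewrite -lt_nmC Hd.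
have h3 : nm (x' - x) <= e / 3.
  rewrite (le_trans xx')// ler_pdivrMr ?ltr_wpDl//.
  by rewrite mulrDr mulr1 lerDr mulr_ge0// divr_ge0// ltW.
rewrite (le_lt_trans (lerD h1 (nm_trans x' _ _)))//.
by move: h1 h2 h3; lra.
Qed.

Lemma ci_ext F F' x : (forall t, 0 <= t <= 1 -> F (g t) = F' (g t)) ->
  is_curve_integral g F x -> is_curve_integral g F' x.
Proof.
move=> FF Fx; apply: ci_lim => e e0; exists F, x; split => //.
  by move=> t t01; rewrite FF// subrr nm0 ltW.
by rewrite subrr nm0 ltW.
Qed.

Lemma ciD F F' x x' : is_curve_integral g F x -> is_curve_integral g F' x' ->
  is_curve_integral g (fun z => F z + F' z) (x + x').
Proof.
move=> Fx Fx' e e0; have e20 : 0 < e / 2 by rewrite divr_gt0.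
have [d1 d10 H1] := Fx _ e20; have [d2 d20 H2] := Fx' _ e20.
exists (Num.min d1 d2); first by rewrite lt_min d10.
move=> s xi s01 sx; rewrite curve_sumD opprD addrACA lt_nmC.
rewrite (le_lt_trans (nmD _ _))// [e]splitr ltrD//.
  rewrite -lt_nmC H1// => i ii; have [m b] := sx i ii; split => //.
  by rewrite (lt_le_trans m)// ge_min lexx.
rewrite -lt_nmC H2// => i ii; have [m b] := sx i ii; split => //.
by rewrite (lt_le_trans m)// ge_min lexx orbT.
Qed.

Lemma ciZ (k : R[i]) F x : is_curve_integral g F x ->
  is_curve_integral g (fun z => k *: F z) (k *: x).
Proof.
move=> Fx e e0; have [|d d0 H] := Fx (e / (nm k + 1)).
  by rewrite divr_gt0// ltr_wpDl// nm_ge0.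
exists d => // s xi s01 sx; rewrite curve_sumZ -scalerBr lt_nmC nmZ.
have := H s xi s01 sx; rewrite lt_nmC ltr_pdivlMr ?ltr_wpDl ?nm_ge0//.
by apply: le_lt_trans; rewrite mulrC ler_wpM2l ?nm_ge0// lerDl.
Qed.

Lemma ci0 : is_curve_integral g (fun=> 0 : V) 0.
Proof.
move=> e e0; exists 1 => // s xi _ _.
by rewrite /curve_sum big1 ?subrr ?normr0 ?ltcR// => i _; rewrite scaler0.
Qed.

Lemma ci_sum n (F : 'I_n -> R[i] -> V) (x : 'I_n -> V) :
  (forall i, is_curve_integral g (F i) (x i)) ->
  is_curve_integral g (fun z => \sum_(i < n) F i z) (\sum_(i < n) x i).
Proof.
elim: n F x => [|n ih] F x Fx.
  by rewrite big_ord0; under [fun z => _]eq_fun do rewrite big_ord0; exact: ci0.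
rewrite big_ord_recl; under [fun z => _]eq_fun do rewrite big_ord_recl.
by apply: ciD => //; exact: ih.
Qed.

Lemma ci_bound F x (e : R) : (forall t, 0 <= t <= 1 -> nm (F (g t)) <= e) ->
  is_curve_integral g F x -> nm x <= e * (v 1 - v 0).
Proof.
move=> Fe Fx; apply/ler_addgt0Pl => e1 e10; have [d d0 H] := Fx _ e10.
have [N HN] := upart_mesh d0; have T := HN _ (leqnn N).
have := H (upart N) (pt (upart N)) (upart_itv N) T; rewrite lt_nmC => /ltW h1.
rewrite -(subrK (curve_sum g F (upart N) (pt (upart N))) x) (le_trans (nmD _ _))//.
by rewrite lerD// ?(curve_sum_bound Fe (upart_itv N) T)// nmB.
Qed.

End IntegralTheory.

Section CurveContinuity.
Variables (R : realType) (V : normedModType R[i]) (g : R -> R[i]).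
Hypothesis gc : {within `[0, 1], continuous g}.

Lemma curve_eps_delta t (e : R) : 0 <= t <= 1 -> 0 < e -> exists2 d : R, 0 < d &
  forall s, 0 <= s <= 1 -> `|s - t| < d -> nm (g s - g t) < e.
Proof.
move=> t01 e0; move/subspace_continuousP : gc => /(_ t).
rewrite /= in_itv/= => /(_ t01)/cvgrPdist_lt/(_ e%:C).
rewrite ltcR => /(_ e0) [d /= d0 H]; exists d => // s s01 st.
rewrite nmB -lt_nmC; apply: H => /=; last by rewrite in_itv.
by rewrite distrC.
Qed.

(** By compactness of the parameter interval, pointwise continuity at the points
    of the trace suffices. *)
Lemma curve_contP (F : R[i] -> V) :
  (forall t, 0 <= t <= 1 -> forall e : R, 0 < e -> exists2 d : R, 0 < d &
     forall z, nm (z - g t) < d -> nm (F z - F (g t)) < e) -> curve_cont g F.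
Proof.
move=> Fc e e0.
have [|d d0 H] := @compact_uniform R 0 1 (fun d u => forall w, 0 <= w <= 1 ->
    `|u - w| < d -> nm (F (g u) - F (g w)) <= e); last first.
  by exists d => // u w u01 w01 uw; exact: H.
move=> t t01; have [|d1 d10 H1] := Fc t t01 (e / 2); first by rewrite divr_gt0.
have [d2 d20 H2] := curve_eps_delta t01 d10.
exists (d2 / 2); first by rewrite divr_gt0.
move=> s e1 s01 st e1d w w01 sw.
rewrite (le_trans (nm_trans (F (g t)) _ _))// [e]splitr lerD//.
  by rewrite ltW// H1// H2//; lra.
rewrite nmB ltW// H1// H2//; move: st sw e1d; rewrite !ltr_norml; lra.
Qed.

End CurveContinuity.

(** * Winding numbers *)

Lemma twopii_neq0 (R : realType) : twopii R != 0.
Proof. by rewrite /twopii eq_complex/= eqxx/= mulf_neq0// gt_eqF// pi_gt0. Qed.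

Section Winding.
Variables (R : realType) (g : R -> R[i]).
Hypothesis gcr : closed_rectifiable_curve g.
Implicit Types (z w : R[i]) (t s : R).

Let gc : {within `[0, 1], continuous g}. Proof. by case: gcr. Qed.
Let g01 : g 0 = g 1. Proof. by case: gcr. Qed.
Let gdom : exists v, dominates g v. Proof. exact: closed_curve_dominates. Qed.

Definition avoids w (d : R) := forall t, 0 <= t <= 1 -> d <= nm (g t - w).

Lemma not_trace w t : ~ trace g w -> 0 <= t <= 1 -> g t - w != 0.
Proof.
move=> nw t01; apply/negP => /eqP/subr0_eq gw.
by apply: nw; exists t => //=; rewrite in_itv.
Qed.

Lemma trace_avoids w : ~ trace g w -> exists2 d : R, 0 < d & avoids w d.
Proof.
move=> nw; apply: (@compact_uniform R 0 1 (fun d t => d <= nm (g t - w))).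
move=> t t01; have p0 : 0 < nm (g t - w) by rewrite nm_gt0 not_trace.
have p20 : 0 < nm (g t - w) / 2 by rewrite divr_gt0.
have [d d0 H] := curve_eps_delta gc t01 p20.
exists (Num.min d (nm (g t - w) / 2)); first by rewrite lt_min d0.
move=> s e s01; rewrite lt_min => /andP[std _] /andP[e0].
rewrite lt_min => /andP[_ e2]; have := H s s01 std.
by have := nm_trans (g s) (g t) w; rewrite (nmB (g t) (g s)); lra.
Qed.

Lemma avoids_gt0 w (d : R) t : 0 < d -> avoids w d -> 0 <= t <= 1 -> g t - w != 0.
Proof. by move=> d0 wd t01; rewrite -nm_gt0 (lt_le_trans d0)// wd. Qed.

Lemma avoids_inv w (d : R) t : 0 < d -> avoids w d -> 0 <= t <= 1 -> nm (g t - w)^-1 <= d^-1.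
Proof. by move=> d0 wd t01; rewrite nmV lef_pV2 ?posrE ?wd// nm_gt0 (avoids_gt0 d0 wd). Qed.

Lemma avoids_cont w (d : R) : 0 < d -> avoids w d -> curve_cont g (fun z => (z - w)^-1).
Proof.
move=> d0 wd; apply: curve_contP => // t t01 e e0.
have e'0 : 0 < Num.min (d / 2) (e * (d / 2) ^+ 2).
  by rewrite lt_min divr_gt0//= mulr_gt0// exprn_gt0// divr_gt0.
exists (Num.min (d / 2) (e * (d / 2) ^+ 2)) => // z.
rewrite lt_min => /andP[z1 z2].
have d20 : 0 < d / 2 by rewrite divr_gt0.
have h1 : d / 2 <= nm (g t - w) by rewrite (le_trans _ (wd t t01))//; lra.
have h2 : d / 2 <= nm (z - w).
  by have := wd t t01; have := nm_trans z (g t) w; rewrite (nmB (g t) z); lra.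
rewrite (le_lt_trans (nm_invB d20 h2 h1))// opprB addrA subrK mulrC.
by rewrite -ltr_pdivlMr ?invr_gt0 ?exprn_gt0// invrK.
Qed.

Lemma ci_inv w : ~ trace g w ->
  is_curve_integral g (fun z => (z - w)^-1) (twopii R * winding_number g w).
Proof.
move=> nw; have [d d0 wd] := trace_avoids nw; have [v gv] := gdom.
have [x Hx] := ci_exists gv (avoids_cont d0 wd).
by rewrite /winding_number (curve_integralE Hx) mulrA mulfV ?mul1r// twopii_neq0.
Qed.

(** [(z - w)^-2] has the primitive [- (z - w)^-1]. *)
Lemma ci_inv2 w (d : R) : 0 < d -> avoids w d ->
  is_curve_integral g (fun z => (z - w)^-1 ^+ 2) 0.
Proof.
move=> d0 wd; have [v gv] := gdom.
have invb t t01 := avoids_inv d0 wd t01 (t := t).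
apply: (ci_upart gv).
  have wc := avoids_cont d0 wd => e e0.
  have [|d1 d10 H1] := wc (e / (2 * d^-1)).
    by rewrite divr_gt0// mulr_gt0 ?invr_gt0.
  exists d1 => // a b a01 b01 ab.
  rewrite subr_sqr nmM.
  apply: le_trans (ler_pM _ _ (H1 _ _ a01 b01 ab) (nmD _ _)) _; rewrite ?nm_ge0//.
  rewrite mulrAC ler_pdivrMr ?mulr_gt0 ?invr_gt0// ler_wpM2l ?(ltW e0)//.
  have := invb _ a01; have := invb _ b01. lra.
pose L := v 1 - v 0.
have L0 : 0 <= L := length_ge0 gv.
move=> e e0.
have idc : curve_cont g (id : R[i] -> R[i]).
  by apply: (curve_contP gc) => t t01 e1 e10; exists e1.
have [|d1 d10 H1] := idc (e / (L + 1) * d ^+ 3).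
  by rewrite mulr_gt0 ?exprn_gt0// divr_gt0// ltr_wpDl.
have [N HN] := upart_mesh d10; exists N => n Nn; have T := HN n Nn; rewrite subr0.
have := pt_telescope (fun t => - (g t - w)^-1) (upart_itv n).
rewrite -g01 subrr => tel.
rewrite -[curve_sum _ _ _ _]subr0 -tel -sumrB.
apply: le_trans (nm_sum _) _.
apply: (@le_trans _ _ (e / (L + 1) * L)); last by apply: mul_frac_le => //; exact: ltW.
rewrite -[X in _ <= _ * X](pt_telescope v (upart_itv n)) mulr_sumr.
apply: ler_sum => i _; have [] := T i (ltn_ord i).
set p := pt _ _; set q := pt _ _ => pq /andP[_ qp].
have /andP[q0 q1] : 0 <= q <= 1 := pt_itv _ (upart_itv n).
have /andP[p0 p1] : 0 <= p <= 1 := pt_itv _ (upart_itv n).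
have a0 : g q - w != 0 by rewrite (avoids_gt0 d0)// q0.
have b0 : g p - w != 0 by rewrite (avoids_gt0 d0)// p0.
have -> : (g p - g q) *: (g q - w)^-1 ^+ 2 - (- (g p - w)^-1 - - (g q - w)^-1) =
    (g p - g q) * ((g p - g q) * ((g q - w)^-1 * (g q - w)^-1 * (g p - w)^-1)).
  by rewrite /GRing.scale/=; field; rewrite ?a0 ?b0.
have h1 : nm (g p - g q) <= v p - v q by apply: gv.
have h2 : nm (g p - g q) <= e / (L + 1) * d ^+ 3.
  by apply: H1; rewrite ?p0 ?q0// ger0_norm// subr_ge0.
rewrite nmM mulrC ler_pM ?nm_ge0// !nmM.
apply: (@le_trans _ _ (e / (L + 1) * d ^+ 3 * (d^-1 * d^-1 * d^-1))).
  by rewrite !ler_pM ?mulr_ge0 ?nm_ge0 ?invb ?p0 ?q0.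
have dn0 : d != 0 by rewrite gt_eqF.
apply: le_of_eq; field; rewrite dn0 gt_eqF//.
by rewrite ltr_wpDl.
Qed.

(** The first-order term [(w - w') * (z - w)^-2] of the difference of the two
    integrands integrates to 0. *)
Lemma winding_step : exists2 C : R, 0 <= C & forall w w' (d : R),
  0 < d -> avoids w d -> avoids w' d ->
  nm (winding_number g w - winding_number g w') <= C / d ^+ 3 * nm (w - w') ^+ 2.
Proof.
have [v gv] := gdom; pose L := v 1 - v 0.
have L0 : 0 <= L := length_ge0 gv.
exists (nm (twopii R)^-1 * L); first by rewrite mulr_ge0 ?nm_ge0.
move=> w w' d d0 wd wd'.
have nt u : avoids u d -> ~ trace g u.
  move=> ud [t]; rewrite /= in_itv/= => t01 gt; have := ud t t01.
  by rewrite gt subrr nm0 leNgt d0.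
have := ciD (ciD (ci_inv (nt _ wd)) (ciZ (-1) (ci_inv (nt _ wd'))))
            (ciZ (w' - w) (ci_inv2 d0 wd)).
rewrite scaler0 addr0 scaleN1r -mulrBr => /(ci_bound gv).
have t0 := twopii_neq0 R.
move=> /(_ (nm (w - w') ^+ 2 / d ^+ 3)) H.
rewrite -[X in nm X](mulKf t0) nmM -!mulrA ler_wpM2l ?nm_ge0//.
apply: le_trans (H _) _; last first.
  by apply: le_of_eq; rewrite /L; field; rewrite gt_eqF.
move=> t t01.
have a0 : g t - w != 0 by exact: avoids_gt0 wd _.
have b0 : g t - w' != 0 by exact: avoids_gt0 wd' _.
have invb u ud := avoids_inv d0 ud t01 (w := u).
have -> : (g t - w)^-1 + (-1 *: (g t - w')^-1) + (w' - w) *: (g t - w)^-1 ^+ 2 =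
   (w - w') ^+ 2 * - ((g t - w)^-1 * (g t - w)^-1 * (g t - w')^-1).
  by rewrite /GRing.scale/=; field; rewrite ?a0 ?b0.
rewrite nmM nmN !nmM -expr2 ler_wpM2l ?exprn_ge0 ?nm_ge0//.
apply: (@le_trans _ _ (d^-1 * d^-1 * d^-1)).
  by rewrite !ler_pM ?mulr_ge0 ?nm_ge0 ?invb.
by rewrite (_ : _ * _ = (d ^+ 3)^-1)//; field; rewrite gt_eqF.
Qed.

(** Cut the segment into [n] equal pieces: each increment is O(n^-2), so the
    [n] increments add up to O(n^-1). *)
Lemma winding_segment w w' :
  (forall t, 0 <= t <= 1 -> ~ trace g (w + t%:C * (w' - w))) ->
  winding_number g w = winding_number g w'.
Proof.
move=> H; pose q t := w + t%:C * (w' - w).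
have [d d0 qd] : exists2 d : R, 0 < d & forall t, 0 <= t <= 1 -> avoids (q t) d.
  apply: (@compact_uniform R 0 1 (fun d t => avoids (q t) d)) => t t01.
  have [d d0 qd] := trace_avoids (H t t01).
  have nm1_gt0 : 0 < nm (w' - w) + 1 by rewrite ltr_wpDl// nm_ge0.
  exists (Num.min (d / 2) (d / 2 / (nm (w' - w) + 1))).
    by rewrite lt_min !divr_gt0.
  move=> s e s01; rewrite lt_min => /andP[_ st] /andP[_].
  rewrite lt_min => /andP[ed _] u u01; have := qd u u01.
  have : nm (q s - q t) <= d / 2.
    rewrite /q opprD addrACA subrr add0r -mulrBl -rmorphB nmM nmC.
    move: st; rewrite ltr_pdivlMr// => /ltW; apply: le_trans.
    by rewrite ler_wpM2l// lerDl.
  by have := nm_trans (q s) (g u) (q t); lra.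
have [C C0 HC] := winding_step.
apply: nm_unique => e e0.
pose K := C / d ^+ 3 * nm (w' - w) ^+ 2.
have K0 : 0 <= K by rewrite mulr_ge0 ?exprn_ge0 ?nm_ge0// divr_ge0// exprn_ge0// ltW.
pose n := Num.truncn (K / e).
have nK : K / n.+1%:R <= e.
  by rewrite ler_pdivrMr ?ltr0n// mulrC -ler_pdivrMr// ltW// truncnS_gt.
have tel := pt_telescope (fun t => winding_number g (q t)) (upart_itv n).
have q0 : q 0 = w by rewrite /q rmorph0 mul0r addr0.
have q1 : q 1 = w' by rewrite /q rmorph1 mul1r addrC subrK.
rewrite q0 q1 in tel; rewrite nmB -tel.
apply: le_trans (nm_sum _) _; apply: le_trans nK.
apply: (@le_trans _ _ (\sum_(i < size (upart n : seq R)) K / n.+1%:R ^+ 2)).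
  apply: ler_sum => i _.
  have ii : (i < n.+1)%N by rewrite -(size_upart R n).
  apply: le_trans (HC _ _ d d0 _ _) _; try by apply: qd; exact: pt_itv (upart_itv n).
  rewrite /q opprD addrACA subrr add0r -mulrBl -rmorphB upart_step// nmM nmC exprMn.
  by rewrite ger0_norm ?invr_ge0// exprVn mulrCA mulrC.
rewrite sumr_const card_ord size_upart -(mulr_natr (K / n.+1%:R ^+ 2)).
have : n.+1%:R != 0 :> R by rewrite pnatr_eq0.
by move: n.+1%:R => N N0; apply: le_of_eq; field; rewrite N0.
Qed.

(** The winding number is constant along the ray and tends to 0 at infinity. *)
Lemma winding_ray w u : u != 0 ->
  (forall t, 0 <= t -> ~ trace g (w + t%:C * u)) -> winding_number g w = 0.
Proof.
move=> u0 H; have [v gv] := gdom; pose L := v 1 - v 0.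
have L0 : 0 <= L := length_ge0 gv.
apply: nm_unique => e e0; rewrite subr0.
have nmu : 0 < nm u by rewrite nm_gt0.
have gL t : 0 <= t <= 1 -> nm (g t - g 0) <= L.
  move=> /andP[t0 t1]; apply: le_trans (gv 0 t _ _ _) _ => //.
  by rewrite /L lerD2r (dominates_nd gv).
pose T := (nm (twopii R)^-1 * L / e + L + nm (w - g 0) + 1) / nm u.
have e'0 : 0 <= nm (twopii R)^-1 * L / e.
  by rewrite divr_ge0 ?mulr_ge0 ?nm_ge0// ltW.
have T0 : 0 <= T.
  apply: divr_ge0; last exact: nm_ge0.
  by have := nm_ge0 (w - g 0); lra.
pose w' := w + T%:C * u.
have -> : winding_number g w = winding_number g w'.
  apply: winding_segment => t /andP[t0 t1].
  have -> : w + t%:C * (w' - w) = w + (t * T)%:C * u.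
    by rewrite /w' [w + T%:C * u]addrC addrK mulrA -(rmorphM (real_complex R) t T).
  by apply: H; rewrite mulr_ge0.
have far t : 0 <= t <= 1 -> nm (twopii R)^-1 * L / e + 1 <= nm (g t - w').
  move=> t01; have := gL t t01.
  have -> : g t - w' = (g t - g 0) - (w - g 0) - T%:C * u by rewrite /w'; ring.
  have h1 : nm (T%:C * u) = nm (twopii R)^-1 * L / e + L + nm (w - g 0) + 1.
    by rewrite nmM nmC ger0_norm// divfK// gt_eqF.
  set a := g t - g 0; set b := w - g 0; set c := T%:C * u.
  have := nm_sub (a - b) (a - b - c); have := nm_sub a b; rewrite subKr.
  by move: h1; rewrite -/b -/c; lra.
have nt : ~ trace g w' by apply: H.
pose D := nm (twopii R)^-1 * L / e + 1.
have D0 : 0 < D by rewrite ltr_wpDl.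
have t0 := twopii_neq0 R.
have := ci_bound gv (e := D^-1) _ (ci_inv nt).
rewrite -[X in _ -> X <= _](_ : nm ((twopii R)^-1 * (twopii R * winding_number g w')) = _); last first.
  by rewrite mulKf.
move=> H1; rewrite nmM; apply: le_trans (ler_wpM2l (nm_ge0 _) (H1 _)) _.
  move=> t t01; rewrite nmV lef_pV2 ?posrE ?far// nm_gt0 not_trace//.
rewrite mulrCA mulrC ler_pdivrMr// -/L.
have -> : e * D = nm (twopii R)^-1 * L + e by rewrite /D; field; rewrite gt_eqF.
by rewrite lerDl ltW.
Qed.

End Winding.

(** * Cauchy's theorem and formula on rectangles *)

Section ComplexIntegral.
Variable R : realType.
Implicit Types (phi psi : R -> R[i]) (a b c : R).
Let mu := (@lebesgue_measure R).

Definition cint phi a b : R[i] :=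
  (\int[mu]_(t in `[a, b]) complex.Re (phi t)) +i*
  (\int[mu]_(t in `[a, b]) complex.Im (phi t)).

Definition seg_cont phi a b : Prop := forall t, a <= t <= b ->
  forall e : R, 0 < e -> exists2 d : R, 0 < d & forall s, a <= s <= b ->
    `|s - t| < d -> nm (phi s - phi t) < e.

Lemma seg_contS phi a b a' b' : a <= a' -> b' <= b -> seg_cont phi a b ->
  seg_cont phi a' b'.
Proof.
move=> aa bb H t /andP[t1 t2] e e0; have [|d d0 Hd] := H t _ e e0.
  by rewrite (le_trans aa t1) (le_trans t2 bb).
exists d => // s /andP[s1 s2] st; apply: Hd => //.
by rewrite (le_trans aa s1) (le_trans s2 bb).
Qed.

Let proj_integrable (p : R[i] -> R) phi a b :
  (forall z w, `|p z - p w| <= nm (z - w)) -> seg_cont phi a b ->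
  mu.-integrable `[a, b] (EFin \o (fun t => p (phi t))).
Proof.
move=> Hp Hphi; apply: continuous_compact_integrable; first exact: segment_compact.
apply/subspace_continuousP => t /=; rewrite in_itv/= => tab.
apply/cvgrPdist_lt => e e0; have [d d0 H] := Hphi t tab e e0.
exists d => //= s st sab; rewrite (le_lt_trans (Hp _ _))// nmB.
by apply: H; [move: sab; rewrite /= in_itv|rewrite distrC].
Qed.

Lemma Re_lip (z w : R[i]) : `|complex.Re z - complex.Re w| <= nm (z - w).
Proof. by rewrite -ReB Re_le_nm. Qed.

Lemma Im_lip (z w : R[i]) : `|complex.Im z - complex.Im w| <= nm (z - w).
Proof. by rewrite -ImB Im_le_nm. Qed.

Let Re_integrable phi a b := @proj_integrable _ phi a b Re_lip.
Let Im_integrable phi a b := @proj_integrable _ phi a b Im_lip.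

Lemma seg_contB phi psi a b : seg_cont phi a b -> seg_cont psi a b ->
  seg_cont (fun t => phi t - psi t) a b.
Proof.
move=> H1 H2 t tab e e0; have e20 : 0 < e / 2 by rewrite divr_gt0.
have [d1 d10 {}H1] := H1 t tab _ e20; have [d2 d20 {}H2] := H2 t tab _ e20.
exists (Num.min d1 d2); first by rewrite lt_min d10.
move=> s sab; rewrite lt_min => /andP[s1 s2].
have -> : phi s - psi s - (phi t - psi t) = (phi s - phi t) - (psi s - psi t) by ring.
by rewrite (le_lt_trans (nm_sub _ _))// [e]splitr ltrD ?H1// H2.
Qed.

Lemma seg_cont_cst (k : R[i]) a b : seg_cont (fun=> k) a b.
Proof. by move=> t _ e e0; exists 1 => // s _ _; rewrite subrr nm0. Qed.

Let Rint_cat (u : R -> R) a b c : a <= b -> b <= c ->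
  mu.-integrable `[a, c] (EFin \o u) ->
  \int[mu]_(t in `[a, c]) u t = \int[mu]_(t in `[a, b]) u t + \int[mu]_(t in `[b, c]) u t.
Proof.
move=> ab bc iu.
have := @Rintegral_itvB R u (BLeft a) (BRight c) b iu.
rewrite !bnd_simp => /(_ ab bc) H.
rewrite -[LHS](subrK (\int[mu]_(t in `[a, b]) u t)) H addrC; congr (_ + _).
apply: Rintegral_itv_obnd_cbnd.
apply: integrableS iu => //; apply: subset_itv; rewrite bnd_simp//.
Qed.

Lemma cint_cat phi a b c : a <= b -> b <= c -> seg_cont phi a c ->
  cint phi a c = cint phi a b + cint phi b c.
Proof.
move=> ab bc H; rewrite /cint; have := Re_integrable H; have := Im_integrable H.
by move=> hI hR; rewrite (Rint_cat ab bc hR) (Rint_cat ab bc hI).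
Qed.

Lemma cintB phi psi a b : seg_cont phi a b -> seg_cont psi a b ->
  cint (fun t => phi t - psi t) a b = cint phi a b - cint psi a b.
Proof.
move=> H1 H2; rewrite /cint.
have -> : \int[mu]_(t in `[a, b]) complex.Re (phi t - psi t) =
          \int[mu]_(t in `[a, b]) (complex.Re (phi t) - complex.Re (psi t)).
  by apply: eq_Rintegral => t _; rewrite ReB.
have -> : \int[mu]_(t in `[a, b]) complex.Im (phi t - psi t) =
          \int[mu]_(t in `[a, b]) (complex.Im (phi t) - complex.Im (psi t)).
  by apply: eq_Rintegral => t _; rewrite ImB.
by rewrite !RintegralB//; [exact: Im_integrable..|exact: Re_integrable|exact: Re_integrable].
Qed.

Lemma cintZ (k : R[i]) phi a b : seg_cont phi a b ->
  cint (fun t => k * phi t) a b = k * cint phi a b.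
Proof.
move=> H; rewrite /cint; have iR := Re_integrable H; have iI := Im_integrable H.
have iZ (u : R -> R) (r : R) : mu.-integrable `[a, b] (EFin \o u) ->
    mu.-integrable `[a, b] (EFin \o (fun t => r * u t)).
  move=> iu.
  have iu' : mu.-integrable `[a, b] (fun t => r%:E * (EFin \o u) t)%E.
    exact: integrableZl.
  by apply: eq_integrable iu' => // t _ /=; rewrite EFinM.
have -> : \int[mu]_(t in `[a, b]) complex.Re (k * phi t) =
   \int[mu]_(t in `[a, b]) (complex.Re k * complex.Re (phi t) - complex.Im k * complex.Im (phi t)).
  by apply: eq_Rintegral => t _; case: (k) (phi t) => [? ?] [? ?].
have -> : \int[mu]_(t in `[a, b]) complex.Im (k * phi t) =
   \int[mu]_(t in `[a, b]) (complex.Re k * complex.Im (phi t) + complex.Im k * complex.Re (phi t)).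
  by apply: eq_Rintegral => t _; case: (k) (phi t) => [? ?] [? ?] /=.
rewrite RintegralB ?RintegralD//; try exact: iZ.
by rewrite !RintegralZl//; case: (k).
Qed.

Let mu_itv a b : a <= b -> fine (mu `[a, b]) = b - a.
Proof.
move=> ab; rewrite /mu lebesgue_measure_itv/= lte_fin.
by case: ltgtP ab => [//|//|->]; rewrite /= subrr.
Qed.

Lemma cint_cst (k : R[i]) a b : a <= b -> cint (fun=> k) a b = (b - a)%:C * k.
Proof.
move=> ab; rewrite /cint !Rintegral_cst//.
by rewrite !mu_itv//; case: k => k1 k2; simpc => /=; rewrite mulrC (mulrC k2).
Qed.

(** The factor 2 pays for bounding real and imaginary parts separately. *)
Lemma cint_bound phi a b (e : R) : a <= b -> seg_cont phi a b ->
  (forall t, a <= t <= b -> nm (phi t) <= e) -> nm (cint phi a b) <= 2 * e * (b - a).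
Proof.
move=> ab H He; have iR := Re_integrable H; have iI := Im_integrable H.
have bd (u : R -> R) : mu.-integrable `[a, b] (EFin \o u) ->
    (forall t, a <= t <= b -> `|u t| <= e) -> `|\int[mu]_(t in `[a, b]) u t| <= e * (b - a).
  move=> iu ue; apply: le_trans (le_normr_Rintegral _ iu) _ => //.
  have -> : e * (b - a) = \int[mu]_(t in `[a, b]) e.
    by rewrite Rintegral_cst// mu_itv.
  apply: le_Rintegral => //.
  - exact: (integrable_abse iu).
  - apply: continuous_compact_integrable; first exact: segment_compact.
    by apply: continuous_subspaceT => x; exact: cvg_cst.
have -> : 2 * e * (b - a) = e * (b - a) + e * (b - a) by ring.
apply: le_trans (nm_le_ReIm _) _; apply: lerD => /=.
  by apply: bd => // t tab; rewrite (le_trans (Re_le_nm _))// He.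
by apply: bd => // t tab; rewrite (le_trans (Im_le_nm _))// He.
Qed.

End ComplexIntegral.

Section Rectangles.
Variable R : realType.
Implicit Types (F : R[i] -> R[i]) (z w p : R[i]) (a b c d x y e : R).

Definition cts F z : Prop := forall e, 0 < e -> exists2 d, 0 < d &
  forall w, nm (w - z) < d -> nm (F w - F z) < e.

Definition hol F z : Prop := exists l : R[i], forall e, 0 < e -> exists2 d, 0 < d &
  forall w, nm (w - z) < d -> nm (F w - F z - l * (w - z)) <= e * nm (w - z).

Lemma derivable_hol F z : derivable F z 1 -> hol F z.
Proof.
move=> /cvg_ex[/= l Fl]; exists l => e e0.
have e0' : 0 < e%:C by rewrite ltcR.
move/cvgrPdist_lt: Fl => /(_ _ e0')/nbhs_nmP[d d0 H].
exists d => // w wz; have [->|wz0] := eqVneq w z.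
  by rewrite !subrr mulr0 subr0 nm0 mulr0.
have wz0' : w - z != 0 by rewrite subr_eq0.
have := H (w - z); rewrite sub0r nmN => /(_ wz wz0').
rewrite /= (_ : (w - z) *: 1 = w - z); last exact: mulr1.
rewrite subrK lt_nmC => /ltW h1.
have -> : F w - F z - l * (w - z) =
    - ((l - (w - z)^-1 * (F w - F z)) * (w - z)).
  by rewrite mulrBl mulrAC mulVf// mul1r opprB.
by rewrite nmN nmM ler_wpM2r// nm_ge0.
Qed.

Lemma hol_cts F z : hol F z -> cts F z.
Proof.
move=> [l H] e e0; have [d d0 {}H] := H 1 ltr01.
have K0 : 0 < 1 + nm l by rewrite ltr_pwDl// nm_ge0.
exists (Num.min d (e / (1 + nm l))); first by rewrite lt_min d0 divr_gt0.
move=> w; rewrite lt_min ltr_pdivlMr// => /andP[/H h1 h2].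
rewrite (le_lt_trans _ h2)// -(subrK (l * (w - z)) (F w - F z)).
have -> : nm (w - z) * (1 + nm l) = 1 * nm (w - z) + nm l * nm (w - z) by ring.
by apply: le_trans (nmD _ _) _; rewrite nmM lerD2r.
Qed.

Lemma subC x y x' y' : (x +i* y) - (x' +i* y') = (x - x') +i* (y - y').
Proof. by []. Qed.

Lemma nm_real x : nm (x +i* 0) = `|x|. Proof. exact: nmC. Qed.

Lemma nm_imag y : nm (0 +i* y) = `|y|.
Proof. by rewrite nmE2/= expr0n/= add0r sqrtr_sqr. Qed.

Definition hline F y x := F (x +i* y).
Definition vline F x y := F (x +i* y).

Lemma cts_hline F y a b : (forall x, a <= x <= b -> cts F (x +i* y)) ->
  seg_cont (hline F y) a b.
Proof.
move=> H t tab e e0; have [d d0 Hd] := H t tab e e0; exists d => // s sab st.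
by apply: Hd; rewrite subC subrr nm_real.
Qed.

Lemma cts_vline F x c d : (forall y, c <= y <= d -> cts F (x +i* y)) ->
  seg_cont (vline F x) c d.
Proof.
move=> H t tab e e0; have [r r0 Hr] := H t tab e e0; exists r => // s sab st.
by apply: Hr; rewrite subC subrr nm_imag.
Qed.

Definition hseg F y a b := cint (hline F y) a b.
Definition vseg F x c d := 'i * cint (vline F x) c d.

(** Integral over the boundary of [a, b] x [c, d], counterclockwise. *)
Definition rect F a b c d :=
  hseg F c a b - hseg F d a b + (vseg F b c d - vseg F a c d).

Definition rcont F a b c d := [/\ seg_cont (hline F c) a b,
  seg_cont (hline F d) a b, seg_cont (vline F a) c d & seg_cont (vline F b) c d].

Definition in_rect a b c d z :=
  (a <= complex.Re z <= b) && (c <= complex.Im z <= d).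

Lemma cts_rcont F a b c d : a <= b -> c <= d ->
  (forall z, in_rect a b c d z -> cts F z) -> rcont F a b c d.
Proof.
rewrite /in_rect => ab cd H; split; [apply: cts_hline|apply: cts_hline|
  apply: cts_vline|apply: cts_vline] => t tab; apply: H => /=; by rewrite tab ?ab ?cd ?lexx.
Qed.

Lemma rect_catH F a x b c d : a <= x -> x <= b ->
  seg_cont (hline F c) a b -> seg_cont (hline F d) a b ->
  rect F a b c d = rect F a x c d + rect F x b c d.
Proof.
move=> ax xb H1 H2; rewrite /rect /hseg (cint_cat ax xb H1) (cint_cat ax xb H2).
ring.
Qed.

Lemma rect_catV F a b c y d : c <= y -> y <= d ->
  seg_cont (vline F a) c d -> seg_cont (vline F b) c d ->
  rect F a b c d = rect F a b c y + rect F a b y d.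
Proof.
move=> cy yd H1 H2; rewrite /rect /vseg (cint_cat cy yd H1) (cint_cat cy yd H2).
ring.
Qed.

Lemma rect_bound F a b c d e : a <= b -> c <= d -> rcont F a b c d ->
  (forall z, in_rect a b c d z -> nm (F z) <= e) ->
  nm (rect F a b c d) <= 4 * e * ((b - a) + (d - c)).
Proof.
move=> ab cd [h1 h2 h3 h4]; rewrite /in_rect => Fe.
have b1 : nm (hseg F c a b) <= 2 * e * (b - a).
  by apply: cint_bound => // t tab; apply: Fe; rewrite /= tab lexx.
have b2 : nm (hseg F d a b) <= 2 * e * (b - a).
  by apply: cint_bound => // t tab; apply: Fe; rewrite /= tab lexx cd.
have ni : nm ('i : R[i]) = 1 by rewrite nm_imag normr1.
have b3 : nm (vseg F a c d) <= 2 * e * (d - c).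
  rewrite /vseg nmM ni mul1r.
  by apply: cint_bound => // t tab; apply: Fe; rewrite /= tab lexx ab.
have b4 : nm (vseg F b c d) <= 2 * e * (d - c).
  rewrite /vseg nmM ni mul1r.
  by apply: cint_bound => // t tab; apply: Fe; rewrite /= tab lexx ab.
apply: le_trans (nmD _ _) _.
have := nm_sub (hseg F c a b) (hseg F d a b).
by have := nm_sub (vseg F b c d) (vseg F a c d); lra.
Qed.

Lemma rectB F F' a b c d : rcont F a b c d -> rcont F' a b c d ->
  rect (fun z => F z - F' z) a b c d = rect F a b c d - rect F' a b c d.
Proof.
move=> [h1 h2 h3 h4] [k1 k2 k3 k4]; rewrite /rect /hseg /vseg.
rewrite (cintB h1 k1) (cintB h2 k2) (cintB h3 k3) (cintB h4 k4).
ring.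
Qed.

Lemma rcontB F F' a b c d : rcont F a b c d -> rcont F' a b c d ->
  rcont (fun z => F z - F' z) a b c d.
Proof.
by move=> [h1 h2 h3 h4] [k1 k2 k3 k4]; split; apply: seg_contB.
Qed.

Lemma cts_affine (l k p : R[i]) z : cts (fun w => k + l * (w - p)) z.
Proof.
move=> e e0; have K0 : 0 < nm l + 1 by rewrite ltr_wpDl// nm_ge0.
exists (e / (nm l + 1)); first by rewrite divr_gt0.
move=> w; rewrite ltr_pdivlMr//; apply: le_lt_trans.
have -> : k + l * (w - p) - (k + l * (z - p)) = l * (w - z) by ring.
by rewrite nmM mulrC ler_wpM2l ?nm_ge0// lerDl.
Qed.

Lemma rect_affine (l k p : R[i]) a b c d : a <= b -> c <= d ->
  rect (fun w => k + l * (w - p)) a b c d = 0.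
Proof.
move=> ab cd; have [h1 h2 h3 h4] := cts_rcont ab cd (fun z _ => cts_affine l k p z).
rewrite /rect /hseg /vseg -(cintB h1 h2) -mulrBr -(cintB h4 h3).
have -> : (fun t => hline (fun w => k + l * (w - p)) c t - hline (fun w => k + l * (w - p)) d t) =
    fun=> l * (0 +i* (c - d)).
  by apply/funext => t; rewrite /hline -(subrr t) -subC; ring.
have -> : (fun t => vline (fun w => k + l * (w - p)) b t - vline (fun w => k + l * (w - p)) a t) =
    fun=> l * (b - a)%:C.
  apply/funext => t; rewrite /vline -[(b - a)%:C]/((b - a) +i* 0) -(subrr t) -subC; ring.
rewrite !cint_cst//.
have -> : 0 +i* (c - d) = - ('i * (d - c)%:C) by apply/eqP; rewrite eq_complex/=; apply/andP; split; apply/eqP; ring.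
ring.
Qed.

Lemma nested_itv (u w : nat -> R) :
  (forall n, u n <= u n.+1) -> (forall n, u n.+1 + w n.+1 <= u n + w n) ->
  (forall n, 0 <= w n) -> exists x, forall n, u n <= x <= u n + w n.
Proof.
move=> u1 uw w0.
have um m n : (m <= n)%N -> u m <= u n.
  by move=> /subnK <-; elim: (n - m)%N => //= k; move/le_trans; exact.
have uwm m n : (m <= n)%N -> u n + w n <= u m + w m.
  by move=> /subnK <-; elim: (n - m)%N => //= k IH; exact: le_trans (uw _) IH.
have ub m n : u m <= u n + w n.
  case: (leqP m n) => [mn|/ltnW nm'].
    by rewrite (le_trans (um _ _ mn))// lerDl.
  by rewrite (le_trans _ (uwm _ _ nm'))// lerDl.
exists (sup (range u)) => n; apply/andP; split.
  apply: ub_le_sup; last by exists n.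
  by exists (u 0%N + w 0%N) => _ [m _ <-].
apply: ge_sup; first by exists (u 0%N), 0%N.
by move=> _ [m _ <-].
Qed.

(** Goursat's bisection: if the integral were larger than [e] times the square
    of the half-perimeter, so would be the integral over one of the quarters, and
    so on. Near the common point of the nested rectangles [F] is affine up to a
    relative error [e / 4], and affine functions integrate to 0. *)
Lemma goursat F a b c d : a <= b -> c <= d ->
  (forall z, in_rect a b c d z -> hol F z) -> rect F a b c d = 0.
Proof.
move=> ab cd HF; pose W := b - a; pose H := d - c.
have W0 : 0 <= W by rewrite subr_ge0. have H0 : 0 <= H by rewrite subr_ge0.
apply: nm_unique => e' e'0; rewrite subr0.
have S0 : 0 < (W + H) ^+ 2 + 1 by rewrite ltr_wpDl// sqr_ge0.
apply: le_trans (_ : e' / ((W + H) ^+ 2 + 1) * (W + H) ^+ 2 <= e'); last first.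
  by apply: mul_frac_le; [exact: ltW|exact: sqr_ge0].
have : 0 < e' / ((W + H) ^+ 2 + 1) by exact: divr_gt0.
move: (e' / _) => e e0 {S0}.
rewrite leNgt; apply/negP => bad0.
pose w n : R := W / 2 ^+ n; pose h n : R := H / 2 ^+ n.
have p2 n : 0 < (2 : R) ^+ n by rewrite exprn_gt0.
have w0 n : 0 <= w n by rewrite divr_ge0// ltW.
have h0 n : 0 <= h n by rewrite divr_ge0// ltW.
have wS n : w n = w n.+1 + w n.+1.
  by rewrite /w exprS; have := p2 n; move: (2 ^+ n) => q q0; field; rewrite gt_eqF.
have hS n : h n = h n.+1 + h n.+1.
  by rewrite /h exprS; have := p2 n; move: (2 ^+ n) => q q0; field; rewrite gt_eqF.
pose Q n (p : R * R) := rect F p.1 (p.1 + w n) p.2 (p.2 + h n).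
pose bad n (p : R * R) := e * (w n + h n) ^+ 2 < nm (Q n p).
pose step n (p : R * R) :=
  if bad n.+1 p then p else
  if bad n.+1 (p.1 + w n.+1, p.2) then (p.1 + w n.+1, p.2) else
  if bad n.+1 (p.1, p.2 + h n.+1) then (p.1, p.2 + h n.+1) else
  (p.1 + w n.+1, p.2 + h n.+1).
pose s := fix s n := if n is m.+1 then step m (s m) else (a, c).
have stepP n (p : R * R) : [/\ p.1 <= (step n p).1, (step n p).1 + w n.+1 <= p.1 + w n,
    p.2 <= (step n p).2 & (step n p).2 + h n.+1 <= p.2 + h n].
  rewrite /step; have := w0 n.+1; have := h0 n.+1; rewrite (wS n) (hS n).
  by do 3 (case: ifP => _; first by split => /=; lra); split => /=; lra.
have inside_ n : [/\ a <= (s n).1, (s n).1 + w n <= b, c <= (s n).2 & (s n).2 + h n <= d].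
  elim: n => [|n [i1 i2 i3 i4]] /=.
    by rewrite /w /h expr0 !divr1 /W /H; split => //; lra.
  by have [j1 j2 j3 j4] := stepP n (s n); split; lra.
have sub_rect n z : in_rect (s n).1 ((s n).1 + w n) (s n).2 ((s n).2 + h n) z ->
    in_rect a b c d z.
  have [i1 i2 i3 i4] := inside_ n.
  rewrite /in_rect => /andP[/andP[z1 z2] /andP[z3 z4]]; apply/andP; split; apply/andP; split; lra.
have badS n : bad n (s n).
  elim: n => [|n ih] /=.
    rewrite /bad /Q /w /h !expr0 !divr1 /=.
    by have -> : a + W = b by [rewrite /W; ring]; have -> : c + H = d by [rewrite /H; ring].
  rewrite /step; move: ih (sub_rect n); case: (s n) => x y /= ih sub.
  do 3 (case: ifP => //; move/negbT; rewrite -leNgt => ?).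
  rewrite /bad ltNge; apply/negP => ?; move: ih; apply/negP; rewrite -leNgt.
  have C z : in_rect x (x + w n) y (y + h n) z -> cts F z.
    by move=> /sub /HF /hol_cts.
  have hw := w0 n.+1; have hh := h0 n.+1.
  rewrite /Q /=.
  rewrite (@rect_catH F x (x + w n.+1)) ?lerD2l ?lerDl//; last 3 first.
  - by rewrite (wS n) lerDl.
  - by apply: cts_hline => t tt; apply: C; rewrite /in_rect/= tt lexx lerDl h0.
  - by apply: cts_hline => t tt; apply: C; rewrite /in_rect/= tt lexx lerDl h0.
  rewrite (@rect_catV F x (x + w n.+1) y (y + h n.+1)) ?lerDl//; last 3 first.
  - by rewrite (hS n) lerD2l lerDl.
  - by apply: cts_vline => t tt; apply: C; rewrite /in_rect/= tt lexx lerDl w0.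
  - apply: cts_vline => t tt; apply: C; rewrite /in_rect/= tt andbT.
    by rewrite lerDl hw lerD2l (wS n) lerDl.
  rewrite (@rect_catV F (x + w n.+1) (x + w n) y (y + h n.+1)) ?lerDl//; last 3 first.
  - by rewrite (hS n) lerD2l lerDl.
  - apply: cts_vline => t tt; apply: C; rewrite /in_rect/= tt andbT.
    by rewrite lerDl hw lerD2l (wS n) lerDl.
  - by apply: cts_vline => t tt; apply: C; rewrite /in_rect/= tt lexx lerDl w0.
  have Q1 : nm (rect F x (x + w n.+1) y (y + h n.+1)) <= e * (w n.+1 + h n.+1) ^+ 2 by [].
  have Q2 : nm (rect F (x + w n.+1) (x + w n) y (y + h n.+1)) <= e * (w n.+1 + h n.+1) ^+ 2.
    by rewrite (wS n) addrA.
  have Q3 : nm (rect F x (x + w n.+1) (y + h n.+1) (y + h n)) <= e * (w n.+1 + h n.+1) ^+ 2.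
    by rewrite (hS n) addrA.
  have Q4 : nm (rect F (x + w n.+1) (x + w n) (y + h n.+1) (y + h n)) <= e * (w n.+1 + h n.+1) ^+ 2.
    by rewrite (hS n) (wS n) !addrA.
  apply: le_trans (nmD _ _) _; apply: le_trans (lerD (nmD _ _) (nmD _ _)) _.
  apply: le_trans (lerD (lerD Q1 Q3) (lerD Q2 Q4)) _.
  by apply: le_of_eq; rewrite (wS n) (hS n); ring.
have [x Hx] : exists x, forall n, (s n).1 <= x <= (s n).1 + w n.
  by apply: nested_itv => // n; have [] := stepP n (s n).
have [y Hy] : exists y, forall n, (s n).2 <= y <= (s n).2 + h n.
  by apply: nested_itv => // n; have [] := stepP n (s n).
have inP n : in_rect (s n).1 ((s n).1 + w n) (s n).2 ((s n).2 + h n) (x +i* y).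
  by rewrite /in_rect/= Hx Hy.
have [l Hl] := HF _ (sub_rect 0%N _ (inP 0%N)).
have [|r r0 Hr] := Hl (e / 4); first by rewrite divr_gt0.
pose n := Num.truncn ((W + H) / r).
have wh : w n + h n < r.
  rewrite /w /h -mulrDl ltr_pdivrMr// mulrC -ltr_pdivrMr//.
  rewrite (lt_le_trans (truncnS_gt _))// -natrX ler_nat.
  by rewrite ltn_expl.
have := badS n; rewrite /bad ltNge => /negP; apply; rewrite /Q.
move: (inP n) (sub_rect n) (w0 n) (h0 n) wh; rewrite /in_rect /=.
move: (w n) (h n) (s n).1 (s n).2 => w' h' x0 y0 /andP[/andP[x1 x2] /andP[y1 y2]] sub w'0 h'0 wh.
have xx : x0 <= x0 + w' by rewrite lerDl.
have yy : y0 <= y0 + h' by rewrite lerDl.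
pose A := fun z => F (x +i* y) + l * (z - (x +i* y)).
have rF : rcont F x0 (x0 + w') y0 (y0 + h').
  by apply: cts_rcont => // z /sub/HF/hol_cts.
have rA : rcont A x0 (x0 + w') y0 (y0 + h').
  by apply: cts_rcont => // z _; exact: cts_affine.
have -> : rect F x0 (x0 + w') y0 (y0 + h') = rect (fun z => F z - A z) x0 (x0 + w') y0 (y0 + h').
  by rewrite rectB// rect_affine// subr0.
have -> : e * (w' + h') ^+ 2 = 4 * (e / 4 * (w' + h')) * ((x0 + w' - x0) + (y0 + h' - y0)).
  by field.
apply: rect_bound => //; first exact: rcontB.
move=> z /andP[/andP[zx1 zx2] /andP[zy1 zy2]].
have dz : nm (z - (x +i* y)) <= w' + h'.
  apply: le_trans (nm_le_ReIm _) _; rewrite ReB ImB/=.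
  by apply: lerD; rewrite ler_norml; apply/andP; split; lra.
rewrite /A opprD addrA (le_trans (Hr _ _))//; first exact: le_lt_trans wh.
by rewrite ler_wpM2l// divr_ge0// ltW.
Qed.

End Rectangles.

Section CauchyRectangle.
Variable R : realType.
Implicit Types (f F : R[i] -> R[i]) (z w zeta : R[i]) (a b c d x y e r : R).
Let mu := (@lebesgue_measure R).

Lemma hol_inv z zeta : z != zeta -> hol (fun w => (w - zeta)^-1) z.
Proof.
move=> zn; have zn0 : z - zeta != 0 by rewrite subr_eq0.
exists (- (z - zeta)^-1 ^+ 2) => e e0; set p := nm (z - zeta).
have p0 : 0 < p by rewrite nm_gt0.
have p30 : 0 < p ^+ 3 / 2 by rewrite divr_gt0// exprn_gt0.
exists (Num.min (p / 2) (e * (p ^+ 3 / 2))).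
  by rewrite lt_min divr_gt0//= mulr_gt0.
move=> w; rewrite lt_min => /andP[w1 w2].
have pw : p / 2 <= nm (w - zeta).
  by have := nm_trans w z zeta; rewrite (nmB z w) -/p; lra.
have wn0 : w - zeta != 0 by rewrite -nm_gt0 (lt_le_trans _ pw)// divr_gt0.
have -> : (w - zeta)^-1 - (z - zeta)^-1 - - (z - zeta)^-1 ^+ 2 * (w - z) =
    (w - z) * ((w - zeta)^-1 * ((z - zeta)^-1 * (z - zeta)^-1)) * (w - z).
  by field; rewrite zn0.
rewrite [nm (_ * (w - z))]nmM ler_wpM2r ?nm_ge0// nmM !nmM !nmV -/p.
apply: (@le_trans _ _ (e * (p ^+ 3 / 2) * ((p / 2)^-1 * (p^-1 * p^-1)))); last first.
  by apply: le_of_eq; field; rewrite gt_eqF.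
rewrite ler_pM ?nm_ge0 ?mulr_ge0 ?invr_ge0 ?nm_ge0 ?(ltW w2)// ler_wpM2r//.
  by rewrite mulr_ge0 ?invr_ge0 ?ltW.
by rewrite lef_pV2 ?posrE ?nm_gt0 ?divr_gt0.
Qed.

Lemma holM f F z : hol f z -> hol F z -> hol (fun w => f w * F w) z.
Proof.
move=> hf hF; have cF := hol_cts hF; case: hf => l Hl; case: hF => m Hm.
exists (l * F z + f z * m) => e e0.
have K0 : 0 < nm (F z) + 1 + nm l + nm (f z).
  by have := nm_ge0 (F z); have := nm_ge0 l; have := nm_ge0 (f z); lra.
have [e1 [e10 eE]] : exists e1, 0 < e1 /\ e = e1 * (nm (F z) + 1 + nm l + nm (f z)).
  by exists (e / (nm (F z) + 1 + nm l + nm (f z))); rewrite divr_gt0// divfK// gt_eqF.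
have [d1 d10 H1] := Hl _ e10; have [d2 d20 H2] := Hm _ e10.
have [|d3 d30 H3] := cF (Num.min 1 e1); first by rewrite lt_min ltr01.
exists (Num.min d1 (Num.min d2 d3)); first by rewrite !lt_min d10 d20.
move=> w; rewrite !lt_min => /andP[/H1 {}H1 /andP[/H2 {}H2 /H3]].
rewrite lt_min => /andP[H3a /ltW H3b].
have Fw : nm (F w) <= nm (F z) + 1.
  by have := nmD (F w - F z) (F z); rewrite subrK; lra.
have -> : f w * F w - f z * F z - (l * F z + f z * m) * (w - z) =
   (f w - f z - l * (w - z)) * F w + l * (w - z) * (F w - F z) +
   f z * (F w - F z - m * (w - z)) by ring.
have -> : e * nm (w - z) = e1 * nm (w - z) * (nm (F z) + 1) +
    nm l * nm (w - z) * e1 + nm (f z) * (e1 * nm (w - z)).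
  by rewrite eE; ring.
apply: le_trans (nmD _ _) _; apply: lerD; last by rewrite nmM ler_wpM2l ?nm_ge0.
apply: le_trans (nmD _ _) _; apply: lerD; first by rewrite nmM ler_pM ?nm_ge0.
by rewrite !nmM ler_wpM2l ?mulr_ge0 ?nm_ge0.
Qed.

Lemma hol_quot f z zeta : hol f z -> z != zeta -> hol (fun w => f w / (w - zeta)) z.
Proof. by move=> hf zn; apply: holM => //; exact: hol_inv. Qed.

(** The integrals of [(z - zeta)^-1] over opposite sides of a square centred at
    [zeta] add up to this one. *)
Lemma int_atan x r : 0 < r ->
  \int[mu]_(t in `[x - r, x + r]) (2 * r / ((t - x) ^+ 2 + r ^+ 2)) = pi.
Proof.
move=> r0; pose u t := 2 * r / ((t - x) ^+ 2 + r ^+ 2).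
pose U t := 2 * atan ((t - x) / r).
have r20 : 0 < r ^+ 2 by rewrite exprn_gt0.
have Uu t : is_derive t (1 : R) U (u t).
  have h1 := @is_deriveB R R R id (cst x) t 1 1 0 (@is_derive_id R R t 1) (@is_derive_cst R R R x t 1).
  have h2 := @is_deriveZ R R R _ r^-1 t 1 _ h1.
  rewrite subr0 (mulr1 r^-1 : r^-1%:A = r^-1 :> R) in h2.
  have d1 : is_derive t (1 : R) (fun s : R => (s - x) / r) r^-1.
    rewrite [X in is_derive _ _ X](_ : _ = r^-1 \*: (id - cst x))//.
    by apply/funext => s; rewrite mulrC.
  have h3 := @is_derive1_comp R atan (fun s : R => (s - x) / r) t _ _
    (is_derive1_atan ((t - x) / r)) d1.
  have h4 := @is_deriveZ R R R _ 2 t 1 _ h3.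
  have -> : u t = 2 *: ((1 + ((t - x) / r) ^+ 2)^-1 * r^-1); last exact: h4.
  rewrite /u /GRing.scale/=.
  have ne : (t - x) ^+ 2 + r ^+ 2 != 0 by rewrite gt_eqF// ltr_wpDl// sqr_ge0.
  by field; rewrite gt_eqF//= addrC.
have Ud t : derivable U t 1 by [].
have Uc t : {for t, continuous U}.
  by apply: differentiable_continuous; exact/derivable1_diffP.
have uc : continuous u.
  move=> t; apply: cvgM; first exact: cvg_cst.
  have ne : (t - x) ^+ 2 + r ^+ 2 != 0 by rewrite gt_eqF// ltr_wpDl// sqr_ge0.
  apply: cvgV => //; apply: cvgD; last exact: cvg_cst.
  apply: (@cvg_comp _ _ _ (fun s : R => s - x) (fun s : R => s ^+ 2)); last exact: exprn_continuous.
  by apply: cvgB; [exact: cvg_id|exact: cvg_cst].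
rewrite /Rintegral (@continuous_FTC2 _ u U); last first.
- by move=> t _; rewrite derive1E; apply: derive_val.
- split => //.
  + by apply: cvg_at_right_filter; exact: Uc.
  + by apply: cvg_at_left_filter; exact: Uc.
- exact: continuous_subspaceT.
- lra.
rewrite /U /=.
have -> : (x + r - x) / r = 1 by rewrite addrAC subrr add0r divff// gt_eqF.
have -> : (x - r - x) / r = -1 by rewrite addrAC subrr add0r mulNr divff// gt_eqF.
rewrite atanN atan1; lra.
Qed.

(** The four rectangles that surround the small square contribute nothing, by
    Goursat's theorem. *)
Lemma rect_shrink F a b c d x y r : 0 < r -> a <= x - r -> x + r <= b ->
  c <= y - r -> y + r <= d ->
  (forall z, in_rect a b c d z -> z != x +i* y -> hol F z) ->
  rect F a b c d = rect F (x - r) (x + r) (y - r) (y + r).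
Proof.
move=> r0 ax xb cy yd HF.
have ct x' y' : a <= x' <= b -> c <= y' <= d -> (x' != x) || (y' != y) -> cts F (x' +i* y').
  move=> xi yi ne; apply: hol_cts; apply: HF; first by rewrite /in_rect/= xi yi.
  by rewrite eq_complex/= negb_and.
have go a' b' c' d' : a <= a' -> a' <= b' -> b' <= b -> c <= c' -> c' <= d' -> d' <= d ->
    ~~ in_rect a' b' c' d' (x +i* y) -> rect F a' b' c' d' = 0.
  move=> h1 h2 h3 h4 h5 h6 nin; apply: goursat => // z zin; apply: HF.
    move: zin; rewrite /in_rect => /andP[/andP[z1 z2] /andP[z3 z4]].
    by apply/andP; split; apply/andP; split; lra.
  by apply: contraNneq nin => <-.
have nx (u : R) : u = x - r \/ u = x + r -> u != x.
  by move=> H; apply/eqP; case: H => ->; lra.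
have ny (u : R) : u = y - r \/ u = y + r -> u != y.
  by move=> H; apply/eqP; case: H => ->; lra.
have nc : c != y by apply/eqP; lra.
have nd : d != y by apply/eqP; lra.
have q1 : x - r <= b by lra.
have q2 : x - r <= x + r by lra.
have q3 : a <= x + r by lra.
have q4 : y - r <= d by lra.
have q5 : y - r <= y + r by lra.
have q6 : c <= y + r by lra.
have q7 : c <= d by lra.
have q8 : a <= b by lra.
rewrite (@rect_catH _ F a (x - r) b c d)//; last 2 first.
- by apply: cts_hline => t tab; apply: ct => //; [lra|rewrite nc orbT].
- by apply: cts_hline => t tab; apply: ct => //; [lra|rewrite nd orbT].
rewrite (@rect_catH _ F (x - r) (x + r) b c d)//; last 2 first.
- by apply: cts_hline => t tab; apply: ct => //; [lra|lra|rewrite nc orbT].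
- by apply: cts_hline => t tab; apply: ct => //; [lra|lra|rewrite nd orbT].
rewrite (go a (x - r) c d)//; last by rewrite /in_rect/=; apply/negP => /andP[/andP[_ ?] _]; lra.
rewrite (go (x + r) b c d)//; last by rewrite /in_rect/=; apply/negP => /andP[/andP[? _] _]; lra.
rewrite add0r addr0.
rewrite (@rect_catV _ F (x - r) (x + r) c (y - r) d)//; last 2 first.
- by apply: cts_vline => t tab; apply: ct => //; [lra|rewrite nx//; left].
- by apply: cts_vline => t tab; apply: ct => //; [lra|rewrite nx//; right].
rewrite (@rect_catV _ F (x - r) (x + r) (y - r) (y + r) d)//; last 2 first.
- by apply: cts_vline => t tab; apply: ct => //; [lra|lra|rewrite nx//; left].
- by apply: cts_vline => t tab; apply: ct => //; [lra|lra|rewrite nx//; right].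
rewrite (go (x - r) (x + r) c (y - r))//; last first.
  by rewrite /in_rect/=; apply/negP => /andP[_ /andP[]]; lra.
rewrite (go (x - r) (x + r) (y + r) d)//; last first.
  by rewrite /in_rect/=; apply/negP => /andP[_ /andP[]]; lra.
by rewrite add0r addr0.
Qed.

Lemma rcont_square F x y r : 0 < r -> (forall z, z != x +i* y -> cts F z) ->
  rcont F (x - r) (x + r) (y - r) (y + r).
Proof.
by move=> r0 HF; split; [apply: cts_hline|apply: cts_hline|apply: cts_vline|apply: cts_vline];
  move=> t _; apply: HF; rewrite eq_complex/= negb_and; apply/orP;
  [right|right|left|left]; apply/eqP; lra.
Qed.

Lemma rect_inv x y r : 0 < r ->
  rect (fun z => (z - (x +i* y))^-1) (x - r) (x + r) (y - r) (y + r) = twopii R.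
Proof.
move=> r0; pose F := fun z : R[i] => (z - (x +i* y))^-1.
have Fc z : z != x +i* y -> cts F z by move=> zn; apply: hol_cts; exact: hol_inv.
have [h1 h2 h3 h4] := rcont_square r0 Fc.
rewrite -/F /rect /hseg /vseg -(cintB h1 h2) -mulrBr -(cintB h4 h3).
pose u x t := 2 * r / ((t - x) ^+ 2 + r ^+ 2).
have ne x' t : (t - x') ^+ 2 + r ^+ 2 != 0 by rewrite gt_eqF// ltr_wpDl ?sqr_ge0// exprn_gt0.
have -> : (fun t => hline F (y - r) t - hline F (y + r) t) = fun t => 0 +i* u x t.
  apply/funext => t; rewrite /hline /F /u; apply/eqP; rewrite eq_complex/=.
  rewrite ![y - r - y]addrAC ![y + r - y]addrAC subrr !add0r sqrrN.
  by apply/andP; split; apply/eqP; field; exact: ne.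
have -> : (fun t => vline F (x + r) t - vline F (x - r) t) = fun t => (u y t)%:C.
  apply/funext => t; rewrite /vline /F /u; apply/eqP; rewrite eq_complex/=.
  rewrite ![x - r - x]addrAC ![x + r - x]addrAC subrr !add0r sqrrN [r ^+ 2 + _]addrC.
  by apply/andP; split; apply/eqP; field; exact: ne.
rewrite /cint /= !int_atan// !Rintegral_cst// !mul0r /twopii.
by apply/eqP; rewrite eq_complex/=; apply/andP; split; apply/eqP; ring.
Qed.

(** Shrink the rectangle to a small square around the pole: there the difference
    quotient of [f] is bounded, so only the integral of [f zeta / (z - zeta)]
    survives. *)
Lemma cauchy_rect f a b c d x y : a < x -> x < b -> c < y -> y < d ->
  (forall z, in_rect a b c d z -> hol f z) ->
  rect (fun z => f z / (z - (x +i* y))) a b c d = twopii R * f (x +i* y).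
Proof.
move=> ax xb cy yd Hf; set zeta := x +i* y.
have zin : in_rect a b c d zeta by rewrite /in_rect/= !ltW.
have [l Hl] := Hf _ zin; have [d1 d10 {}Hl] := Hl 1 ltr01.
apply: nm_unique => e e0.
pose K := 1 + nm l; have K0 : 0 < K by rewrite ltr_pwDl// nm_ge0.
pose r := Num.min (Num.min (Num.min (x - a) (b - x)) (Num.min (y - c) (d - y)))
  (Num.min (d1 / 3) (e / (16 * K))).
have r0 : 0 < r by rewrite /r !lt_min !subr_gt0 ax xb cy yd !divr_gt0// mulr_gt0.
have : r <= r by []; rewrite {2}/r !le_min => /andP[/andP[/andP[r1 r2] /andP[r3 r4]] /andP[r5 r6]].
have hq z : in_rect a b c d z -> z != zeta -> hol (fun z => f z / (z - zeta)) z.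
  by move=> zin' zn; apply: hol_quot => //; exact: Hf.
rewrite (@rect_shrink _ a b c d x y r)//; try lra.
pose G0 := fun z : R[i] => f zeta * (z - zeta)^-1.
have cG0 z : z != zeta -> cts G0 z.
  move=> zn; apply: hol_cts; apply: holM; last exact: hol_inv.
  exists 0 => e1 e10; exists 1 => // w _.
  by rewrite subrr mul0r subrr nm0 mulr_ge0 ?nm_ge0 ?ltW.
have rG0 := rcont_square r0 cG0.
have insub z : in_rect (x - r) (x + r) (y - r) (y + r) z -> in_rect a b c d z.
  rewrite /in_rect => /andP[/andP[z1 z2] /andP[z3 z4]].
  by apply/andP; split; apply/andP; split; lra.
have rF : rcont (fun z => f z / (z - zeta)) (x - r) (x + r) (y - r) (y + r).
  have C z : in_rect (x - r) (x + r) (y - r) (y + r) z -> z != zeta ->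
      cts (fun z => f z / (z - zeta)) z.
    by move=> /insub zi zn; apply: hol_cts; exact: hq.
  split; [apply: cts_hline|apply: cts_hline|apply: cts_vline|apply: cts_vline];
    move=> t tt; (apply: C; [by rewrite /in_rect/= tt !lexx ?andbT; lra|
    rewrite eq_complex/= negb_and; apply/orP]); [right|right|left|left];
    by apply/eqP; lra.
have -> : twopii R * f zeta = rect G0 (x - r) (x + r) (y - r) (y + r).
  have [h1 h2 h3 h4] : rcont (fun z => (z - zeta)^-1) (x - r) (x + r) (y - r) (y + r).
    by apply: rcont_square => // z zn; apply: hol_cts; exact: hol_inv.
  rewrite -(rect_inv x y r0) -/zeta /rect /hseg /vseg /G0 /hline /vline.
  rewrite (cintZ _ h1) (cintZ _ h2) (cintZ _ h3) (cintZ _ h4); ring.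
rewrite -rectB//; apply: le_trans (rect_bound (e := K) _ _ _ _) _.
- lra.
- lra.
- exact: rcontB.
- move=> z zi; rewrite /G0 -mulrBl nmM nmV.
  have [->|zn] := eqVneq z zeta; first by rewrite !subrr nm0 mul0r ltW.
  have zn0 : 0 < nm (z - zeta) by rewrite nm_gt0 subr_eq0.
  rewrite ler_pdivrMr//.
  have zd : nm (z - zeta) < d1.
    apply: le_lt_trans (nm_le_ReIm _) _; rewrite ReB ImB/=.
    have [i1 i2] : `|complex.Re z - x| <= r /\ `|complex.Im z - y| <= r.
      move: zi; rewrite /in_rect => /andP[/andP[z1 z2] /andP[z3 z4]].
      by split; rewrite ler_norml; apply/andP; split; lra.
    by lra.
  rewrite -(subrK (l * (z - zeta)) (f z - f zeta)).
  by apply: le_trans (nmD _ _) _; rewrite nmM /K mulrDl lerD2r Hl.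
have -> : 4 * K * (x + r - (x - r) + (y + r - (y - r))) = 16 * K * r by ring.
by move: r6; rewrite ler_pdivlMr ?mulr_gt0// mulrC.
Qed.

End CauchyRectangle.

(** * Cauchy's formula along a curve that winds around no point outside G *)

Section Edges.
Variables (R : realType) (g : R -> R[i]).
Hypothesis gcr : closed_rectifiable_curve g.
Implicit Types (z w zeta t : R[i]) (a b x y e : R).

(** A pole at such a point contributes nothing to an integral along [g]. *)
Definition null z := ~ trace g z /\ winding_number g z = 0.

Lemma inside_not_null t : inside g t -> ~ null t.
Proof. by move=> [_ t1] [_ t0]; move: t1; rewrite t0 => /eqP; rewrite eq_sym oner_eq0. Qed.

(** Partial fractions: the pole [z] has winding number 0 and the pole [t] has
    winding number 1. *)
Lemma ci_pole z t : null z -> inside g t ->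
  is_curve_integral g (fun zeta => (z - zeta)^-1 * (zeta - t)^-1) (twopii R / (z - t)).
Proof.
move=> zn ti; have [nz z0] := zn; have [nt t1] := ti.
have zt : z - t != 0.
  by apply/negP => /eqP/subr0_eq zt; apply: (inside_not_null ti); rewrite -zt.
have [v gv] := closed_curve_dominates gcr.
have H := ciZ (z - t)^-1 (ciD (ciZ (-1) (ci_inv gcr nz)) (ci_inv gcr nt)).
move: H; rewrite z0 t1 mulr0 scaler0 add0r mulr1 => H.
have -> : twopii R / (z - t) = (z - t)^-1 *: twopii R by rewrite mulrC.
apply: (ci_ext gv) H => s s01; rewrite /GRing.scale/=.
have a0 : g s - z != 0 by exact: not_trace.
have b0 : g s - t != 0 by exact: not_trace.
have c0 : z - g s != 0 by rewrite -opprB oppr_eq0.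
by field; rewrite ?zt ?a0 ?b0 ?c0.
Qed.

Variables (gam phi : R -> R[i]) (a b : R).
Hypothesis ab : a <= b.
Hypothesis gamL : forall s s', nm (gam s - gam s') <= `|s - s'|.
Hypothesis phic : seg_cont phi a b.
Hypothesis gamN : forall s, a <= s <= b -> null (gam s).

(** The integral of [phi / (_ - zeta)] over an edge of null points, as a function
    of the pole [zeta]. *)
Definition edge zeta := cint (fun s => phi s / (gam s - zeta)) a b.

Lemma edge_dist t : inside g t -> exists2 d : R, 0 < d & forall s, a <= s <= b ->
  avoids g (gam s) d /\ d <= nm (gam s - t).
Proof.
move=> ti; apply: (@compact_uniform R a b (fun d s => avoids g (gam s) d /\ d <= nm (gam s - t))).
move=> s sab; have [ns s0] := gamN sab; have [d d0 sd] := trace_avoids gcr ns.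
have st : 0 < nm (gam s - t).
  rewrite nm_gt0; apply/negP => /eqP/subr0_eq st.
  by apply: (inside_not_null ti); rewrite -st; exact: gamN.
exists (Num.min d (nm (gam s - t)) / 2); first by rewrite divr_gt0// lt_min d0.
move=> s' e s'ab ss /andP[e0 ee].
have m1 : Num.min d (nm (gam s - t)) <= d by rewrite ge_min lexx.
have m2 : Num.min d (nm (gam s - t)) <= nm (gam s - t) by rewrite ge_min lexx orbT.
have Ls := gamL s' s; split.
  move=> u u01; have := sd u u01; have := nm_trans (gam s') (g u) (gam s); lra.
by have := nm_trans (gam s') (gam s) t; rewrite (nmB (gam s) (gam s')); lra.
Qed.

Lemma edge_osc (d e : R) : 0 < d -> 0 < e -> exists2 dl : R, 0 < dl &
  forall s s', a <= s <= b -> a <= s' <= b -> `|s - s'| < dl ->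
  forall zeta, (forall u, a <= u <= b -> d <= nm (gam u - zeta)) ->
    nm (phi s / (gam s - zeta) - phi s' / (gam s' - zeta)) <= e.
Proof.
move=> d0 e0.
have [|dl dl0 H] := @compact_uniform R a b (fun dl s => forall s', a <= s' <= b ->
  `|s - s'| < dl -> forall zeta, (forall u, a <= u <= b -> d <= nm (gam u - zeta)) ->
    nm (phi s / (gam s - zeta) - phi s' / (gam s' - zeta)) <= e); last first.
  by exists dl => // s s' sab s'ab ss; exact: (H s).
move=> s sab.
have ed0 : 0 < e / 4 * d by rewrite mulr_gt0// divr_gt0.
have [d1 d10 H1] := phic sab ed0.
have K0 : 0 < nm (phi s) + 1 by rewrite ltr_wpDl// nm_ge0.
pose d2 := Num.min d1 (e / 4 * d ^+ 2 / (nm (phi s) + 1)).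
have d20 : 0 < d2 by rewrite lt_min d10 divr_gt0// mulr_gt0 ?exprn_gt0// divr_gt0.
have near s' : a <= s' <= b -> `|s' - s| < d2 ->
    forall zeta, (forall u, a <= u <= b -> d <= nm (gam u - zeta)) ->
    nm (phi s' / (gam s' - zeta) - phi s / (gam s - zeta)) <= e / 2.
  move=> s'ab; rewrite lt_min => /andP[s1 s2] zeta zd.
  have -> : phi s' / (gam s' - zeta) - phi s / (gam s - zeta) =
     (phi s' - phi s) * (gam s' - zeta)^-1 +
     phi s * ((gam s' - zeta)^-1 - (gam s - zeta)^-1) by ring.
  have -> : e / 2 = e / 4 * d * d^-1 + e / 4 by field; rewrite gt_eqF.
  apply: le_trans (nmD _ _) _; rewrite !nmM; apply: lerD.
    rewrite ler_pM ?nm_ge0 ?(ltW (H1 _ s'ab s1))// nmV.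
    by rewrite lef_pV2 ?posrE ?zd// (lt_le_trans d0)// zd.
  have h := nm_invB d0 (zd _ s'ab) (zd _ sab).
  apply: le_trans (ler_wpM2l (nm_ge0 _) h) _.
  have -> : gam s' - zeta - (gam s - zeta) = gam s' - gam s by ring.
  move: s2; rewrite ltr_pdivlMr// => s2.
  rewrite mulrCA mulrC ler_pdivrMr ?exprn_gt0//; apply: le_trans (ltW s2).
  by rewrite mulrC ler_pM ?nm_ge0// lerDl.
exists (d2 / 2); first by rewrite divr_gt0.
move=> s1 e1 s1ab ss /andP[e10 e1d] s' s'ab ss' zeta zd.
have s1s : `|s1 - s| < d2 by lra.
have s's : `|s' - s| < d2 by move: ss ss'; rewrite !ltr_norml; lra.
apply: le_trans (nm_trans (phi s / (gam s - zeta)) _ _) _; rewrite [e]splitr lerD ?near//.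
by rewrite nmB near.
Qed.

Lemma edge_seg_cont zeta : (forall s, a <= s <= b -> gam s != zeta) ->
  seg_cont (fun s => phi s / (gam s - zeta)) a b.
Proof.
move=> H s sab e e0.
have [d d0 Hd] : exists2 d : R, 0 < d & forall s, a <= s <= b -> d <= nm (gam s - zeta).
  apply: (@compact_uniform R a b (fun d s => d <= nm (gam s - zeta))) => s1 s1ab.
  exists (nm (gam s1 - zeta) / 2); first by rewrite divr_gt0// nm_gt0 subr_eq0 H.
  move=> s' e' s'ab ss /andP[e'0 ee].
  have := gamL s1 s'; have := nm_trans (gam s') (gam s1) zeta.
  by rewrite (distrC s1 s'); lra.
have [dl dl0 Hdl] := edge_osc d0 (divr_gt0 e0 (ltr0Sn R 1)).
exists dl => // s' s'ab ss; apply: le_lt_trans (Hdl _ _ s'ab sab ss _ Hd) _.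
by rewrite ltr_pdivrMr// ltr_pMr// ltr1n.
Qed.

Lemma cint_riemann (h : R -> R[i]) (n : nat) e (x : nat -> R) :
  seg_cont h (x 0%N) (x n) -> (forall k, (k < n)%N -> x k <= x k.+1) ->
  (forall k s, (k < n)%N -> x k <= s <= x k.+1 -> nm (h s - h (x k)) <= e) ->
  nm (cint h (x 0%N) (x n) - \sum_(k < n) (x k.+1 - x k)%:C * h (x k)) <=
    2 * e * (x n - x 0%N).
Proof.
elim: n => [|n ih] hc xs he.
  have -> : cint h (x 0%N) (x 0%N) = 0.
    have := cint_cat (lexx (x 0%N)) (lexx _) hc.
    by rewrite -[LHS]addr0 => /addrI/esym.
  by rewrite big_ord0 !subrr nm0 mulr0.
have x0n k : (k <= n)%N -> x 0%N <= x k.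
  elim: k => // k ihk kn; apply: le_trans (xs k _); first exact: ihk (ltnW kn).
  exact: ltnW.
have xn := xs n (ltnSn n).
rewrite (cint_cat (x0n n (leqnn n)) xn hc) big_ord_recr/=.
have hn : seg_cont h (x n) (x n.+1) by apply: seg_contS hc => //; exact: x0n.
have -> : 2 * e * (x n.+1 - x 0%N) = 2 * e * (x n - x 0%N) + 2 * e * (x n.+1 - x n) by ring.
rewrite opprD addrACA; apply: le_trans (nmD _ _) _; apply: lerD.
  apply: ih; first exact: seg_contS hc.
  - by move=> k kn; apply: xs; exact: ltnW.
  - by move=> k s kn; apply: he; exact: ltnW.
rewrite -cint_cst// -cintB//; last exact: seg_cont_cst.
apply: cint_bound => //; first by apply: seg_contB => //; exact: seg_cont_cst.
by move=> s; exact: he.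
Qed.

(** The integrals along [g] and along the edge are exchanged: on the trace and at
    [t], the edge integral is a uniform limit of Riemann sums, each term of which
    has a null pole, so that [ci_pole] applies. *)
Lemma ci_edge t : inside g t ->
  is_curve_integral g (fun zeta => edge zeta / (zeta - t)) (twopii R * edge t).
Proof.
move=> ti; have [v gv] := closed_curve_dominates gcr.
have [d d0 dd] := edge_dist ti; have [nt t1] := ti.
have [dt dt0 tdt] := trace_avoids gcr nt.
apply: (ci_lim gv) => e e0.
pose C := (dt^-1 + nm (twopii R)) * 2 * (b - a) + 1.
have C0 : 0 < C.
  by rewrite ltr_wpDl// !mulr_ge0 ?subr_ge0// addr_ge0 ?nm_ge0// invr_ge0 ltW.
have [e1 [e10 eE]] : exists e1, 0 < e1 /\ e = e1 * C.
  by exists (e / C); rewrite divr_gt0// divfK// gt_eqF.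
have [dl dl0 Hdl] := edge_osc d0 e10.
pose n := Num.truncn ((b - a) / dl).
have n0 : 0 < n.+1%:R :> R by rewrite ltr0n.
pose x k : R := a + k%:R * ((b - a) / n.+1%:R).
have xS k : x k.+1 - x k = (b - a) / n.+1%:R by rewrite /x -natr1; ring.
have st0 : 0 <= (b - a) / n.+1%:R by rewrite divr_ge0 ?subr_ge0// ltW.
have stdl : (b - a) / n.+1%:R < dl.
  by rewrite ltr_pdivrMr// mulrC -ltr_pdivrMr// truncnS_gt.
have x0 : x 0%N = a by rewrite /x mul0r addr0.
have xn : x n.+1 = b by rewrite /x mulrC divfK ?gt_eqF// addrC subrK.
have xab k : (k <= n.+1)%N -> a <= x k <= b.
  move=> kn; rewrite lerDl mulr_ge0//= -[leRHS]xn lerD2l ler_wpM2r// ler_nat//.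
have xs k : (k < n.+1)%N -> x k <= x k.+1 by move=> _; rewrite -subr_ge0 xS.
pose S zeta := \sum_(k < n.+1) (x k.+1 - x k)%:C * (phi (x k) / (gam (x k) - zeta)).
have close zeta : (forall u, a <= u <= b -> d <= nm (gam u - zeta)) ->
    nm (edge zeta - S zeta) <= 2 * e1 * (b - a).
  move=> zd; rewrite /edge -x0 -xn; apply: cint_riemann => //.
    rewrite x0 xn; apply: edge_seg_cont => s sab.
    by rewrite -subr_eq0 -nm_gt0 (lt_le_trans d0)// zd.
  move=> k s kn /andP[s1 s2].
  have /andP[xk0 _] := xab k (ltnW kn); have /andP[_ xk1] := xab k.+1 kn.
  apply: Hdl => //.
  - by rewrite (le_trans xk0 s1) (le_trans s2 xk1).
  - by rewrite xk0 (le_trans s1 (le_trans s2 xk1)).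
  - rewrite ger0_norm ?subr_ge0//; apply: le_lt_trans stdl.
    by rewrite -(xS k) lerD2r.
exists (fun zeta => S zeta / (zeta - t)), (twopii R * S t); split.
- have Hk (k : 'I_n.+1) := ciZ ((x k.+1 - x k)%:C * phi (x k))
    (ci_pole (gamN (xab k (ltnW (ltn_ord k)))) ti).
  have := ci_sum Hk.
  have -> : twopii R * S t = \sum_(i < n.+1)
     ((x i.+1 - x i)%:C * phi (x i)) *: (twopii R / (gam (x i) - t)).
    by rewrite /S mulr_sumr; apply: eq_bigr => k _; rewrite /GRing.scale/=; ring.
  apply: (ci_ext gv) => s s01; rewrite /S mulr_suml; apply: eq_bigr => k _.
  by rewrite /GRing.scale/= !mulrA.
- move=> s s01; rewrite -mulrBl nmM nmV.
  have h1 : nm (edge (g s) - S (g s)) <= 2 * e1 * (b - a).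
    by apply: close => u uab; have [ud _] := dd u uab; rewrite nmB; exact: ud.
  have h2 : (nm (g s - t))^-1 <= dt^-1.
    by rewrite lef_pV2 ?posrE ?tdt// (lt_le_trans dt0)// tdt.
  apply: le_trans (ler_pM _ _ h1 h2) _; rewrite ?nm_ge0 ?invr_ge0 ?nm_ge0//.
  rewrite eE /C; have h3 : 0 <= e1 * nm (twopii R) * 2 * (b - a).
    by rewrite !mulr_ge0 ?nm_ge0 ?subr_ge0 ?(ltW e10).
  by lra.
- rewrite -mulrBr nmM nmB.
  have h1 : nm (edge t - S t) <= 2 * e1 * (b - a).
    by apply: close => u uab; have [] := dd u uab.
  apply: le_trans (ler_wpM2l (nm_ge0 _) h1) _.
  rewrite eE /C; have h3 : 0 <= e1 * dt^-1 * 2 * (b - a).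
    by rewrite !mulr_ge0 ?subr_ge0 ?invr_ge0 ?(ltW e10) ?(ltW dt0).
  by lra.
Qed.

Lemma edge_cts zeta : ~ null zeta -> cts edge zeta.
Proof.
move=> nz.
have [d d0 Hd] : exists2 d : R, 0 < d & forall s, a <= s <= b ->
    d <= nm (gam s - zeta) /\ nm (phi s) <= d^-1.
  apply: (@compact_uniform R a b (fun d s => d <= nm (gam s - zeta) /\ nm (phi s) <= d^-1)).
  move=> s sab; have p0 : 0 < nm (gam s - zeta).
    by rewrite nm_gt0; apply/negP => /eqP/subr0_eq E; apply: nz; rewrite -E; exact: gamN.
  have [d1 d10 H1] := phic sab ltr01.
  have K0 : 0 < nm (phi s) + 1 by rewrite ltr_wpDl// nm_ge0.
  exists (Num.min (nm (gam s - zeta) / 2) (Num.min d1 (nm (phi s) + 1)^-1)).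
    by rewrite !lt_min divr_gt0//= d10 invr_gt0.
  move=> s' e s'ab; rewrite !lt_min => /andP[s1 /andP[s2 _]].
  move=> /andP[e0 /andP[e1 /andP[_ e2]]]; split.
    by have := gamL s' s; have := nm_trans (gam s') (gam s) zeta; rewrite (nmB (gam s) (gam s')); lra.
  rewrite -[e^-1]invrK; have := H1 _ s'ab s2.
  have : nm (phi s) + 1 <= e^-1 by rewrite -[leLHS]invrK lef_pV2 ?posrE ?invr_gt0// ltW.
  by have := nmD (phi s' - phi s) (phi s); rewrite subrK invrK; lra.
move=> e e0; have d20 : 0 < d / 2 by rewrite divr_gt0.
pose C := d^-1 * ((d / 2) ^- 2) * 2 * (b - a) + 1.
have C0 : 0 < C.
  by rewrite ltr_wpDl// !mulr_ge0 ?subr_ge0 ?invr_ge0 ?exprn_ge0// ltW.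
exists (Num.min (d / 2) (e / C)); first by rewrite lt_min d20 divr_gt0.
move=> w; rewrite lt_min => /andP[w1 w2].
have wd s : a <= s <= b -> d / 2 <= nm (gam s - w).
  move=> /Hd[h _]; have := nm_trans w (gam s) zeta; lra.
have zd s : a <= s <= b -> d / 2 <= nm (gam s - zeta) by move=> /Hd[h _]; lra.
have ne u : (forall s, a <= s <= b -> d / 2 <= nm (gam s - u)) ->
    seg_cont (fun s => phi s / (gam s - u)) a b.
  move=> H; apply: edge_seg_cont => s /H h.
  by rewrite -subr_eq0 -nm_gt0 (lt_le_trans d20).
rewrite /edge -cintB; [|exact: ne|exact: ne].
apply: le_lt_trans (cint_bound (e := d^-1 * ((d / 2) ^- 2 * nm (w - zeta))) ab _ _) _.
- by apply: seg_contB; exact: ne.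
- move=> s sab; rewrite -mulrBr nmM; have [_ h] := Hd s sab.
  rewrite ler_pM ?nm_ge0//; apply: le_trans (nm_invB d20 (wd s sab) (zd s sab)) _.
  by have -> : gam s - w - (gam s - zeta) = zeta - w by [ring]; rewrite nmB.
move: w2; rewrite ltr_pdivlMr// /C => w2.
have := nm_ge0 (w - zeta).
have -> : 2 * (d^-1 * ((d / 2) ^- 2 * nm (w - zeta))) * (b - a) =
  nm (w - zeta) * (d^-1 * ((d / 2) ^- 2) * 2 * (b - a)) by ring.
by rewrite mulrDr mulr1 in w2; lra.
Qed.

End Edges.

Section Homology.
Variables (R : realType) (g : R -> R[i]) (G : set R[i]) (f : R[i] -> R[i]).
Hypothesis gcr : closed_rectifiable_curve g.
Hypothesis Gop : forall z, G z -> exists2 r : R, 0 < r & forall w, nm (w - z) < r -> G w.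
Hypothesis Gf : forall z, G z -> hol f z.
Hypothesis gG : trace g `<=` G.
Hypothesis gW : forall w, ~ G w -> winding_number g w = 0.
Implicit Types (z w zeta t : R[i]) (a b x y e : R).

(** The ray from 0 through [z] does not meet the trace beyond [z]. *)
Lemma null_far : exists2 B : R, 0 < B & forall z,
  B <= `|complex.Re z| \/ B <= `|complex.Im z| -> null g z.
Proof.
have [v gv] := closed_curve_dominates gcr.
pose B := nm (g 0) + (v 1 - v 0) + 1.
have L0 : 0 <= v 1 - v 0 := length_ge0 gv.
have gB z : trace g z -> nm z < B.
  move=> [s]; rewrite /= in_itv/= => /andP[s0 s1] <-.
  have h1 : nm (g s - g 0) <= v s - v 0 by exact: gv.
  have h2 : v s <= v 1 by exact: dominates_nd gv _ _ _.
  by have := nmD (g s - g 0) (g 0); rewrite subrK /B; lra.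
have B0 : 0 < B by rewrite /B; have := nm_ge0 (g 0); lra.
exists B => // z zB; have {}zB : B <= nm z.
  by case: zB => /le_trans; apply; [exact: Re_le_nm|exact: Im_le_nm].
have z0 : z != 0 by rewrite -nm_gt0 (lt_le_trans B0).
have H s : 0 <= s -> ~ trace g (z + s%:C * z).
  move=> s0 /gB; apply/negP; rewrite -leNgt; apply: le_trans zB _.
  rewrite -[X in X + _]mul1r -mulrDl -[1 + _](rmorphD (real_complex R) 1 s).
  by rewrite nmM nmC ger0_norm ?addr_ge0// ler_peMl ?nm_ge0// lerDl.
split; last exact: (winding_ray gcr z0 H).
by have := H 0 (lexx 0); rewrite rmorph0 mul0r addr0.
Qed.

(** The trace is at positive distance from the complement of [G], so a short
    segment leads from [z] to the point [w] outside [G] without meeting it. *)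
Lemma null_near : exists2 r : R, 0 < r & forall z w, ~ G w -> nm (w - z) < r -> null g z.
Proof.
have gc : {within `[0, 1], continuous g} by case: gcr.
have [r r0 Hr] : exists2 r : R, 0 < r & forall s, 0 <= s <= 1 ->
    forall w, nm (w - g s) < r -> G w.
  apply: (@compact_uniform R 0 1 (fun r s => forall w, nm (w - g s) < r -> G w)).
  move=> s s01; have [|r r0 Hr] := Gop (z := g s).
    by apply: gG; exists s => //=; rewrite in_itv.
  have r20 : 0 < r / 2 by rewrite divr_gt0.
  have [d d0 Hd] := curve_eps_delta gc s01 r20.
  exists (Num.min d (r / 2)); first by rewrite lt_min d0.
  move=> s' e s'01; rewrite lt_min => /andP[ss _] /andP[e0].
  rewrite lt_min => /andP[_ er] w wr; apply: Hr.
  by have := nm_trans (g s') w (g s); have := Hd _ s'01 ss; lra.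
exists r => // z w nw wz.
have H s : 0 <= s <= 1 -> ~ trace g (z + s%:C * (w - z)).
  move=> /andP[s0 s1] [u]; rewrite /= in_itv/= => u01 gu; apply: nw.
  apply: (Hr u u01); rewrite gu; apply: le_lt_trans wz.
  have -> : w - (z + s%:C * (w - z)) = (1 - s)%:C * (w - z).
    by rewrite (rmorphB (real_complex R) 1 s) rmorph1; ring.
  rewrite nmM nmC ger0_norm ?subr_ge0// ler_piMl ?nm_ge0//; lra.
split; last by rewrite (winding_segment gcr H) gW.
by have := H 0; rewrite rmorph0 mul0r addr0; apply; rewrite lexx ler01.
Qed.

(** Abel summation: edges shared by two selected cells of a grid cancel. *)
Lemma sum_by_parts (c H : nat -> R[i]) (N : nat) :
  (forall j, (N <= j)%N -> c j = 0) ->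
  \sum_(j < N) c j * (H j - H j.+1) =
  \sum_(j < N.+1) (c j - (if nat_of_ord j is k.+1 then c k else 0)) * H j.
Proof.
move=> c0; under eq_bigr do rewrite mulrBr; rewrite sumrB.
under [RHS]eq_bigr do rewrite mulrBl; rewrite sumrB; congr (_ - _).
  by rewrite big_ord_recr/= c0// mul0r addr0.
by rewrite big_ord_recl/= mul0r add0r.
Qed.

Lemma ctsB (F F' : R[i] -> R[i]) z : cts F z -> cts F' z -> cts (fun w => F w - F' w) z.
Proof.
move=> H1 H2 e e0; have e20 : 0 < e / 2 by rewrite divr_gt0.
have [d1 d10 {}H1] := H1 _ e20; have [d2 d20 {}H2] := H2 _ e20.
exists (Num.min d1 d2); first by rewrite lt_min d10.
move=> w; rewrite lt_min => /andP[/H1 h1 /H2 h2].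
have -> : F w - F' w - (F z - F' z) = (F w - F z) - (F' w - F' z) by ring.
by apply: le_lt_trans (nm_sub _ _) _; rewrite [e]splitr ltrD.
Qed.

Lemma ctsZ (k : R[i]) F z : cts F z -> cts (fun w => k * F w) z.
Proof.
move=> H e e0; have K0 : 0 < nm k + 1 by rewrite ltr_wpDl// nm_ge0.
have [|d d0 Hd] := H (e / (nm k + 1)); first by rewrite divr_gt0.
exists d => // w /Hd; rewrite ltr_pdivlMr// => h; rewrite -mulrBr nmM.
by apply: le_lt_trans h; rewrite mulrC ler_wpM2l ?nm_ge0// lerDl.
Qed.

Lemma cts_sum n (F : 'I_n -> R[i] -> R[i]) z : (forall i, cts (F i) z) ->
  cts (fun w => \sum_(i < n) F i w) z.
Proof.
move=> H; elim: n F H => [|n ih] F H e e0.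
  by exists 1 => // w _; rewrite !big_ord0 subrr nm0.
have e20 : 0 < e / 2 by rewrite divr_gt0.
have [d1 d10 H1] := ih (fun i => F (lift ord0 i)) (fun i => H _) _ e20.
have [d2 d20 H2] := H ord0 _ e20.
exists (Num.min d1 d2); first by rewrite lt_min d10.
move=> w; rewrite lt_min => /andP[/H1 h1 /H2 h2].
rewrite !big_ord_recl opprD addrACA; apply: le_lt_trans (nmD _ _) _.
by rewrite [e]splitr ltrD.
Qed.

Lemma interior_near (lo hi a e : R) : lo <= a -> a < hi -> 0 < e ->
  exists a', [/\ lo < a', a' < hi & `|a' - a| < e].
Proof.
move=> a1 a2 e0; pose q := Num.min (e / 2) ((hi - a) / 2).
have q0 : 0 < q by rewrite lt_min !divr_gt0// subr_gt0.
have q1 : q <= e / 2 by rewrite ge_min lexx.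
have q2 : q <= (hi - a) / 2 by rewrite ge_min lexx orbT.
by exists (a + q); rewrite [a + q - a]addrAC subrr add0r ger0_norm ?(ltW q0)//; split; lra.
Qed.

(** Let [r] be as in [null_near]. Cover a large square by a grid finer than [r],
    and select the cells that contain a point at distance at least [r] from the
    complement of [G]. All selected cells lie in [G], so the sum
    [Phi] of the integrals of [f z / (z - zeta)] over their boundaries equals
    [2 pi i * f zeta] wherever [zeta] is not null, first in the interior of the
    cells and then by continuity. An edge that does not cancel borders a cell
    that is not selected, so it consists of null points, and [ci_edge] integrates
    [Phi zeta / (zeta - t)] along [g]. *)
Lemma homology_cauchy t : inside g t ->
  is_curve_integral g (fun z => f z / (z - t)) (twopii R * f t).
Proof.
move=> ti; have [B B0 far] := null_far; have [r r0 near] := null_near.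
have [v gv] := closed_curve_dominates gcr.
pose N := (Num.truncn (4 * B / r)).+1.
have N0 : 0 < N%:R :> R by rewrite ltr0n.
pose h := 2 * B / N%:R; have h0 : 0 < h by rewrite divr_gt0// mulr_gt0.
have hr : 2 * h < r.
  have -> : 2 * h = 4 * B / N%:R by rewrite /h; ring.
  rewrite ltr_pdivrMr// [r * _]mulrC -ltr_pdivrMr//; exact: truncnS_gt.
pose x (i : nat) := - B + i%:R * h.
have xS i : x i.+1 = x i + h by rewrite /x -natr1; ring.
have x0 : x 0%N = - B by rewrite /x mul0r addr0.
have xN : x N = B by rewrite /x /h mulrC divfK ?gt_eqF//; ring.
pose D z := forall w, nm (w - z) < r -> G w.
have nD z : ~ D z -> null g z.
  by move=> /existsNP[w /not_implyP[wz nw]]; exact: near nw wz.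
have DG z : D z -> G z by move=> Dz; apply: Dz; rewrite subrr nm0.
pose cell i j z := in_rect (x i) (x i.+1) (x j) (x j.+1) z.
pose good i j := (i < N)%N && (j < N)%N && `[< exists z, cell i j z /\ D z >].
have goodG i j z : good i j -> cell i j z -> G z.
  move=> /andP[_ /asboolP[w [wc wD]]] zc; apply: wD.
  apply: le_lt_trans (nm_le_ReIm _) _; rewrite ReB ImB.
  move: zc wc; rewrite /cell /in_rect !xS.
  move=> /andP[/andP[z1 z2] /andP[z3 z4]] /andP[/andP[w1 w2] /andP[w3 w4]].
  have : `|complex.Re z - complex.Re w| <= h by rewrite ler_norml; apply/andP; split; lra.
  have : `|complex.Im z - complex.Im w| <= h by rewrite ler_norml; apply/andP; split; lra.
  lra.
have cellN i j z : ~~ good i j -> (i <= N)%N -> (j <= N)%N -> cell i j z -> null g z.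
  move=> ng iN jN zc; case: (ltnP i N) => iN'; last first.
    have {}iN : i = N by apply/eqP; rewrite eqn_leq iN.
    apply: far; left; move: zc; rewrite /cell /in_rect iN xN => /andP[/andP[z1 _] _].
    by rewrite ger0_norm//; lra.
  case: (ltnP j N) => jN'; last first.
    have {}jN : j = N by apply/eqP; rewrite eqn_leq jN.
    apply: far; right; move: zc; rewrite /cell /in_rect jN xN => /andP[_ /andP[z1 _]].
    by rewrite ger0_norm//; lra.
  apply: nD => Dz; move: ng; rewrite /good iN' jN' /= => /negP; apply.
  by apply/asboolP; exists z.
pose F zeta z := f z / (z - zeta).
pose c i j : R[i] := (good i j)%:R.
pose Hs zeta i j := hseg (F zeta) (x j) (x i) (x i.+1).
pose Vs zeta i j := vseg (F zeta) (x i) (x j) (x j.+1).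
pose ch (i j : nat) : R[i] := c i j - (if j is k.+1 then c i k else 0).
pose cv (i j : nat) : R[i] := c i j - (if i is k.+1 then c k j else 0).
pose Phi zeta := \sum_(i < N) \sum_(j < N.+1) ch i j * Hs zeta i j -
   \sum_(j < N) \sum_(i < N.+1) cv i j * Vs zeta i j.
have PhiE zeta : Phi zeta = \sum_(i < N) \sum_(j < N)
    c i j * rect (F zeta) (x i) (x i.+1) (x j) (x j.+1).
  have -> : \sum_(i < N) \sum_(j < N) c i j * rect (F zeta) (x i) (x i.+1) (x j) (x j.+1) =
     \sum_(i < N) \sum_(j < N) c i j * (Hs zeta i j - Hs zeta i j.+1) -
     \sum_(j < N) \sum_(i < N) c i j * (Vs zeta i j - Vs zeta i.+1 j).
    rewrite [X in _ - X]exchange_big/= -sumrB; apply: eq_bigr => i _.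
    by rewrite -sumrB; apply: eq_bigr => j _; rewrite /rect /Hs /Vs; ring.
  rewrite /Phi; congr (_ - _); apply: eq_bigr => i _; symmetry.
    apply: (@sum_by_parts (c i) (Hs zeta i) N) => j jN.
    by rewrite /c /good [(j < N)%N]ltnNge jN andbF.
  apply: (@sum_by_parts (c^~ i) (Vs zeta ^~ i) N) => j jN.
  by rewrite /c /good ltnNge jN.
have tn : ~ null g t := inside_not_null ti.
have trn z : trace g z -> ~ null g z by move=> ? [].
have xle i : x i <= x i.+1 by rewrite xS lerDl ltW.
have hcell i j s : x i <= s <= x i.+1 -> cell i j (s +i* x j) /\ cell i j (s +i* x j.+1).
  by move=> si; rewrite /cell /in_rect/= si !lexx !xle.
have vcell i j s : x j <= s <= x j.+1 -> cell i j (x i +i* s) /\ cell i j (x i.+1 +i* s).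
  by move=> sj; rewrite /cell /in_rect/= sj !lexx !xle.
(* An edge with nonzero coefficient borders a cell that is not selected, or
   lies on the boundary of the large square. *)
have hedge i j : (i < N)%N -> (j <= N)%N -> ch i j != 0 ->
    forall s, x i <= s <= x i.+1 -> null g (s +i* x j).
  move=> iN jN c0 s si; case: (boolP (good i j)) => gij; last first.
    exact: cellN gij (ltnW iN) jN (proj1 (hcell i j s si)).
  move: c0; rewrite /ch /c gij; case: (j) jN => [|k] jN.
    by move=> _; apply: far; right; rewrite /= x0 normrN ger0_norm// ltW.
  case: (boolP (good i k)) => gik; first by rewrite subrr eqxx.
  by move=> _; exact: cellN gik (ltnW iN) (ltnW jN) (proj2 (hcell i k s si)).
have vedge i j : (i <= N)%N -> (j < N)%N -> cv i j != 0 ->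
    forall s, x j <= s <= x j.+1 -> null g (x i +i* s).
  move=> iN jN c0 s sj; case: (boolP (good i j)) => gij; last first.
    exact: cellN gij iN (ltnW jN) (proj1 (vcell i j s sj)).
  move: c0; rewrite /cv /c gij; case: (i) iN => [|k] iN.
    by move=> _; apply: far; left; rewrite /= x0 normrN ger0_norm// ltW.
  case: (boolP (good k j)) => gkj; first by rewrite subrr eqxx.
  by move=> _; exact: cellN gkj (ltnW iN) (ltnW jN) (proj2 (vcell k j s sj)).
(* Such an edge also borders a selected cell, on which [f] is holomorphic. *)
have hG i j : ch i j != 0 -> forall s, x i <= s <= x i.+1 -> G (s +i* x j).
  rewrite /ch /c; case: (boolP (good i j)) => gij.
    by move=> _ s si; exact: goodG gij (proj1 (hcell i j s si)).
  case: j gij => [|k] gij; first by rewrite subrr eqxx.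
  case: (boolP (good i k)) => gik; last by rewrite subrr eqxx.
  by move=> _ s si; exact: goodG gik (proj2 (hcell i k s si)).
have vG i j : cv i j != 0 -> forall s, x j <= s <= x j.+1 -> G (x i +i* s).
  rewrite /cv /c; case: (boolP (good i j)) => gij.
    by move=> _ s sj; exact: goodG gij (proj1 (vcell i j s sj)).
  case: i gij => [|k] gij; first by rewrite subrr eqxx.
  case: (boolP (good k j)) => gkj; last by rewrite subrr eqxx.
  by move=> _ s sj; exact: goodG gkj (proj2 (vcell k j s sj)).
have gamh y s s' : nm ((s +i* y) - (s' +i* y)) <= `|s - s'| by rewrite subC subrr nm_real.
have gamv y s s' : nm ((y +i* s) - (y +i* s')) <= `|s - s'| by rewrite subC subrr nm_imag.
have hcont i j : ch i j != 0 -> seg_cont (fun s => f (s +i* x j)) (x i) (x i.+1).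
  by move=> c0; apply: cts_hline => s si; apply: hol_cts; apply: Gf; exact: hG si.
have vcont i j : cv i j != 0 -> seg_cont (fun s => f (x i +i* s)) (x j) (x j.+1).
  by move=> c0; apply: cts_vline => s si; apply: hol_cts; apply: Gf; exact: vG si.
have PhiI : is_curve_integral g (fun zeta => Phi zeta / (zeta - t)) (twopii R * Phi t).
  have H1 : is_curve_integral g
     (fun zeta => \sum_(i < N) \sum_(j < N.+1) ch i j *: (Hs zeta i j / (zeta - t)))
     (\sum_(i < N) \sum_(j < N.+1) ch i j *: (twopii R * Hs t i j)).
    apply: ci_sum => i; apply: ci_sum => j.
    have [c0|c0] := eqVneq (ch i j) 0.
      rewrite c0 scale0r; under [fun zeta => _]eq_fun do rewrite scale0r; exact: ci0.
    apply: ciZ; apply: (@ci_edge R g gcr (fun s => s +i* x j) (fun s => f (s +i* x j))) => //.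
    - exact: hcont.
    - by apply: hedge => //; rewrite -ltnS.
  have H2 : is_curve_integral g
     (fun zeta => \sum_(j < N) \sum_(i < N.+1) (- cv i j) *: (Vs zeta i j / (zeta - t)))
     (\sum_(j < N) \sum_(i < N.+1) (- cv i j) *: (twopii R * Vs t i j)).
    apply: ci_sum => j; apply: ci_sum => i.
    have [c0|c0] := eqVneq (cv i j) 0.
      rewrite c0 oppr0 scale0r; under [fun zeta => _]eq_fun do rewrite scale0r; exact: ci0.
    have E := @ci_edge R g gcr (fun s => x i +i* s) (fun s => f (x i +i* s)) (x j) (x j.+1)
      (xle j) (gamv (x i)) (vcont _ _ c0) (vedge _ _ _ (ltn_ord j) c0) t ti.
    have := ciZ (- cv i j * 'i) (E (ltn_ord i)).
    have VE zeta : Vs zeta i j = 'i * edge (fun s => x i +i* s)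
      (fun s => f (x i +i* s)) (x j) (x j.+1) zeta by [].
    have -> : (- cv i j) *: (twopii R * Vs t i j) =
        (- cv i j * 'i) *: (twopii R * edge (fun s => x i +i* s)
      (fun s => f (x i +i* s)) (x j) (x j.+1) t).
      by rewrite VE /GRing.scale/=; ring.
    by apply: (ci_ext gv) => s _; rewrite VE /GRing.scale/=; ring.
  have := ciD H1 H2.
  have -> : twopii R * Phi t =
     \sum_(i < N) \sum_(j < N.+1) ch i j *: (twopii R * Hs t i j) +
     \sum_(j < N) \sum_(i < N.+1) (- cv i j) *: (twopii R * Vs t i j).
    rewrite /Phi mulrBr; congr (_ + _).
      rewrite mulr_sumr; apply: eq_bigr => i _; rewrite mulr_sumr; apply: eq_bigr => j _.
      by rewrite /GRing.scale/= mulrCA.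
    rewrite -mulrN -sumrN mulr_sumr; apply: eq_bigr => j _; rewrite -sumrN mulr_sumr.
    by apply: eq_bigr => i _; rewrite /GRing.scale/=; ring.
  apply: (ci_ext gv) => s s01.
  rewrite /Phi mulrBl -mulNr -sumrN; congr (_ + _).
    rewrite mulr_suml; apply: eq_bigr => i _; rewrite mulr_suml; apply: eq_bigr => j _.
    by rewrite /GRing.scale/= mulrA.
  rewrite mulr_suml; apply: eq_bigr => j _; rewrite -sumrN mulr_suml.
  by apply: eq_bigr => i _; rewrite /GRing.scale/=; ring.
(* The other selected cells contribute nothing, by Goursat's theorem. *)
have PhiO i0 j0 a b : good i0 j0 -> x i0 < a -> a < x i0.+1 -> x j0 < b -> b < x j0.+1 ->
    Phi (a +i* b) = twopii R * f (a +i* b).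
  move=> gij a1 a2 b1 b2; rewrite PhiE.
  have [iN jN] : (i0 < N)%N /\ (j0 < N)%N by move: gij => /andP[/andP[]].
  have xmono i j : (i <= j)%N -> x i <= x j.
    by move=> ij; rewrite /x lerD2l ler_wpM2r ?ler_nat// ltW.
  have out i j : (i != i0) || (j != j0) -> ~~ cell i j (a +i* b).
    move=> ij; apply/negP; rewrite /cell /in_rect/= => /andP[/andP[c1 c2] /andP[c3 c4]].
    case/orP: ij; rewrite neq_ltn => /orP[] /xmono; lra.
  rewrite (bigD1 (Ordinal iN))//= (bigD1 (Ordinal jN))//= [X in _ + X + _]big1 ?addr0; last first.
    move=> j jj; rewrite /c; case: (boolP (good i0 j)) => gj; last by rewrite mul0r.
    rewrite goursat ?mulr0 ?xle// => z zc; apply: hol_quot; first by apply: Gf; exact: goodG zc.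
    have /negP o : ~~ cell i0 j (a +i* b) by apply: out; rewrite -val_eqE/= in jj; rewrite jj orbT.
    by apply/eqP => zab; apply: o; rewrite -zab.
  rewrite [X in _ + X]big1 ?addr0; last first.
    move=> i ii; apply: big1 => j _; rewrite /c; case: (boolP (good i j)) => gj; last by rewrite mul0r.
    rewrite goursat ?mulr0 ?xle// => z zc; apply: hol_quot; first by apply: Gf; exact: goodG zc.
    have /negP o : ~~ cell i j (a +i* b) by apply: out; rewrite -val_eqE/= in ii; rewrite ii.
    by apply/eqP => zab; apply: o; rewrite -zab.
  rewrite /c gij mul1r; apply: cauchy_rect => // z zc.
  by apply: Gf; exact: goodG zc.
have Phicts zeta : ~ null g zeta -> cts Phi zeta.
  move=> nz; apply: ctsB; apply: cts_sum => i; apply: cts_sum => j.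
    have [c0|c0] := eqVneq (ch i j) 0.
      by move=> e e0; exists 1 => // w _; rewrite c0 !mul0r subrr nm0.
    apply: ctsZ; apply: (@edge_cts R g (fun s => s +i* x j) (fun s => f (s +i* x j))) => //.
    - exact: hcont.
    - by apply: hedge => //; rewrite -ltnS.
  have [c0|c0] := eqVneq (cv j i) 0.
    by move=> e e0; exists 1 => // w _; rewrite c0 !mul0r subrr nm0.
  apply: ctsZ; apply: ctsZ.
  apply: (@edge_cts R g (fun s => x j +i* s) (fun s => f (x j +i* s))) => //.
  - exact: vcont.
  - by apply: vedge => //; rewrite -ltnS.
have index a : `|a| < B -> exists2 i, (i < N)%N & x i <= a < x i.+1.
  rewrite ltr_norml => /andP[a1 a2].
  have q0 : 0 <= (a + B) / h by rewrite divr_ge0 ?ltW//; lra.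
  have tr : (Num.truncn ((a + B) / h))%:R <= (a + B) / h by rewrite truncn_le.
  have tS := truncnS_gt ((a + B) / h).
  exists (Num.truncn ((a + B) / h)).
    rewrite -(ltr_nat R); apply: le_lt_trans tr _.
    by rewrite ltr_pdivrMr// /h mulrC divfK ?gt_eqF//; lra.
  move: tr tS; rewrite ler_pdivlMr// ltr_pdivrMr// /x; lra.
have PhiF zeta : ~ null g zeta -> Phi zeta = twopii R * f zeta.
  move=> nz; have Dz : D zeta by apply: contrapT => /nD.
  have Cf := hol_cts (Gf (DG _ Dz)); have CP := Phicts _ nz.
  have [za zb] : `|complex.Re zeta| < B /\ `|complex.Im zeta| < B.
    by split; rewrite ltNge; apply/negP => ?; apply: nz; apply: far; [left|right].
  have [i0 iN /andP[i1 i2]] := index _ za; have [j0 jN /andP[j1 j2]] := index _ zb.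
  have gij : good i0 j0.
    rewrite /good iN jN; apply/asboolP; exists zeta; split => //.
    by rewrite /cell /in_rect i1 j1 !ltW.
  apply: nm_unique => e e0; have e20 : 0 < e / 2 by rewrite divr_gt0.
  have K0 : 0 < nm (twopii R) + 1 by rewrite ltr_wpDl// nm_ge0.
  have [d1 d10 H1] := CP _ e20.
  have [|d2 d20 H2] := Cf (e / 2 / (nm (twopii R) + 1)); first by rewrite divr_gt0.
  pose dl := Num.min d1 d2; have dl0 : 0 < dl by rewrite lt_min d10.
  have dl20 : 0 < dl / 2 by rewrite divr_gt0.
  have [a' [a1 a2 a3]] := interior_near i1 i2 dl20.
  have [b' [b1 b2 b3]] := interior_near j1 j2 dl20.
  have PE := PhiO _ _ _ _ gij a1 a2 b1 b2.
  have dz : nm ((a' +i* b') - zeta) < dl.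
    by apply: le_lt_trans (nm_le_ReIm _) _; rewrite ReB ImB/= [dl]splitr ltrD.
  move: dz; rewrite lt_min => /andP[/H1 q1 /H2 q2].
  apply: le_trans (nm_trans (Phi (a' +i* b')) _ _) _.
  rewrite [e]splitr; apply: lerD; first by rewrite nmB ltW.
  rewrite PE -mulrBr nmM; move: q2; rewrite ltr_pdivlMr// => q2.
  by apply: le_trans _ (ltW q2); rewrite mulrC ler_wpM2l ?nm_ge0// lerDl.
have t0 := twopii_neq0 R.
rewrite -[twopii R * f t]mul1r -[X in X * _](mulVf t0) -mulrA.
rewrite -PhiF//; apply: (ci_ext gv) (ciZ (twopii R)^-1 PhiI) => s s01.
rewrite PhiF; last by apply: trn; exists s => //=; rewrite in_itv.
by rewrite /GRing.scale/= !mulrA mulVf// mul1r.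
Qed.

End Homology.

(** * A curve around a real interval *)

Section Cis.
Variable R : realType.
Implicit Types (a b h : R) (z w : R[i]).

Definition cis a : R[i] := cos a +i* sin a.

Lemma cisD a b : cis (a + b) = cis a * cis b.
Proof. by rewrite /cis sinD cosD; apply/eqP; rewrite eq_complex/= eqxx/=; apply/eqP; ring. Qed.

Lemma nm_cis a : nm (cis a) = 1.
Proof. by rewrite nmE2/= cos2Dsin2 sqrtr1. Qed.

Lemma cis_neq0 a : cis a != 0.
Proof. by rewrite -nm_gt0 nm_cis. Qed.

Let lip (u du : R -> R) (K : R) a b : (forall x : R, is_derive x (1 : R) u (du x)) ->
  a <= b -> (forall x : R, a <= x <= b -> `|du x| <= K) -> `|u b - u a| <= K * (b - a).
Proof.
move=> ud ab duK.
have uc : {within `[a, b], continuous u}.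
  by apply: derivable_within_continuous => x _; have [] := ud x.
have [c cab ->] := @MVT_segment R u du a b ab (fun x _ => ud x) uc.
rewrite normrM [`|b - a|]ger0_norm ?subr_ge0// ler_wpM2r ?subr_ge0// duK//.
Qed.

Lemma cos_le1N a : `|cos a| <= 1.
Proof. by rewrite ler_norml cos_geN1 cos_le1. Qed.

Lemma sin_le1N a : `|sin a| <= 1.
Proof. by rewrite ler_norml sin_geN1 sin_le1. Qed.

Lemma cis_lip a b : nm (cis b - cis a) <= 2 * `|b - a|.
Proof.
wlog ab : a b / a <= b.
  by move=> H; case: (leP a b) => [/H//|/ltW/H]; rewrite nmB distrC.
apply: le_trans (nm_le_ReIm _) _; rewrite ReB ImB/= [X in 2 * X]ger0_norm ?subr_ge0//.
have -> : 2 * (b - a) = 1 * (b - a) + 1 * (b - a) by ring.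
apply: lerD.
  by apply: (@lip cos (fun x => - sin x)) => // x _; rewrite normrN sin_le1N.
by apply: (@lip sin cos) => // x _; exact: cos_le1N.
Qed.

Lemma cis_taylor h : 0 <= h -> nm (cis h - 1 - 'i * h%:C) <= 2 * h ^+ 2.
Proof.
move=> h0.
have sinh (x : R) : 0 <= x -> `|sin x| <= x.
  move=> x0; have := @lip sin cos 1 0 x _ x0 _.
  by rewrite sin0 !subr0 mul1r; apply => // y _; exact: cos_le1N.
have cosh (x : R) : 0 <= x -> `|cos x - 1| <= x.
  move=> x0; have := @lip cos (fun x => - sin x) 1 0 x _ x0 _.
  by rewrite cos0 subr0 mul1r; apply => // y _; rewrite normrN sin_le1N.
apply: le_trans (nm_le_ReIm _) _.
have -> : complex.Re (cis h - 1 - 'i * h%:C) = cos h - 1 by rewrite /=; ring.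
have -> : complex.Im (cis h - 1 - 'i * h%:C) = sin h - h by rewrite /=; ring.
have -> : 2 * h ^+ 2 = h * h + h * h by ring.
apply: lerD.
  have := @lip cos (fun x => - sin x) h 0 h _ h0 _.
  rewrite cos0 subr0; apply => // x /andP[x0 xh].
  by rewrite normrN (le_trans (sinh _ x0)).
have := @lip (fun x => sin x - x) (fun x => cos x - 1) h 0 h _ h0 _.
rewrite sin0 !subr0; apply => // x /andP[x0 xh].
by rewrite (le_trans (cosh _ x0)).
Qed.

End Cis.

Section Gauge.
Variables (R : realType) (al be : R).
Hypotheses (be0 : 0 < be) (ba : be <= al).
Implicit Types (z w : R[i]) (s t : R).

Let al0 : 0 < al. Proof. exact: lt_le_trans ba. Qed.

(** The gauge of the rectangle with half-sides [al] and [be] centred at 0. *)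
Definition gauge z : R := Num.max (`|complex.Re z| / al) (`|complex.Im z| / be).

Lemma gaugeZ s z : 0 <= s -> gauge (s%:C * z) = s * gauge z.
Proof.
move=> s0; case: z => x y; rewrite /gauge /= !mul0r subr0 addr0 !normrM ger0_norm//.
by rewrite maxr_pMr// !mulrA.
Qed.

Lemma gauge_lip z w : gauge z - gauge w <= nm (z - w) / be.
Proof.
rewrite lerBlDr /gauge ge_max.
have inv : al^-1 <= be^-1 by rewrite lef_pV2.
apply/andP; split; rewrite addrC.
  apply: le_trans (_ : `|complex.Re w| / al + `|complex.Re (z - w)| / al <= _).
    rewrite -mulrDl ler_wpM2r ?invr_ge0 ?(ltW al0) ?(ltW be0)//.
    by have := ler_normD (complex.Re w) (complex.Re z - complex.Re w); rewrite ReB [_ + (_ - _)]addrC subrK.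
  apply: lerD; first by rewrite le_max lexx.
  by rewrite ler_pM ?invr_ge0 ?Re_le_nm ?inv ?(ltW al0).
apply: le_trans (_ : `|complex.Im w| / be + `|complex.Im (z - w)| / be <= _).
  rewrite -mulrDl ler_wpM2r ?invr_ge0 ?(ltW al0) ?(ltW be0)//.
  by have := ler_normD (complex.Im w) (complex.Im z - complex.Im w); rewrite ImB [_ + (_ - _)]addrC subrK.
apply: lerD; first by rewrite le_max lexx orbT.
by rewrite ler_wpM2r ?invr_ge0 ?Im_le_nm ?(ltW be0).
Qed.

Lemma gauge_cis_ge (a : R) : (2 * al)^-1 <= gauge (cis a).
Proof.
rewrite /gauge le_max /=; have := cos2Dsin2 a.
case: (leP (1 / 2) `|cos a|) => c0 E; apply/orP.
  by left; rewrite invfM ler_wpM2r ?invr_ge0 ?(ltW al0) ?(ltW be0)//; move: c0; rewrite mul1r.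
right; apply: (@le_trans _ _ (2^-1 / be)).
  by rewrite invfM ler_wpM2l// lef_pV2.
rewrite ler_wpM2r ?invr_ge0 ?(ltW be0)// leNgt; apply/negP => s0.
rewrite mul1r in c0; have h0 : 0 <= (2^-1 : R) by [].
have h1 : cos a ^+ 2 <= 4^-1.
  rewrite -real_normK ?num_real// (_ : 4^-1 = 2^-1 ^+ 2); last by field.
  by rewrite lerXn2r ?nnegrE// ltW.
have h2 : sin a ^+ 2 <= 4^-1.
  rewrite -real_normK ?num_real// (_ : 4^-1 = 2^-1 ^+ 2); last by field.
  by rewrite lerXn2r ?nnegrE// ltW.
by lra.
Qed.

Lemma gauge_cis_le (a : R) : gauge (cis a) <= be^-1.
Proof.
rewrite /gauge ge_max /=; apply/andP; split; rewrite -[leRHS]mul1r.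
  by rewrite ler_pM ?invr_ge0 ?cos_le1N ?lef_pV2 ?(ltW al0).
by rewrite ler_wpM2r ?invr_ge0 ?sin_le1N ?(ltW be0).
Qed.

Lemma gauge_cis_gt0 (a : R) : 0 < gauge (cis a).
Proof. by rewrite (lt_le_trans _ (gauge_cis_ge a))// invr_gt0 mulr_gt0. Qed.

(** Distance from the centre to the boundary in the direction [2 * pi * t]: the
    boundary of the rectangle is parametrized by polar coordinates. *)
Definition radius t := (gauge (cis (2 * pi * t)))^-1.
Variable p : R[i].
Definition rect_curve t := p + (radius t)%:C * cis (2 * pi * t).

Lemma radius_gt0 t : 0 < radius t.
Proof. by rewrite invr_gt0 gauge_cis_gt0. Qed.

Lemma radius_ge t : be <= radius t.
Proof. by rewrite -[be]invrK lef_pV2 ?posrE ?gauge_cis_gt0 ?invr_gt0 ?gauge_cis_le. Qed.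

Lemma radius_le t : radius t <= 2 * al.
Proof. by rewrite -[2 * al]invrK lef_pV2 ?posrE ?gauge_cis_gt0 ?invr_gt0 ?mulr_gt0 ?gauge_cis_ge. Qed.

Lemma radius_lip : exists2 C : R, 0 < C & forall s t, `|radius t - radius s| <= C * `|t - s|.
Proof.
exists ((2 * al) ^+ 2 * (2 * (2 * pi) / be)).
  by rewrite !mulr_gt0 ?exprn_gt0 ?mulr_gt0 ?pi_gt0 ?invr_gt0.
move=> s t; rewrite /radius.
have g0 u := gauge_cis_gt0 (2 * pi * u).
have -> : (gauge (cis (2 * pi * t)))^-1 - (gauge (cis (2 * pi * s)))^-1 =
    radius t * radius s * (gauge (cis (2 * pi * s)) - gauge (cis (2 * pi * t))).
  by rewrite /radius; field; rewrite !gt_eqF.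
rewrite normrM -[leRHS]mulrA ler_pM//.
  have rt := ltW (radius_gt0 t); have rs := ltW (radius_gt0 s).
  rewrite ger0_norm ?mulr_ge0 ?rt ?rs// expr2.
  by rewrite ler_pM ?radius_le ?rt ?rs.
have -> : 2 * (2 * pi) / be * `|t - s| = (2 * `|2 * pi * s - 2 * pi * t|) / be.
  rewrite -mulrBr normrM [`|2 * pi|]ger0_norm ?mulr_ge0 ?pi_ge0// (distrC s); ring.
apply: (@le_trans _ _ (nm (cis (2 * pi * s) - cis (2 * pi * t)) / be)); last first.
  by rewrite ler_wpM2r ?invr_ge0 ?cis_lip ?(ltW be0).
by rewrite ler_norml gauge_lip andbT lerNl opprB nmB gauge_lip.
Qed.

Lemma rect_curve_lip : exists2 C : R, 0 < C &
  forall s t, nm (rect_curve t - rect_curve s) <= C * `|t - s|.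
Proof.
have [C C0 HC] := radius_lip; exists (C + 2 * al * (2 * (2 * pi))).
  by rewrite addr_gt0 ?mulr_gt0 ?pi_gt0.
move=> s t; rewrite /rect_curve.
have -> : p + (radius t)%:C * cis (2 * pi * t) - (p + (radius s)%:C * cis (2 * pi * s)) =
   (radius t - radius s)%:C * cis (2 * pi * t) +
   (radius s)%:C * (cis (2 * pi * t) - cis (2 * pi * s)).
  by rewrite (rmorphB (real_complex R) (radius t) (radius s)); ring.
apply: le_trans (nmD _ _) _; rewrite !nmM !nmC nm_cis mulr1 [leRHS]mulrDl; apply: lerD => //.
rewrite -[leRHS]mulrA ler_pM ?nm_ge0//; first by rewrite ger0_norm ?radius_le ?(ltW (radius_gt0 _)).
apply: le_trans (cis_lip _ _) _.
rewrite -mulrBr normrM [`|2 * pi|]ger0_norm ?mulr_ge0 ?pi_ge0//.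
by apply: le_of_eq; ring.
Qed.

Lemma gauge_rect_curve t : gauge (rect_curve t - p) = 1.
Proof.
rewrite /rect_curve [p + _]addrC addrK gaugeZ ?(ltW (radius_gt0 t))//.
by rewrite /radius mulVf// gt_eqF// gauge_cis_gt0.
Qed.

Lemma rect_curve_closed : closed_rectifiable_curve rect_curve.
Proof.
have [C C0 HC] := rect_curve_lip; split.
- apply: continuous_subspaceT => t; apply/cvgrPdist_lt => e e0.
  have e'0 : 0 < complex.Re e by move: e0; rewrite ltcE/= => /andP[].
  have eE : e = (complex.Re e)%:C by rewrite RRe_real// gtr0_real.
  exists (complex.Re e / C) => /=; first by rewrite divr_gt0.
  move=> s /=; rewrite ltr_pdivlMr// => st; rewrite eE lt_nmC.
  by apply: le_lt_trans st; rewrite mulrC HC.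
- rewrite /rect_curve /radius mulr0 mulr1.
  have -> : cis (2 * pi) = cis 0 :> R[i].
    by rewrite /cis mulr_natl cos2pi sin2pi cos0 sin0.
  by [].
- exists C => s s01.
  have -> : C = C * (1 - 0) by rewrite subr0 mulr1.
  rewrite -[X in C * X](pt_telescope id s01) mulr_sumr rmorph_sum/=.
  apply: ler_sum => i _; rewrite nmE lecR; apply: le_trans (HC _ _) _.
  by rewrite ger0_norm// subr_ge0 pt_le.
Qed.

Lemma rect_curve_trace w : trace rect_curve w -> gauge (w - p) = 1.
Proof. by move=> [t _ <-]; exact: gauge_rect_curve. Qed.

Lemma gauge0 : gauge 0 = 0.
Proof. by rewrite /gauge/= normr0 !mul0r maxxx. Qed.

(** Each term of a Riemann sum for [(z - p)^-1] is [q * cis h - 1], where [q] is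
    the ratio of two successive radii and [h] the angle between them. The numbers
    [q - 1] are [ln q] up to second order, and these logarithms telescope to 0;
    the numbers [cis h - 1] are ['i * h] up to second order. *)
Lemma winding_center : winding_number rect_curve p = 1.
Proof.
have cr := rect_curve_closed; set g := rect_curve.
have [v gv] := closed_curve_dominates cr.
have np : ~ trace g p.
  by move=> /rect_curve_trace; rewrite subrr gauge0 => /eqP; rewrite eq_sym oner_eq0.
suff H : is_curve_integral g (fun z => (z - p)^-1) (twopii R).
  by rewrite /winding_number (curve_integralE H) mulVf// twopii_neq0.
have [d d0 pd] := trace_avoids cr np.
apply: (ci_upart gv); first exact: avoids_cont d0 pd.
have [C C0 HC] := radius_lip.
pose K := C ^+ 2 / be ^+ 2 * (2 * al / be) + 8 * pi ^+ 2.
have K0 : 0 <= K.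
  by rewrite addr_ge0 ?mulr_ge0 ?exprn_ge0 ?invr_ge0 ?pi_ge0 ?exprn_ge0 ?(ltW be0) ?(ltW al0) ?(ltW C0).
move=> e e0; exists (Num.truncn (K / e)) => n nN.
have n0 : 0 < n.+1%:R :> R by rewrite ltr0n.
have ne : K / n.+1%:R <= e.
  rewrite ler_pdivrMr// mulrC -ler_pdivrMr// ltW// (lt_le_trans (truncnS_gt _))//.
  by rewrite ler_nat.
apply: le_trans ne.
set s := upart n; pose rho i := radius (pt s i).
pose q i := rho i.+1 / rho i.
have rho0 i : 0 < rho i := radius_gt0 _.
have a2 k : (rho k)^-1 <= be^-1 by rewrite lef_pV2 ?posrE// radius_ge.
have a3 k : 0 <= (rho k)^-1 by rewrite invr_ge0 ltW.
pose h : R := 2 * pi / n.+1%:R.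
have h0 : 0 <= h by rewrite divr_ge0 ?mulr_ge0 ?pi_ge0// ltW.
have SE : curve_sum g (fun z => (z - p)^-1) s (pt s) =
   \sum_(i < size s) ((q i)%:C * cis h - 1).
  apply: eq_bigr => i _.
  have gE k : g (pt s k) = p + (rho k)%:C * cis (2 * pi * pt s k) by [].
  have qE : (q i)%:C = (rho i.+1)%:C / (rho i)%:C :> R[i] by exact: fmorph_div.
  have iS : (i < n.+1)%N by rewrite -(size_upart R n).
  rewrite !gE qE.
  have -> : 2 * pi * pt s i.+1 = 2 * pi * pt s i + h.
    by rewrite /h -(@upart_step R n i iS); ring.
  rewrite cisD /GRing.scale/=.
  have r0 : (rho i)%:C != 0 by rewrite fmorph_eq0 gt_eqF.
  move: (cis_neq0 (2 * pi * pt s i)) r0 => c0 r0.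
  move: (cis (2 * pi * pt s i)) (cis h) (rho i)%:C (rho i.+1)%:C c0 r0 => c k y y' c0 r0.
  have -> : p + y * c - p = y * c by ring.
  by field; rewrite ?r0 ?c0.
have qs i : (i < size s)%N -> 0 <= (q i - 1) - (ln (rho i.+1) - ln (rho i)) <= C ^+ 2 / be ^+ 2 * (2 * al / be) / n.+1%:R ^+ 2.
  move=> iS; have q0 : 0 < q i by rewrite divr_gt0.
  have -> : ln (rho i.+1) - ln (rho i) = ln (q i) by rewrite /q ln_div ?posrE ?rho0.
  have l1 : ln (q i) <= q i - 1.
    by have := @le_ln1Dx R (q i - 1); rewrite [1 + _]addrC subrK; apply; lra.
  have l2 : - ln (q i) <= (q i)^-1 - 1.
    have := @le_ln1Dx R ((q i)^-1 - 1); rewrite [1 + _]addrC subrK lnV ?posrE//; apply.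
    by have : 0 < (q i)^-1 by [rewrite invr_gt0]; lra.
  apply/andP; split; first lra.
  apply: (@le_trans _ _ ((q i - 1) ^+ 2 * (q i)^-1)).
    have -> : (q i - 1) ^+ 2 * (q i)^-1 = q i - 1 + ((q i)^-1 - 1) by field; rewrite gt_eqF.
    lra.
  have qV : (q i)^-1 <= 2 * al / be.
    have a1 : rho i <= 2 * al := radius_le _.
    by rewrite /q invf_div ler_pM ?a1 ?a2 ?a3 ?(ltW (rho0 i)).
  have q1 : `|q i - 1| <= C / be / n.+1%:R.
    have -> : q i - 1 = (rho i.+1 - rho i) * (rho i)^-1 by rewrite /q; field; rewrite gt_eqF.
    rewrite normrM -[leRHS]mulrA [be^-1 * _]mulrC mulrA ler_pM//.
      apply: le_trans (HC _ _) _; rewrite ger0_norm; last by rewrite subr_ge0 pt_le//; exact: upart_itv.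
      by rewrite upart_step -?(size_upart R n).
    by rewrite ger0_norm ?a3 ?a2.
  have -> : C ^+ 2 / be ^+ 2 * (2 * al / be) / n.+1%:R ^+ 2 = (C / be / n.+1%:R) ^+ 2 * (2 * al / be).
    by move: (n.+1%:R) n0 => N N0; field; rewrite !gt_eqF.
  rewrite ler_pM ?sqr_ge0 ?invr_ge0 ?(ltW q0)// -real_normK ?num_real//.
  by rewrite lerXn2r ?nnegrE// !divr_ge0 ?(ltW C0) ?(ltW be0).
have lnsum : \sum_(i < size s) (ln (rho i.+1) - ln (rho i)) = 0.
  rewrite (pt_telescope (fun t => ln (radius t)) (upart_itv n)).
  have -> : radius 1 = radius 0 by rewrite /radius mulr1 mulr0 /cis mulr_natl cos2pi sin2pi cos0 sin0.
  by rewrite subrr.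
have qsum : `|\sum_(i < size s) (q i - 1)| <= C ^+ 2 / be ^+ 2 * (2 * al / be) / n.+1%:R.
  have -> : \sum_(i < size s) (q i - 1) =
      \sum_(i < size s) ((q i - 1) - (ln (rho i.+1) - ln (rho i))).
    by rewrite [RHS]sumrB lnsum subr0.
  rewrite ger0_norm; last first.
    by apply: sumr_ge0 => i _; have /andP[] := qs i (ltn_ord i).
  apply: (@le_trans _ _ (\sum_(i < size s) C ^+ 2 / be ^+ 2 * (2 * al / be) / n.+1%:R ^+ 2)).
    by apply: ler_sum => i _; have /andP[] := qs i (ltn_ord i).
  rewrite sumr_const card_ord size_upart -(mulr_natr (_ / _)).
  apply: le_of_eq.
  by move: (n.+1%:R) n0 => N N0; field; rewrite !gt_eqF.
rewrite SE.
have -> : \sum_(i < size s) ((q i)%:C * cis h - 1) - twopii R =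
   (\sum_(i < size s) (q i - 1))%:C * cis h + n.+1%:R * (cis h - 1 - 'i * h%:C).
  rewrite rmorph_sum mulr_suml.
  have -> : twopii R = n.+1%:R * ('i * h%:C).
    rewrite /h mulrCA -(rmorph_nat (real_complex R)) -rmorphM/= [n.+1%:R * _]mulrC divfK ?gt_eqF//.
    by apply/eqP; rewrite eq_complex/=; apply/andP; split; apply/eqP; ring.
  rewrite [n.+1%:R * (_ - _ - _)]mulrBr addrA; congr (_ - _).
  have -> : n.+1%:R * (cis h - 1) = \sum_(i < size s) (cis h - 1).
    by rewrite sumr_const card_ord size_upart mulr_natl.
  rewrite -big_split/=; apply: eq_bigr => i _.
  by rewrite (rmorphB (real_complex R) (q i) 1) rmorph1; ring.
apply: le_trans (nmD _ _) _; rewrite !nmM nm_cis mulr1 nmC.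
have -> : K / n.+1%:R = C ^+ 2 / be ^+ 2 * (2 * al / be) / n.+1%:R + 8 * pi ^+ 2 / n.+1%:R.
  by rewrite /K mulrDl.
apply: lerD => //.
have -> : nm (n.+1%:R : R[i]) = n.+1%:R.
  by rewrite -(rmorph_nat (real_complex R)) nmC ger0_norm.
apply: le_trans (ler_wpM2l (ltW n0) (cis_taylor h0)) _.
apply: le_of_eq; rewrite /h.
by move: (n.+1%:R) n0 => N N0; field; rewrite gt_eqF.
Qed.

Lemma winding_in w : gauge (w - p) < 1 -> inside rect_curve w.
Proof.
move=> w1; have H t : 0 <= t <= 1 -> ~ trace rect_curve (p + t%:C * (w - p)).
  move=> /andP[t0 t1] /rect_curve_trace; rewrite [p + _]addrC addrK gaugeZ// => E.
  have g0 : 0 <= gauge (w - p) by rewrite /gauge le_max divr_ge0 ?(ltW al0).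
  by move: E; nra.
split; last by rewrite -(winding_segment rect_curve_closed H) winding_center.
by have := H 1; rewrite rmorph1 mul1r addrC subrK; apply; rewrite ler01 lexx.
Qed.

Lemma winding_out w : 1 < gauge (w - p) -> winding_number rect_curve w = 0.
Proof.
move=> w1; apply: (@winding_ray _ _ rect_curve_closed w (w - p)).
  by apply/eqP => w0; move: w1; rewrite w0 gauge0 ltr10.
move=> t t0 /rect_curve_trace.
have -> : w + t%:C * (w - p) - p = (1 + t)%:C * (w - p).
  by rewrite (rmorphD (real_complex R) 1 t) rmorph1; ring.
rewrite gaugeZ; last lra.
by move=> E; move: E w1; nra.
Qed.

End Gauge.

(** Take a rectangle around the segment that is smaller than the distance from
    the segment to the complement of [G]. *)
Lemma enclosing_curve (R : realType) (G : set R[i]) (K : set R[i]) (m M : R) :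
  m <= M -> (forall z, G z -> exists2 r : R, 0 < r & forall w, nm (w - z) < r -> G w) ->
  (forall t, m <= t <= M -> G t%:C) -> K `<=` [set l | m%:C <= l <= M%:C] ->
  exists g, encloses G K g.
Proof.
move=> mM Gop Gm Km.
have [r r0 Hr] : exists2 r : R, 0 < r & forall t, m <= t <= M -> forall w, nm (w - t%:C) < r -> G w.
  apply: (@compact_uniform R m M (fun r t => forall w, nm (w - t%:C) < r -> G w)) => t tm.
  have [r r0 Hr] := Gop _ (Gm t tm); exists (r / 2); first by rewrite divr_gt0.
  move=> s e sm st /andP[e0 er] w ws; apply: Hr.
  have := nm_trans s%:C w t%:C; rewrite -rmorphB nmC; lra.
pose al := (M - m) / 2 + r / 4; pose be := r / 4.
have be0 : 0 < be by rewrite divr_gt0.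
have ba : be <= al by rewrite lerDr divr_ge0// subr_ge0.
have al0 : 0 < al by exact: lt_le_trans ba.
pose p : R[i] := ((m + M) / 2)%:C.
have inG w : gauge al be (w - p) <= 1 -> G w.
  rewrite /gauge ge_max !ler_pdivrMr// !mul1r ReB ImB/= subr0 => /andP[w1 w2].
  pose t := clamp m M (complex.Re w).
  have tm : m <= t <= M.
    rewrite /t /clamp le_max lexx/= ge_max mM/= ge_min lexx orbT//.
  apply: (Hr t tm); apply: le_lt_trans (nm_le_ReIm _) _; rewrite ReB ImB/= subr0.
  have : `|complex.Re w - t| <= r / 4.
    move: w1; rewrite /al !ler_norml /t /clamp => /andP[w11 w12].
    by case: (leP (complex.Re w) M) => h1; [case: (leP m (complex.Re w)) => h2|
      rewrite (max_r mM)]; apply/andP; split; lra.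
  by rewrite /be in w2; lra.
exists (rect_curve al be p); split.
- exact: rect_curve_closed.
- by move=> w /(rect_curve_trace be0 ba) w1; apply: inG; rewrite w1.
- move=> z /Km /=; rewrite !lecE/= => /andP[/andP[/eqP z1 z2] /andP[_ z3]].
  apply: winding_in => //; rewrite /gauge gt_max ReB ImB/= z1 subrr normr0 mul0r ltr01 andbT.
  by rewrite ltr_pdivrMr// mul1r ltr_norml /al; apply/andP; split; lra.
- move=> w nw; apply: winding_out => //; rewrite ltNge; apply/negP => /inG.
  exact: nw.
Qed.

(** * Invertibility in Banach algebras *)

Section BanachAlgebra.
Variables (R : realType) (A : banachStarAlgType R).
Implicit Types (x y a b c u v : A) (z w l : R[i]) (r s t e : R).

Local Notation unit := (@GRing.unit A).

Lemma nmMA x y : nm (x * y) <= nm x * nm y.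
Proof. by rewrite -lecR rmorphM/= -!nmE; exact: bsa_normM. Qed.

Lemma unit_of x y : y * x = 1 -> x * y = 1 -> x \is a unit.
Proof. by move=> h1 h2; apply/unitrP; exists y. Qed.

Lemma nmA_gt0 : 0 < nm (1 : A).
Proof.
rewrite lt0r nm_ge0 andbT; apply/eqP => n1.
have /eqP := @oner_neq0 A; apply; apply: nm_le0; by rewrite n1.
Qed.

Lemma nmX x n : nm (x ^+ n) <= nm (1 : A) * nm x ^+ n.
Proof.
elim: n => [|n ih]; first by rewrite !expr0 mulr1.
rewrite !exprS mulrCA; apply: le_trans (nmMA _ _) _.
by rewrite ler_wpM2l ?nm_ge0.
Qed.

Lemma small_expr r e : 0 <= r -> r < 1 -> 0 < e -> exists N, forall n, (N <= n)%N -> r ^+ n <= e.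
Proof.
move=> r0 r1 e0; have := @cvg_expr R r; rewrite ger0_norm// => /(_ r1).
move/cvgrPdist_lt => /(_ e e0) [N _ HN]; exists N => n Nn.
have := HN n Nn; rewrite sub0r normrN ger0_norm ?exprn_ge0//; exact: ltW.
Qed.

Lemma neumann x : nm x < 1 -> 1 - x \is a unit.
Proof.
move=> x1; set r := nm x; have r0 : 0 <= r := nm_ge0 x.
pose S n := \sum_(k < n) x ^+ k.
have Sx n : S n * x = x * S n.
  by apply: commr_sym; apply: commr_sum => k _; exact: commrX.
have SE n : (1 - x) * S n = 1 - x ^+ n.
  by apply: oppr_inj; rewrite opprB subrX1 -mulNr opprB.
have ES n : S n * (1 - x) = 1 - x ^+ n by rewrite -SE mulrBr mulrBl mulr1 mul1r Sx.
pose K : R := nm (1 : A) / (1 - r).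
have r1 : 0 < 1 - r by rewrite subr_gt0.
have K0 : 0 <= K by rewrite divr_ge0 ?nm_ge0// ltW.
have tail n k : nm (S (n + k)%N - S n) <= K * (r ^+ n - r ^+ (n + k)).
  elim: k => [|k ih]; first by rewrite addn0 !subrr nm0 mulr0.
  rewrite addnS {1}/S big_ord_recr/= -/(S _) addrAC.
  have -> : K * (r ^+ n - r ^+ (n + k).+1) =
      K * (r ^+ n - r ^+ (n + k)) + nm (1 : A) * r ^+ (n + k).
    by rewrite exprS /K; field; rewrite gt_eqF.
  by apply: le_trans (nmD _ _) _; apply: lerD => //; exact: nmX.
have tail' n k : nm (S (n + k)%N - S n) <= K * r ^+ n.
  apply: le_trans (tail n k) _; rewrite ler_wpM2l// gerBl exprn_ge0//.
have [y Hy] : exists y, forall e, 0 < e -> exists N, forall n, (N <= n)%N -> nm (S n - y) <= e.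
  apply: cauchy_lim => e e0.
  have [|N HN] := @small_expr r (e / (K + 1)) r0 x1; first by rewrite divr_gt0// ltr_wpDl.
  have H m n : (N <= m)%N -> (m <= n)%N -> nm (S n - S m) <= e.
    move=> Nm /subnKC <-; apply: le_trans (tail' _ _) _.
    apply: le_trans (ler_wpM2l K0 (HN _ Nm)) _; rewrite mulrC.
    by apply: mul_frac_le => //; exact: ltW.
  exists N => m n Nm Nn; case: (leqP m n) => [mn|/ltnW nm'].
    by rewrite nmB H.
  exact: H.
have lim1 (u : A) : (forall e, 0 < e -> exists N, forall n, (N <= n)%N ->
    nm (u - (1 - x ^+ n)) <= e) -> u = 1.
  move=> H; apply: nm_unique => e e0; have e20 : 0 < e / 2 by rewrite divr_gt0.
  have [N HN] := H _ e20.
  have [|N' HN'] := @small_expr r (e / 2 / nm (1 : A)) r0 x1.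
    by rewrite divr_gt0// nmA_gt0.
  pose n := maxn N N'; have h1 := HN n (leq_maxl _ _); have h2 := HN' n (leq_maxr _ _).
  have h3 : nm (x ^+ n) <= e / 2.
    apply: le_trans (nmX _ _) _; rewrite mulrC -ler_pdivlMr ?nmA_gt0//.
  have -> : u - 1 = (u - (1 - x ^+ n)) - x ^+ n by rewrite -[RHS]addrA -opprD subrK.
  by apply: le_trans (nm_sub _ _) _; rewrite [e]splitr lerD.
have K2 : 0 < nm (1 - x) + 1 by rewrite ltr_wpDl// nm_ge0.
apply: (@unit_of _ y); apply: lim1 => e e0.
  have [|N HN] := Hy (e / (nm (1 - x) + 1)); first by rewrite divr_gt0.
  exists N => n Nn; rewrite -ES -mulrBl; apply: le_trans (nmMA _ _) _.
  rewrite nmB; apply: le_trans (ler_wpM2r (nm_ge0 _) (HN n Nn)) _.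
  by apply: mul_frac_le; [exact: ltW|exact: nm_ge0].
have [|N HN] := Hy (e / (nm (1 - x) + 1)); first by rewrite divr_gt0.
exists N => n Nn; rewrite -SE -mulrBr; apply: le_trans (nmMA _ _) _.
rewrite (nmB y) mulrC; apply: le_trans (ler_wpM2r (nm_ge0 _) (HN n Nn)) _.
by apply: mul_frac_le; [exact: ltW|exact: nm_ge0].
Qed.

(** [1 - x] divides [1 - x ^+ n]. *)
Lemma neumannX x n : nm (x ^+ n) < 1 -> 1 - x \is a unit.
Proof.
move=> /neumann; have -> : 1 - x ^+ n = (1 - x) * \sum_(i < n) x ^+ i.
  by apply: oppr_inj; rewrite opprB subrX1 -mulNr opprB.
rewrite unitrM_comm; first by case/andP.
apply: commr_sum => k _; apply: commrX; apply: commr_sym.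
by apply: commrB; [exact: commr1|].
Qed.

Lemma nm_alg z : nm (z%:A : A) = nm z * nm (1 : A).
Proof. exact: nmZ. Qed.

Lemma unit_near x y : x \is a unit -> nm (x - y) * nm x^-1 < 1 -> y \is a unit.
Proof.
move=> xu xy; have -> : y = x * (1 - x^-1 * (x - y)).
  by rewrite mulrBr mulr1 mulrA mulrV// mul1r opprB addrC subrK.
rewrite unitrMr//; apply: neumann.
by apply: le_lt_trans (nmMA _ _) _; rewrite mulrC.
Qed.

Lemma inv_near x y : x \is a unit -> nm (x - y) * nm x^-1 <= 2^-1 ->
  y \is a unit /\ nm (x^-1 - y^-1) <= 2 * nm x^-1 ^+ 2 * nm (x - y).
Proof.
move=> xu xy; have yu : y \is a unit.
  by apply: (unit_near xu); rewrite (le_lt_trans xy)// invf_lt1// ltr1n.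
split => //.
have E : x^-1 - y^-1 = x^-1 * (y - x) * y^-1.
  by rewrite mulrBr mulVr// mulrBl mul1r mulrK.
have h1 : nm (x^-1 - y^-1) <= nm x^-1 * nm (x - y) * nm y^-1.
  rewrite E; apply: le_trans (nmMA _ _) _; rewrite ler_wpM2r ?nm_ge0//.
  by rewrite (nmB x); exact: nmMA.
have h2 : nm y^-1 <= 2 * nm x^-1.
  have := nm_sub x^-1 (x^-1 - y^-1); rewrite subKr.
  have : nm x^-1 * nm (x - y) * nm y^-1 <= 2^-1 * nm y^-1.
    by rewrite ler_wpM2r ?nm_ge0// mulrC.
  lra.
apply: le_trans h1 _.
have -> : 2 * nm x^-1 ^+ 2 * nm (x - y) = nm x^-1 * nm (x - y) * (2 * nm x^-1) by ring.
by rewrite ler_wpM2l ?mulr_ge0 ?nm_ge0.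
Qed.

Section PowerBound.
Variable v : A.
Hypothesis vu : forall z, nm z <= 1 -> 1 - z *: v \is a unit.

Let V j : A := v ^+ (2 ^ j).
Let W j z : A := (1 - z *: V j)^-1.

Let VS j : V j.+1 = V j * V j.
Proof. by rewrite /V expnS mulnC exprM expr2. Qed.

Let factor j (s : R[i]) : 1 - (s ^+ 2) *: V j.+1 = (1 - s *: V j) * (1 + s *: V j).
Proof.
rewrite VS mulrDr mulr1 mulrBl mul1r -scalerAl -scalerAr scalerA -expr2.
by rewrite addrA subrK.
Qed.

Let unitV j z : nm z <= 1 -> 1 - z *: V j \is a unit.
Proof.
elim: j z => [|j ih] z z1; first by rewrite /V expn0 expr1 vu.
rewrite -(sqr_sqrtc z) factor.
have s1 : nm (sqrtc z) <= 1.
  rewrite -(@ler_pXn2r _ 2) ?nnegrE ?nm_ge0// expr1n.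
  by rewrite expr2 -nmM -expr2 sqr_sqrtc.
rewrite unitrM_comm ?ih//=; last first.
  by apply: commrD; [exact: commr1|apply: commr_sym; apply: commrB; [exact: commr1|]].
by have := ih (- sqrtc z); rewrite scaleNr opprK; apply; rewrite nmN.
Qed.

Let WS j (s : R[i]) : nm s <= 1 -> W j.+1 (s ^+ 2) = 2^-1 *: (W j s + W j (- s)).
Proof.
move=> s1; have s2 : nm (s ^+ 2) <= 1 by rewrite expr2 nmM mulr_ile1 ?nm_ge0.
have u1 := unitV j s1; have u2 : 1 + s *: V j \is a unit.
  by have := @unitV j (- s); rewrite scaleNr opprK; apply; rewrite nmN.
have u3 := unitV j.+1 s2.
rewrite /W scaleNr opprK; apply: (mulrI u3); rewrite mulrV// -scalerAr.
have cm : (1 + s *: V j) * (1 - s *: V j) = (1 - s *: V j) * (1 + s *: V j).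
  by apply: commrB; [exact: commr1|apply: commr_sym; apply: commrD; [exact: commr1|]].
have e1 : (1 - s ^+ 2 *: V j.+1) / (1 - s *: V j) = 1 + s *: V j.
  by rewrite factor -cm mulrK.
have e2 : (1 - s ^+ 2 *: V j.+1) / (1 + s *: V j) = 1 - s *: V j.
  by rewrite factor mulrK.
rewrite mulrDr e1 e2 addrACA subrr addr0.
have -> : 1 + 1 = (2 : R[i]) *: (1 : A) by rewrite scaler_nat mulr2n.
by rewrite scalerA mulVf ?scale1r// pnatr_eq0.
Qed.

Let Wbound : exists2 K : R, 0 < K & forall z, nm z <= 1 -> nm (W 0 z) <= K.
Proof.
have [d d0 Hd] : exists2 d : R, 0 < d & forall x : R, -1 <= x <= 1 ->
    forall y : R, -1 <= y <= 1 -> nm (x +i* y) <= 1 -> nm (W 0 (x +i* y)) <= d^-1.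
  apply: (@compact_uniform R (-1) 1 (fun (d x : R) => forall y : R, -1 <= y <= 1 ->
     nm (x +i* y) <= 1 -> nm (W 0 (x +i* y)) <= d^-1)) => x x1.
  have [d d0 Hd] : exists2 d : R, 0 < d & forall y : R, -1 <= y <= 1 ->
      forall x' : R, `|x' - x| < d -> nm (x' +i* y) <= 1 -> nm (W 0 (x' +i* y)) <= d^-1.
    apply: (@compact_uniform R (-1) 1 (fun (d y : R) => forall x' : R, `|x' - x| < d ->
       nm (x' +i* y) <= 1 -> nm (W 0 (x' +i* y)) <= d^-1)) => y y1.
    have dist (x' y' : R) : nm ((x' +i* y') - (x +i* y)) <= `|x' - x| + `|y' - y|.
      by apply: le_trans (nm_le_ReIm _) _; rewrite ReB ImB.
    have [z1|z1] := leP (nm (x +i* y)) 1; last first.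
      exists ((nm (x +i* y) - 1) / 2); first by rewrite divr_gt0// subr_gt0.
      move=> y' e y'1 yy /andP[e0 ed] x' xx z'1.
      have := dist x' y'; have := nm_trans (x +i* y) (x' +i* y') 0.
      rewrite !subr0 (nmB (x' +i* y')).
      have := nm_trans (x +i* y) 0 (x' +i* y').
      have := nmD ((x +i* y) - (x' +i* y')) (x' +i* y'); rewrite subrK nmB; lra.
    set z := x +i* y; have u := unitV 0 z1; pose k := nm (W 0 z).
    have k0 : 0 <= k := nm_ge0 _; have v0 := nm_ge0 v.
    pose d := (2 * (k + 1) * (nm v + 1) + 2 * k + 1)^-1 / 2.
    have D0 : 0 < 2 * (k + 1) * (nm v + 1) + 2 * k + 1.
      rewrite -addrA ltr_wpDl ?mulr_ge0//; lra.
    exists d; first by rewrite divr_gt0 ?invr_gt0.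
    move=> y' e y'1 yy /andP[e0 ed] x' xx z'1.
    have zz : nm ((x' +i* y') - z) * (2 * (k + 1) * (nm v + 1) + 2 * k + 1) <= 1.
      rewrite -ler_pdivlMr// div1r; apply: le_trans (dist _ _) _.
      by move: xx yy ed; rewrite /d; lra.
    set z' := x' +i* y' in zz z'1 *.
    have n0 := nm_ge0 (z' - z).
    have E : nm ((1 - z *: V 0) - (1 - z' *: V 0)) = nm (z' - z) * nm v.
      by rewrite opprB addrC addrA subrK -scalerBl nmZ /V expn0 expr1.
    have [|_ h] := @inv_near (1 - z *: V 0) (1 - z' *: V 0) u.
      rewrite E -/(W 0 z) -/k.
      have : nm (z' - z) * nm v * k * 2 <= 1.
        apply: le_trans zz; have := mulr_ge0 v0 k0; nra.
      lra.
    rewrite -/(W 0 z) -/(W 0 z') -/k E in h.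
    have h2 : nm (W 0 z') <= 2 * k + 1.
      have := nm_sub (W 0 z) (W 0 z - W 0 z'); rewrite subKr -/k.
      have : 2 * k ^+ 2 * (nm (z' - z) * nm v) <= k + 1.
        apply: (@le_trans _ _ (k * (nm (z' - z) * (2 * (k + 1) * (nm v + 1) + 2 * k + 1)))).
          have := mulr_ge0 v0 k0; have := mulr_ge0 k0 n0; have := mulr_ge0 (mulr_ge0 k0 n0) v0.
          nra.
        by apply: le_trans (ler_wpM2l k0 zz) _; lra.
      lra.
    apply: le_trans h2 _.
    have : 2 * (k + 1) * (nm v + 1) + 2 * k + 1 <= e^-1.
      rewrite -[leLHS]invrK lef_pV2 ?posrE ?invr_gt0//; move: ed; rewrite /d; lra.
    by have := mulr_ge0 v0 k0; nra.
  exists d => // x' e x'1 xx /andP[e0 ed] y y1 z1.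
  apply: le_trans (Hd y y1 x' xx z1) _.
  by rewrite lef_pV2 ?posrE ?ltW.
exists d^-1; first by rewrite invr_gt0.
case=> x y z1; apply: Hd => //.
  by have := le_trans (Re_le_nm _) z1; rewrite ler_norml.
by have := le_trans (Im_le_nm _) z1; rewrite ler_norml.
Qed.

Let equicont e : 0 < e -> exists2 d : R, 0 < d & forall j (t t' : R) z, 0 <= t <= 1 -> 0 <= t' <= 1 ->
  `|t - t'| < d -> nm z = 1 ->
  nm (W j ((t ^+ (2 ^ j))%:C * z) - W j ((t' ^+ (2 ^ j))%:C * z)) <= e.
Proof.
move=> e0; have [K K0 HK] := Wbound.
have Q0 : 0 < K ^+ 2 * nm v + 1 by rewrite ltr_wpDl// mulr_ge0 ?nm_ge0// exprn_ge0 ?ltW.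
exists (e / (K ^+ 2 * nm v + 1)); first by rewrite divr_gt0.
elim=> [|j ih] t t' z t1 t'1 tt z1.
  rewrite expn0 !expr1.
  have q (s : R) : 0 <= s <= 1 -> nm (s%:C * z) <= 1.
    by move=> /andP[s0 s1]; rewrite nmM nmC ger0_norm// z1 mulr1.
  have u := @unitV 0 _ (q _ t1); have u' := @unitV 0 _ (q _ t'1).
  have -> : W 0 (t%:C * z) - W 0 (t'%:C * z) =
     W 0 (t%:C * z) * ((t%:C - t'%:C) * z *: v) * W 0 (t'%:C * z).
    have -> : (t%:C - t'%:C) * z *: v = (1 - (t'%:C * z) *: V 0) - (1 - (t%:C * z) *: V 0).
      by rewrite opprB [RHS]addrC [RHS]addrA subrK mulrBl scalerBl /V expn0 expr1.
    by rewrite mulrBr mulrBl mulrK// mulVr// mul1r.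
  apply: le_trans (nmMA _ _) _; apply: le_trans (ler_wpM2r (nm_ge0 _) (nmMA _ _)) _.
  rewrite nmZ nmM -(rmorphB (real_complex R) t t') nmC z1 mulr1.
  move: tt; rewrite ltr_pdivlMr// => tt.
  apply: (@le_trans _ _ (K * (`|t - t'| * nm v) * K)).
    rewrite ler_pM ?mulr_ge0 ?nm_ge0 ?HK ?q// ler_wpM2r ?mulr_ge0 ?nm_ge0 ?HK ?q//.
  have : 0 <= `|t - t'| by []. lra.
rewrite -(sqr_sqrtc z); set w := sqrtc z.
have w1 : nm w = 1.
  have : nm w ^+ 2 = 1 by rewrite expr2 -nmM -expr2 sqr_sqrtc.
  by move/eqP; rewrite sqrf_eq1 => /orP[/eqP//|/eqP h]; have := nm_ge0 w; rewrite h; lra.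
have sq (s : R) : (s ^+ (2 ^ j.+1))%:C * w ^+ 2 = ((s ^+ (2 ^ j))%:C * w) ^+ 2.
  by rewrite exprMn expnS mulnC exprM (rmorphXn (real_complex R)).
have q (s : R) : 0 <= s <= 1 -> nm ((s ^+ (2 ^ j))%:C * w) <= 1.
  by move=> /andP[s0 s1]; rewrite nmM nmC w1 mulr1 ger0_norm ?exprn_ge0 ?exprn_ile1.
rewrite !sq !WS ?q// -scalerBr nmZ opprD addrACA.
have h1 := ih t t' w t1 t'1 tt w1.
have := ih t t' (- w) t1 t'1 tt; rewrite nmN !mulrN => /(_ w1) h2.
have -> : nm (2^-1 : R[i]) = 2^-1.
  by rewrite nmV -(rmorph_nat (real_complex R)) nmC ger0_norm.
have := nmD (W j ((t ^+ (2 ^ j))%:C * w) - W j ((t' ^+ (2 ^ j))%:C * w))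
  (W j (- ((t ^+ (2 ^ j))%:C * w)) - W j (- ((t' ^+ (2 ^ j))%:C * w))).
lra.
Qed.

(** A form of the spectral radius formula. The resolvents of the powers
    [v ^+ (2 ^ j)] are averages of resolvents of [v], so in terms of a dilation
    parameter [t] they are equicontinuous, uniformly in [j]. If the powers of
    [t v] tend to 0, their resolvents tend to 1; then the resolvents for [t']
    close to [t] are eventually close to 1, so the powers of [t' v] are
    eventually small, and in fact tend to 0 by repeated squaring. Finitely many
    such steps lead from [t = 0] to [t = 1]. *)
Lemma power_bound : exists j, nm (v ^+ (2 ^ j)) <= 2^-1.
Proof.
have [d d0 Hd] : exists2 d : R, 0 < d & forall j (t t' : R) z, 0 <= t <= 1 -> 0 <= t' <= 1 ->
   `|t - t'| < d -> nm z = 1 ->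
  nm (W j ((t ^+ (2 ^ j))%:C * z) - W j ((t' ^+ (2 ^ j))%:C * z)) <= 4^-1.
  by apply: equicont; rewrite invr_gt0.
pose X (t : R) j : A := (t ^+ (2 ^ j))%:C *: V j.
have XS t j : X t j.+1 = X t j * X t j.
  by rewrite /X VS -scalerAl -scalerAr scalerA expnS mulnC exprM expr2 (rmorphM (real_complex R)).
pose P (t : R) := exists J, forall j, (J <= j)%N -> nm (X t j) <= 2^-1.
have X1 t j : 0 <= t <= 1 -> 1 - X t j \is a unit.
  move=> /andP[t0 t1]; apply: unitV.
  by rewrite nmC ger0_norm ?exprn_ge0 ?exprn_ile1.
have step (t t' : R) : 0 <= t <= 1 -> 0 <= t' <= 1 -> `|t - t'| < d -> P t -> P t'.
  move=> t1 t'1 tt [J HJ].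
  have Xk k : nm (X t (J + k)%N) <= 2^-1 ^+ k.+1.
    elim: k => [|k ih]; first by rewrite addn0 expr1 HJ.
    rewrite addnS XS; apply: le_trans (nmMA _ _) _; rewrite exprS ler_pM ?nm_ge0//.
    by rewrite HJ// leq_addr.
  exists (J + 4)%N => j Jj.
  have Xj : nm (X t j) <= 13^-1.
    have -> : j = (J + (j - J))%N by rewrite subnKC// (leq_trans _ Jj)// leq_addr.
    apply: le_trans (Xk _) _; have : (4 <= j - J)%N by rewrite leq_subRL// (leq_trans _ Jj)// leq_addr.
    move=> /subnKC <-; rewrite -addSn exprD.
    apply: (@le_trans _ _ (2^-1 ^+ 5)); last by rewrite exprVn lef_pV2 ?posrE// -natrX ler_nat.
    by rewrite ler_piMr ?exprn_ge0// exprn_ile1// invf_le1// ler1n.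
  have small (x y : A) (a : R) : 0 <= a < 1 -> (1 - x) * y = 1 -> nm x <= a -> nm (y - 1) <= a / (1 - a).
    move=> /andP[a0 a1] xy xa; rewrite ler_pdivlMr ?subr_gt0//.
    have E : y - 1 = x + x * (y - 1).
      by rewrite mulrBr mulr1 [RHS]addrC subrK -[X in _ - X]xy mulrBl mul1r subKr.
    have := nmD x (x * (y - 1)); rewrite -E; have := nmMA x (y - 1); have := nm_ge0 (y - 1).
    nra.
  have W1 : nm (W j ((t ^+ (2 ^ j))%:C) - 1) <= 12^-1.
    apply: le_trans (small (X t j) _ 13^-1 _ _ Xj) _.
    - by rewrite invr_ge0 ler0n/= invf_lt1// ltr1n.
    - by rewrite /W mulrV// X1.
    - by have -> : 13^-1 / (1 - 13^-1) = 12^-1 :> R by field.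
  have := Hd j t t' 1 t1 t'1 tt (nm1 R); rewrite !mulr1 => W2.
  have W3 : nm (W j ((t' ^+ (2 ^ j))%:C) - 1) <= 3^-1.
    have := nm_trans (W j ((t ^+ (2 ^ j))%:C)) (W j ((t' ^+ (2 ^ j))%:C)) 1.
    by rewrite (nmB (W j _) (W j ((t ^+ (2 ^ j))%:C))); lra.
  have := small (1 - W j ((t' ^+ (2 ^ j))%:C)) (1 - X t' j) 3^-1.
  rewrite subKr mulVr ?X1// [1 - X t' j - 1]addrAC subrr add0r nmN nmB => h.
  apply: le_trans (h _ erefl W3) _; last first.
    by have -> : 3^-1 / (1 - 3^-1) = 2^-1 :> R by field.
  by rewrite invr_ge0 ler0n/= invf_lt1// ltr1n.
pose n := Num.truncn d^-1.
have n0 : 0 < n.+1%:R :> R by rewrite ltr0n.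
have nd : n.+1%:R^-1 < d by rewrite -[d]invrK ltf_pV2 ?posrE ?invr_gt0// truncnS_gt.
have Pk k : (k <= n.+1)%N -> P (k%:R / n.+1%:R).
  elim: k => [|k ih] kn.
    exists 0%N => j _; rewrite /X mul0r expr0n expn_eq0/= rmorph0 scale0r nm0.
    by rewrite invr_ge0.
  have bd i : (i <= n.+1)%N -> 0 <= (i%:R / n.+1%:R : R) <= 1.
    by move=> iN; rewrite divr_ge0//= ler_pdivrMr// mul1r ler_nat.
  apply: step (ih (ltnW kn)); rewrite ?bd// ?(ltnW kn)//.
  rewrite -mulrBl -natr1 opprD addrA subrr add0r mulN1r normrN.
  by rewrite ger0_norm ?invr_ge0// ltW.
have [J HJ] := Pk n.+1 (leqnn _); exists J.
have := HJ J (leqnn J); rewrite divff ?gt_eqF// /X expr1n.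
by rewrite rmorph1 scale1r.
Qed.

End PowerBound.

(** Subadditivity of the spectral radius on commuting elements: the powers of [v]
    are bounded by [power_bound], so the binomial formula bounds those of
    [u + v]. *)
Lemma unit_sum u v l : u * v = v * u -> nm u <= 1 ->
  (forall z, nm z <= 1 -> 1 - z *: v \is a unit) -> 1 < nm l ->
  1 - (2 * l)^-1 *: (u + v) \is a unit.
Proof.
move=> uv u1 vu l1; have [j vj] := power_bound vu.
set N := (2 ^ j)%N in vj; have N0 : (0 < N)%N by rewrite expn_gt0.
have [C C0 vC] : exists2 C, 0 <= C & forall k, nm (v ^+ k) <= C.
  exists (\sum_(k < N) nm (v ^+ k)); first by apply: sumr_ge0 => k _; exact: nm_ge0.
  elim/ltn_ind => k ih; case: (ltnP k N) => kN.
    by rewrite (bigD1 (Ordinal kN))//= lerDl sumr_ge0// => i _; exact: nm_ge0.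
  rewrite -(subnKC kN) exprD; apply: le_trans (nmMA _ _) _.
  have := ih (k - N)%N; rewrite ltn_subLR// -[X in (X < _)%N]add0n ltn_add2r N0 => /(_ isT) h.
  have := nm_ge0 (v ^+ (k - N)); have := nm_ge0 (v ^+ N).
  by move: h vj; nra.
have K0 := nmA_gt0; set K := nm (1 : A) in K0.
have uk k : nm (u ^+ k) <= K.
  apply: le_trans (nmX _ _) _; rewrite ler_piMr ?(ltW K0)// exprn_ile1 ?nm_ge0//.
have bin m : nm ((u + v) ^+ m) <= K * C * 2 ^+ m.
  rewrite exprDn_comm//; apply: le_trans (nm_sum _) _.
  apply: (@le_trans _ _ (\sum_(i < m.+1) K * C * ('C(m, i))%:R)).
    apply: ler_sum => i _; rewrite -scaler_nat nmZ mulrC.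
    rewrite -(rmorph_nat (real_complex R)) nmC ger0_norm// ler_wpM2r//.
    by apply: le_trans (nmMA _ _) _; rewrite ler_pM ?nm_ge0.
  rewrite -mulr_sumr -natr_sum -natrX ler_wpM2l ?mulr_ge0 ?(ltW K0)// ler_nat.
  rewrite (_ : 2 ^ m = (1 + 1) ^ m)%N// expnDn; apply: leq_sum => i _.
  by rewrite !exp1n !muln1.
have l0 : 0 < nm l by apply: lt_trans l1.
have KC0 : 0 <= K * C by rewrite mulr_ge0// ltW.
have [|||m Hm] := @small_expr (nm l)^-1 ((K * C + 1)^-1 / 2).
- by rewrite invr_ge0 ltW.
- by rewrite invf_lt1.
- by rewrite divr_gt0 ?invr_gt0// ltr_wpDl.
apply: (@neumannX _ m); rewrite exprZn nmZ.
have -> : nm ((2 * l)^-1 ^+ m) = (nm l)^-1 ^+ m / 2 ^+ m.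
  elim: m {Hm} => [|m ih]; first by rewrite !expr0 nm1 divr1.
  rewrite !exprS nmM ih nmV nmM -(rmorph_nat (real_complex R)) nmC ger0_norm//.
  by field; rewrite gt_eqF//= gt_eqF// exprn_gt0.
apply: le_lt_trans (ler_wpM2l _ (bin m)) _.
  by rewrite divr_ge0 ?exprn_ge0 ?invr_ge0// ltW.
have -> : (nm l)^-1 ^+ m / 2 ^+ m * (K * C * 2 ^+ m) = (nm l)^-1 ^+ m * (K * C).
  have : 0 < (2 : R) ^+ m by rewrite exprn_gt0.
  by move: (2 ^+ m) => q q0; field; rewrite !gt_eqF.
apply: le_lt_trans (ler_wpM2r KC0 (Hm m (leqnn m))) _.
have : (K * C + 1)^-1 * (K * C) <= 1 by rewrite mulrC ler_pdivrMr ?ltr_wpDl// mul1r lerDl.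
by lra.
Qed.

End BanachAlgebra.

(** * Positive functionals on Hermitian algebras *)

Section Star.
Variables (R : realType) (A : banachStarAlgType R).
Implicit Types (a b c x y e : A) (z w l : R[i]) (r : R).

Lemma starK a : star (star a) = a. Proof. exact: bsa_starK. Qed.
Lemma starD a b : star (a + b) = star a + star b. Proof. exact: bsa_starD. Qed.
Lemma starZ z a : star (z *: a) = conjc z *: star a. Proof. exact: bsa_starZ. Qed.
Lemma starM a b : star (a * b) = star b * star a. Proof. exact: bsa_starM. Qed.

Lemma star1 : star (1 : A) = 1.
Proof. by rewrite -[LHS]mulr1 -[X in _ * X]starK -starM mulr1 starK. Qed.

Lemma star0 : star (0 : A) = 0.
Proof. by have := starZ 0 (0 : A); rewrite conjc0 !scale0r. Qed.

Lemma starN a : star (- a) = - star a.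
Proof. by rewrite -scaleN1r starZ rmorphN rmorph1 scaleN1r. Qed.

Lemma starB a b : star (a - b) = star a - star b.
Proof. by rewrite starD starN. Qed.

Lemma star_sum n (F : 'I_n -> A) : star (\sum_(i < n) F i) = \sum_(i < n) star (F i).
Proof. by apply: big_morph; [exact: starD|exact: star0]. Qed.

Lemma star_unit a : a \is a GRing.unit -> star a \is a GRing.unit.
Proof.
move=> au; apply: (@unit_of _ _ _ (star a^-1)).
  by rewrite -starM mulrV// star1.
by rewrite -starM mulVr// star1.
Qed.

Lemma star_inv a : a \is a GRing.unit -> star a^-1 = (star a)^-1.
Proof.
move=> au; apply: (mulrI (star_unit au)).
by rewrite mulrV ?star_unit// -starM mulVr// star1.
Qed.

Lemma spectrum_bound a l : spectrum a l -> nm l <= nm a.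
Proof.
move=> la; rewrite leNgt; apply/negP => al; apply/negP: la; rewrite negbK.
have l0 : l != 0 by rewrite -nm_gt0 (le_lt_trans (nm_ge0 _) al).
have -> : l%:A - a = l%:A * (1 - l^-1 *: a).
  by rewrite -scalerAl mul1r scalerBr scalerA mulfV// scale1r.
rewrite unitrM_comm; last by rewrite /GRing.comm -scalerAl mul1r -scalerAr mulr1.
rewrite scaler_unit ?unitfE// unitr1/=; apply: neumann.
by rewrite nmZ nmV mulrC ltr_pdivrMr ?mul1r// nm_gt0.
Qed.

Lemma spectrum_sub a l w : spectrum (a - w%:A) l -> spectrum a (l + w).
Proof. by rewrite /spectrum/= scalerDl opprB addrA addrAC. Qed.

Lemma spectrum_opp a l : spectrum (- a) l -> spectrum a (- l).
Proof.
rewrite /spectrum/= => H; apply: contra H => H.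
by rewrite opprK -[l%:A + a]opprK opprD -scaleNr unitrN.
Qed.

End Star.

Section Positive.
Variables (R : realType) (A : banachStarAlgType R) (psi : {scalar A}).
Hypothesis herm : hermitian_algebra A.
Hypothesis pos : positive_functional psi.
Hypothesis psi1 : normalized psi.
Implicit Types (a b c x y e : A) (z w l : R[i]) (r : R).

Lemma psi_alg z : psi z%:A = z.
Proof. by rewrite linearZ/= psi1 mulr1. Qed.

Lemma psi_ge a r : selfadjoint a -> (forall l, spectrum a l -> r <= complex.Re l) ->
  r%:C <= psi a.
Proof.
move=> sa H; rewrite -subr_ge0 -{1}(psi_alg r%:C) -linearB; apply: pos; split.
  by rewrite /selfadjoint starB sa starZ star1 conjc_real.
move=> l /spectrum_sub lr /=; have /complex_realP[k lk] := herm sa lr.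
have := H _ lr; rewrite lk/= => rk.
have -> : l = (k - r)%:C by rewrite (rmorphB (real_complex R) k r)/= -lk addrK.
by rewrite ler0c subr_ge0.
Qed.

Lemma psi_le a r : selfadjoint a -> (forall l, spectrum a l -> complex.Re l <= r) ->
  psi a <= r%:C.
Proof.
move=> sa H; have := @psi_ge (- a) (- r).
rewrite linearN (rmorphN (real_complex R)) lerN2; apply.
  by rewrite /selfadjoint starN sa.
move=> l /spectrum_opp /H; case: l => l1 l2 /=; lra.
Qed.

Lemma psi_real a : selfadjoint a -> complex.Im (psi a) = 0.
Proof.
move=> sa; have := @psi_ge a (- nm a) sa.
rewrite lecE => H; have /andP[/eqP-> _] : (complex.Im (psi a) == 0) && (- nm a <= complex.Re (psi a)); last by [].
apply: H => l /spectrum_bound h.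
by have := Re_le_nm l; rewrite ler_norml; lra.
Qed.

Lemma half_sum_selfadjoint a : selfadjoint (2^-1 *: (a + star a)).
Proof.
rewrite /selfadjoint starZ starD starK [star a + a]addrC; congr (_ *: _).
by rewrite conjc_inv conjc_nat.
Qed.

Lemma half_double x : 2^-1 *: (x + x) = x.
Proof. by rewrite scalerDr -scalerDl (_ : 2^-1 + 2^-1 = 1) ?scale1r//; field. Qed.

(** The skew part of [a] is ['i] times a selfadjoint element, on which [psi] is
    real. *)
Lemma psi_Re a : complex.Re (psi a) = complex.Re (psi (2^-1 *: (a + star a))).
Proof.
pose h := 2^-1 *: (a + star a); pose k := (2^-1 * - 'i) *: (a - star a).
have sk : selfadjoint k.
  rewrite /selfadjoint starZ starB starK -[star a - a]opprB scalerN -scaleNr.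
  congr (_ *: _); have -> : (2^-1 : R[i]) = (2^-1)%:C by rewrite fmorphV/= rmorph_nat.
  by apply/eqP; rewrite eq_complex/=; apply/andP; split; apply/eqP; ring.
have aE : a = h + 'i *: k.
  have ii : 'i * (2^-1 * - 'i) = 2^-1 :> R[i].
    by rewrite mulrCA mulrN -expr2 sqr_i opprK mulr1.
  rewrite /h /k scalerA ii -scalerDr addrACA subrr addr0.
  by rewrite half_double.
rewrite [in LHS]aE.
move: sk (half_sum_selfadjoint a : star h = h); rewrite -/h; move: h k {aE} => h k sk sh.
rewrite linearD linearZ/=.
by have := psi_real sk; case: (psi h) (psi k) => h1 h2 [k1 k2] /= ->; ring.
Qed.

(** Continuity of [psi] on the elements that commute with their adjoint. The
    spectrum of [star e] is conjugate to that of [e], so it lies in the disc of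
    radius [r] even though [star] need not be continuous; since [e] and [star e]
    commute, [unit_sum] confines the spectrum of their half-sum to [-r, r]. *)
Lemma psi_bound e r : e * star e = star e * e -> 0 < r -> nm e < r ->
  `|complex.Re (psi e)| <= r.
Proof.
move=> ee r0 er; rewrite psi_Re; set h := 2^-1 *: _.
have sh : selfadjoint h := half_sum_selfadjoint e.
have rc0 : r%:C != 0 by rewrite fmorph_eq0 gt_eqF.
pose u := (r%:C)^-1 *: e.
have u1 : nm u < 1.
  by rewrite nmZ nmV nmC ger0_norm ?(ltW r0)// mulrC ltr_pdivrMr// mul1r.
have uu : u * star u = star u * u.
  by rewrite /u starZ -!scalerAl -!scalerAr ee !scalerA mulrC.
have hE : h = (2 * (r%:C)^-1)^-1 *: (u + star u).
  rewrite /u starZ conjc_inv conjc_real -scalerDr scalerA; congr (_ *: _).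
  by rewrite invfM invrK -mulrA mulfV// mulr1.
have vu z : nm z <= 1 -> 1 - z *: star u \is a GRing.unit.
  move=> z1; have -> : 1 - z *: star u = star (1 - conjc z *: u).
    by rewrite starB star1 starZ conjcK.
  apply: star_unit; apply: neumann; apply: le_lt_trans u1.
  by rewrite nmZ {1}/nm normcJ -/(nm z) ler_piMl ?nm_ge0.
have hs l : spectrum h l -> `|complex.Re l| <= r.
  move=> lh; have /complex_realP[k lk] := herm sh lh.
  rewrite lk/= leNgt; apply/negP => rk; apply/negP: lh; rewrite negbK.
  have k0 : k%:C != 0 by rewrite -nm_gt0 nmC (lt_trans r0).
  have l1 : 1 < nm (k%:C / r%:C).
    by rewrite nmM nmV !nmC [`|r|]ger0_norm ?(ltW r0)// ltr_pdivlMr// mul1r.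
  have := unit_sum uu (ltW u1) vu l1; rewrite -(@scaler_unit _ _ k%:C) ?unitfE//.
  have E : k%:C * (2 * (k%:C / r%:C))^-1 = (2 / r%:C)^-1 by field; rewrite ?k0 ?rc0.
  by rewrite lk scalerBr scalerA hE E.
rewrite ler_norml; apply/andP; split.
  have : (- r)%:C <= psi h.
    by apply: psi_ge => // l /hs; rewrite ler_norml => /andP[].
  by rewrite lecE/= => /andP[].
have : psi h <= r%:C.
  by apply: psi_le => // l /hs; rewrite ler_norml => /andP[].
by rewrite lecE/= => /andP[].
Qed.

Section Rational.
Variable c : A.
Hypothesis sc : selfadjoint c.

Let ev (p : {poly R[i]}) : A := horner_alg c p.

(** [x] is the value at [c] of the rational function [p / q], written as
    [q(c) x = p(c)] so that no inverse occurs; [phi] is that function on the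
    spectrum. *)
Definition rational_value x (phi : R[i] -> R[i]) : Prop :=
  exists p q : {poly R[i]}, ev q * x = ev p /\
    forall t, spectrum c t -> q.[t] != 0 /\ q.[t] * phi t = p.[t].

Let ev_comm p q : ev p * ev q = ev q * ev p.
Proof. by rewrite -!rmorphM/= mulrC. Qed.

Let evZ z p : ev (z *: p) = z *: ev p.
Proof. by rewrite -mul_polyC /ev rmorphM/= horner_algC -scalerAl mul1r. Qed.

Lemma rational_value_ext x phi phi' : (forall t, spectrum c t -> phi t = phi' t) ->
  rational_value x phi -> rational_value x phi'.
Proof.
by move=> E [p [q [h H]]]; exists p, q; split => // t ts; rewrite -E//; exact: H.
Qed.

Lemma rational_valueD x y phi chi : rational_value x phi -> rational_value y chi ->
  rational_value (x + y) (fun t => phi t + chi t).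
Proof.
move=> [p [q [h H]]] [p' [q' [h' H']]]; exists (p * q' + q * p'), (q * q'); split.
  have -> : ev (p * q' + q * p') = ev q' * ev p + ev q * ev p'.
    by rewrite (ev_comm q') /ev rmorphD !rmorphM.
  have -> : ev (q * q') = ev q * ev q' by rewrite /ev rmorphM.
  by rewrite mulrDr -[ev q * ev q' * y]mulrA h' (ev_comm q q') -mulrA h.
move=> t ts; have [q0 e] := H t ts; have [q'0 e'] := H' t ts.
rewrite hornerD !hornerM mulf_neq0//; split => //.
by rewrite -e -e'; ring.
Qed.

Lemma rational_valueZ z x phi : rational_value x phi ->
  rational_value (z *: x) (fun t => z * phi t).
Proof.
move=> [p [q [h H]]]; exists (z *: p), q; split.
  by rewrite -scalerAr h evZ.
by move=> t ts; have [q0 e] := H t ts; split => //; rewrite hornerZ -e; ring.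
Qed.

Lemma rational_value_alg z : rational_value z%:A (fun=> z).
Proof.
exists z%:P, 1; split; first by rewrite /ev rmorph1 mul1r horner_algC.
by move=> t ts; rewrite !hornerE oner_neq0.
Qed.

Lemma rational_value_id : rational_value c id.
Proof.
exists 'X, 1; split; first by rewrite /ev rmorph1 mul1r horner_algX.
by move=> t ts; rewrite !hornerE oner_neq0.
Qed.

Lemma rational_value_inv z : ~ spectrum c z ->
  rational_value (z%:A - c)^-1 (fun t => (z - t)^-1).
Proof.
move=> zc; have zu : z%:A - c \is a GRing.unit by apply: contrapT => /negP.
exists 1, (z%:P - 'X); split.
  by rewrite /ev rmorphB/= horner_algC horner_algX mulrV// rmorph1.
move=> t ts; rewrite !hornerE; have zt : z - t != 0.
  by apply/negP => /eqP/subr0_eq E; apply: zc; rewrite E.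
by rewrite mulfV.
Qed.

Lemma rational_value_sum n (x : 'I_n -> A) (phi : 'I_n -> R[i] -> R[i]) :
  (forall i, rational_value (x i) (phi i)) ->
  rational_value (\sum_(i < n) x i) (fun t => \sum_(i < n) phi i t).
Proof.
elim: n x phi => [|n ih] x phi H.
  rewrite big_ord0 -(scale0r 1); apply: rational_value_ext (rational_value_alg 0) => t _.
  by rewrite big_ord0.
rewrite big_ord_recl; apply: rational_value_ext (rational_valueD (H ord0) (ih _ _ (fun i => H _))).
by move=> t _; rewrite big_ord_recl.
Qed.

(** The functional replaces Liouville's theorem: were the spectrum empty, every
    real number would be a lower bound of [psi c]. *)
Lemma spectrum_nonempty : exists t, spectrum c t.
Proof.
apply: contrapT => H.
have : (complex.Re (psi c) + 1)%:C <= psi c.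
  by apply: psi_ge => // l lc; exfalso; apply: H; exists l.
by rewrite lecE/= => /andP[_]; lra.
Qed.

Let ev_unit p : p != 0 -> (forall t, spectrum c t -> p.[t] != 0) -> ev p \is a GRing.unit.
Proof.
move=> p0 H; have [rs E] := closed_field_poly_normal p.
have lc : lead_coef p != 0 by rewrite lead_coef_eq0.
have rn z : z \in rs -> ~ spectrum c z.
  move=> zr /H; rewrite E hornerZ horner_prod; apply/negP; rewrite negbK.
  by rewrite (big_rem z)//= hornerXsubC subrr mul0r mulr0.
rewrite E evZ /ev scaler_unit ?unitfE//; elim: rs {E} rn => [|z rs ih] rn.
  by rewrite big_nil rmorph1 unitr1.
rewrite big_cons rmorphM/=.
have zu : ev ('X - z%:P) \is a GRing.unit.
  rewrite /ev rmorphB/= horner_algC horner_algX -opprB unitrN.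
  by apply: contrapT => /negP; exact: (rn z (mem_head _ _)).
rewrite unitrMr//; apply: ih => w wr; apply: rn; by rewrite in_cons wr orbT.
Qed.

(** Spectral mapping: otherwise the numerator of [l - phi] has no zero on the
    spectrum; it splits into factors that are invertible at [c]. *)
Lemma rational_spectrum x phi l : rational_value x phi -> spectrum x l ->
  exists2 t, spectrum c t & l = phi t.
Proof.
move=> H lx; apply: contrapT => nE.
have [p [q [h {}H]]] : rational_value (l%:A + -1 *: x) (fun t => l - phi t).
  apply: rational_value_ext (rational_valueD (rational_value_alg l) (rational_valueZ (-1) H)).
    by move=> t _; rewrite mulN1r.
have [t0 t0c] := spectrum_nonempty.
have pt t : spectrum c t -> p.[t] != 0.
  move=> tc; have [q0 <-] := H t tc; rewrite mulf_neq0// subr_eq0.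
  by apply/eqP => E; apply: nE; exists t.
have qu : ev q \is a GRing.unit.
  apply: ev_unit => [|t /H[]//]; apply/eqP => q0.
  by have [] := H t0 t0c; rewrite q0 horner0 eqxx.
have pu : ev p \is a GRing.unit.
  apply: ev_unit => //; apply/eqP => p0.
  by have := pt t0 t0c; rewrite p0 horner0 eqxx.
by move/negP: lx; apply; rewrite -(scaleN1r x) -(unitrMr _ qu) h.
Qed.

(** By [psi_Re] only [2^-1 *: (x + star x)] matters; it is again a rational
    function of [c], with values [Re (phi t)] on the spectrum. *)
Lemma psi_rational_ge x phi phi' r : rational_value x phi ->
  rational_value (star x) phi' ->
  (forall t, spectrum c t -> phi' t = conjc (phi t)) ->
  (forall t, spectrum c t -> r <= complex.Re (phi t)) -> r <= complex.Re (psi x).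
Proof.
move=> hx hx' E Hr; rewrite psi_Re.
have := @psi_ge (2^-1 *: (x + star x)) r (half_sum_selfadjoint x).
rewrite lecE/= => H; have /andP[//] : (complex.Im (psi (2^-1 *: (x + star x))) == 0) &&
  (r <= complex.Re (psi (2^-1 *: (x + star x)))).
apply: H => l /(rational_spectrum (rational_valueZ 2^-1 (rational_valueD hx hx'))).
move=> [t tc ->]; rewrite E// addcJ mulKf ?pnatr_eq0//; exact: Hr.
Qed.

End Rational.

End Positive.

(** * Convex functions on an interval *)

Section Convex.
Variables (R : realType) (I : interval R) (f : R[i] -> R[i]) (m M : R).
Hypotheses (fconv : real_convex_on I f) (mM : m < M) (mMI : {subset `[m, M] <= I}).
Implicit Types (s t k : R).

Let fr t := complex.Re (f t%:C).

Lemma convex_real t : m <= t <= M -> f t%:C = (fr t)%:C.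
Proof.
move=> tm; have tI : t \in I by apply: mMI; rewrite in_itv.
by rewrite /fr RRe_real//; case: fconv => + _; exact.
Qed.

Lemma convex_le s t k : m <= s <= M -> m <= t <= M -> 0 <= k -> k <= 1 ->
  fr (k * s + (1 - k) * t) <= k * fr s + (1 - k) * fr t.
Proof.
move=> sm tm k0 k1; case: fconv => _ /(_ (Itv01 k0 k1) s t); apply.
  by rewrite inE /=; apply: mMI; rewrite in_itv.
by rewrite inE /=; apply: mMI; rewrite in_itv.
Qed.

Lemma convex_chord t : m <= t <= M ->
  fr t <= ((M - t) * fr m + (t - m) * fr M) / (M - m).
Proof.
move=> /andP[mt tM]; have d0 : 0 < M - m by rewrite subr_gt0.
have := @convex_le m M ((M - t) / (M - m)); rewrite !lexx (ltW mM) => /(_ isT isT).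
rewrite divr_ge0 ?subr_ge0 ?(ltW mM)// ler_pdivrMr// mul1r lerD2l lerN2 mt => /(_ isT isT).
have d0' : M - m != 0 by rewrite gt_eqF.
have -> : (M - t) / (M - m) * m + (1 - (M - t) / (M - m)) * M = t by field.
by move/le_trans; apply; apply: le_of_eq; field.
Qed.

(** At an end point of [m, M] a convex function need not have a supporting line;
    the derivative provides one. *)
Lemma convex_tangent s : hol f s%:C -> m <= s <= M ->
  exists l, forall t, m <= t <= M -> fr s + l * (t - s) <= fr t.
Proof.
move=> [l Hl] sm; exists (complex.Re l) => t tm; have [->|ts] := eqVneq t s.
  by rewrite subrr mulr0 addr0.
have ts0 : 0 < `|t - s| by rewrite normr_gt0 subr_eq0.
apply/ler_addgt0Pr => e e0; have [|d d0 Hd] := Hl (e / `|t - s|); first by rewrite divr_gt0.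
pose k := Num.min 1 (d / 2 / `|t - s|).
have k0 : 0 < k by rewrite lt_min ltr01 !divr_gt0.
have k1 : k <= 1 by rewrite ge_min lexx.
have kd : k * `|t - s| < d.
  apply: le_lt_trans (_ : d / 2 < d); last by rewrite ltr_pdivrMr// ltr_pMr// ltr1n.
  by rewrite -ler_pdivlMr// ge_min lexx orbT.
pose u := k * t + (1 - k) * s.
have us : u%:C - s%:C = (k * (t - s))%:C.
  by rewrite -(rmorphB (real_complex R) u s); congr (_%:C); rewrite /u; ring.
have := Hd u%:C; rewrite us nmC normrM (ger0_norm (ltW k0)) => /(_ kd) H.
have := convex_le tm sm (ltW k0) k1; rewrite -/u => C.
have := le_trans (Re_le_nm _) H; rewrite ler_norml => /andP[H1 _].
have E : complex.Re (f u%:C - f s%:C - l * (k * (t - s))%:C) =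
    fr u - fr s - complex.Re l * (k * (t - s)).
  by rewrite !ReB; congr (_ - _); case: (l) => l1 l2 /=; rewrite mulr0 subr0.
rewrite E in H1.
have e1 : e / `|t - s| * (k * `|t - s|) = e * k by field; rewrite gt_eqF.
rewrite e1 in H1; rewrite -(ler_pM2l k0); lra.
Qed.

(** [E + (s - E) / k] lies between [s] and [E]. *)
Lemma convex_extrapolate s E k : m <= s <= M -> m <= E <= M -> 1 <= k ->
  k * fr (E + (s - E) / k) - (k - 1) * fr E <= fr s.
Proof.
move=> sm Em k1; have k0 : 0 < k by lra.
have := convex_le sm Em (k := k^-1).
rewrite invr_ge0 (ltW k0) invf_le1// k1 => /(_ isT isT).
have -> : k^-1 * s + (1 - k^-1) * E = E + (s - E) / k by ring.
move=> /(ler_wpM2l (ltW k0)).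
by rewrite mulrDr !mulrA mulrBr mulr1 mulfV ?gt_eqF//; lra.
Qed.

(** The midpoint of [m, M] lies between [s] and the end point [E] farther from
    [s]; the factor is the ratio of [s - E] to half the length of [m, M]. *)
Lemma convex_chord_gap s : m <= s <= M ->
  ((M - s) * fr m + (s - m) * fr M) / (M - m) - fr s <=
    (1 + 2 * (`|s - (m + M) / 2| / (M - m))) *
    ((fr m + fr M) / 2 - fr ((m + M) / 2)).
Proof.
move=> sm; have /andP[ms sM] := sm; have d0 : 0 < M - m by rewrite subr_gt0.
have d0' : M - m != 0 by rewrite gt_eqF.
have mm : m <= m <= M by rewrite lexx ltW.
have MM : m <= M <= M by rewrite lexx ltW.
case: (leP s ((m + M) / 2)) => smid.
  have Ms : M - s != 0 by apply/eqP; lra.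
  rewrite ler0_norm; last lra.
  have -> : 1 + 2 * (- (s - (m + M) / 2) / (M - m)) = 2 * ((M - s) / (M - m)) by field.
  have := convex_extrapolate sm MM (k := 2 * ((M - s) / (M - m))).
  have -> : M + (s - M) / (2 * ((M - s) / (M - m))) = (m + M) / 2.
    by field; rewrite d0' Ms.
  rewrite {1}mulrA ler_pdivlMr// => H; have {}H := H ltac:(lra).
  have -> : ((M - s) * fr m + (s - m) * fr M) / (M - m) =
      (M - s) / (M - m) * fr m + (1 - (M - s) / (M - m)) * fr M by field.
  lra.
have sm0 : s - m != 0 by apply/eqP; lra.
rewrite ger0_norm; last lra.
have -> : 1 + 2 * ((s - (m + M) / 2) / (M - m)) = 2 * ((s - m) / (M - m)) by field.
have := convex_extrapolate sm mm (k := 2 * ((s - m) / (M - m))).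
have -> : m + (s - m) / (2 * ((s - m) / (M - m))) = (m + M) / 2.
  by field; rewrite d0' sm0.
rewrite {1}mulrA ler_pdivlMr// => H; have {}H := H ltac:(lra).
have -> : ((M - s) * fr m + (s - m) * fr M) / (M - m) =
    (1 - (s - m) / (M - m)) * fr m + (s - m) / (M - m) * fr M by field.
lra.
Qed.

Lemma convex_mid : 0 <= (fr m + fr M) / 2 - fr ((m + M) / 2).
Proof.
have h : (0 : R) <= 2^-1 by []. have h1 : (2^-1 : R) <= 1 by lra.
have := @convex_le m M 2^-1; rewrite !lexx (ltW mM) => /(_ isT isT h h1).
have -> : 2^-1 * m + (1 - 2^-1) * M = (m + M) / 2 by field.
lra.
Qed.

Lemma convex_factor_le2 s : m <= s <= M -> 1 + 2 * (`|s - (m + M) / 2| / (M - m)) <= 2.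
Proof.
move=> /andP[ms sM]; have d0 : 0 < M - m by rewrite subr_gt0.
have : `|s - (m + M) / 2| / (M - m) <= 2^-1.
  by rewrite ler_pdivrMr// ler_norml; apply/andP; split; lra.
lra.
Qed.

End Convex.

(** * Rational approximation of the functional calculus *)

Section Approximation.
Variables (R : realType) (A : banachStarAlgType R) (G : set R[i]) (f : R[i] -> R[i]) (c : A).
Hypothesis Gop : forall z, G z -> exists2 r : R, 0 < r & forall w, nm (w - z) < r -> G w.
Hypothesis Gf : forall z, G z -> hol f z.
Implicit Types (z w : R[i]) (e d : R).

(** The set of regular points is open, with the radius given by the resolvent. *)
Lemma spectrum_dist z (t : R[i]) : ~ spectrum c z -> spectrum c t ->
  1 <= nm (z - t) * (nm (1 : A) * nm (z%:A - c)^-1).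
Proof.
move=> /negP/negPn zu; apply: contraPle => h; apply/negP; rewrite negbK.
apply: (unit_near zu); rewrite opprB addrA subrK -scalerBl nm_alg.
by rewrite -mulrA.
Qed.

Lemma resolvent_cts z e : ~ spectrum c z -> 0 < e -> exists2 d, 0 < d &
  forall w, nm (w - z) < d -> nm ((w%:A - c)^-1 - (z%:A - c)^-1) < e.
Proof.
move=> /negP/negPn zu e0; set x := z%:A - c in zu *; set k := nm x^-1.
have k0 : 0 <= k := nm_ge0 _; have K0 := @nmA_gt0 _ A; set K := nm (1 : A) in K0.
have D0 : 0 < 2 * (K * (k + 1)) by rewrite !mulr_gt0// ltr_wpDl.
have D1 : 0 < 2 * (k ^+ 2 + 1) * K by rewrite !mulr_gt0// ltr_wpDl// exprn_ge0.
exists (Num.min (2 * (K * (k + 1)))^-1 (e / (2 * (k ^+ 2 + 1) * K))).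
  by rewrite lt_min invr_gt0 D0 divr_gt0.
move=> w; rewrite lt_min -[(2 * _)^-1]mul1r !ltr_pdivlMr// => /andP[h1 h2].
have n0 := nm_ge0 (w - z).
have E : nm (x - (w%:A - c)) = nm (w - z) * K.
  by rewrite opprB addrA subrK -scalerBl nm_alg nmB.
have [|_] := @inv_near _ _ x (w%:A - c) zu.
  by rewrite E -/k; have := mulr_ge0 n0 (ltW K0); nra.
rewrite nmB E -/k => /le_lt_trans; apply; have := mulr_ge0 n0 (ltW K0).
by move: h2; rewrite -/K; nra.
Qed.

Section Curve.
Variable g : R -> R[i].
Hypothesis gG : encloses G (spectrum c) g.

Let gcr : closed_rectifiable_curve g. Proof. by case: gG. Qed.
Let gc : {within `[0, 1], continuous g}. Proof. by case: gcr. Qed.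
Let gtr t : 0 <= t <= 1 -> trace g (g t).
Proof. by move=> t01; exists t => //=; rewrite in_itv. Qed.
Let gns t : 0 <= t <= 1 -> ~ spectrum c (g t).
Proof. by move=> /gtr h; case: gG => _ _ + _ => /[apply] -[]. Qed.
Let gGt t : 0 <= t <= 1 -> G (g t).
Proof. by move=> /gtr h; case: gG => _ + _ _; exact. Qed.

Lemma curve_spectrum_dist : exists2 d, 0 < d &
  forall s, 0 <= s <= 1 -> forall t, spectrum c t -> d <= nm (g s - t).
Proof.
apply: (@compact_uniform R 0 1 (fun d s => forall t, spectrum c t -> d <= nm (g s - t))).
move=> u u01; pose k := nm (1 : A) * nm ((g u)%:A - c)^-1 + 1.
have k0 : 0 < k by rewrite ltr_wpDl// mulr_ge0// nm_ge0.
have k20 : 0 < k^-1 / 2 by rewrite divr_gt0// invr_gt0.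
have [d d0 Hd] := curve_eps_delta gc u01 k20.
exists (Num.min d (k^-1 / 2)); first by rewrite lt_min d0.
move=> s e s01; rewrite lt_min => /andP[su _] /andP[_]; rewrite lt_min => /andP[_ ek] t tc.
have : k^-1 <= nm (g u - t).
  rewrite -div1r ler_pdivrMr//; apply: le_trans (spectrum_dist (gns u01) tc) _.
  by rewrite ler_wpM2l ?nm_ge0// /k lerDl.
have := nm_trans (g s) (g u) t; rewrite (nmB (g u) (g s)); have := Hd s s01 su; lra.
Qed.

Lemma curve_bound (F : R[i] -> R[i]) : curve_cont g F -> exists2 B, 0 < B &
  forall s, 0 <= s <= 1 -> nm (F (g s)) <= B.
Proof.
move=> Fc; have [|d d0 Hd] := @compact_uniform R 0 1 (fun d s => nm (F (g s)) <= d^-1).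
  move=> t t01; have [d d0 Hd] := Fc 1 ltr01.
  have k0 : 0 < nm (F (g t)) + 1 by rewrite ltr_wpDl// nm_ge0.
  exists (Num.min d (nm (F (g t)) + 1)^-1); first by rewrite lt_min d0 invr_gt0.
  move=> s e s01; rewrite !lt_min => /andP[st _] /andP[e0 /andP[_ ek]].
  apply: (@le_trans _ _ (nm (F (g t)) + 1)).
    by have := nm_trans (F (g t)) (F (g s)) 0; rewrite !subr0; have := Hd _ _ s01 t01 st; lra.
  by rewrite -[leLHS]invrK lef_pV2 ?posrE ?invr_gt0// ltW.
by exists d^-1; rewrite ?invr_gt0.
Qed.

Let fc : curve_cont g f.
Proof. by apply: (curve_contP gc) => t t01 e e0; have := hol_cts (Gf (gGt t01)) e0. Qed.

Let resolvent_curve : curve_cont g (fun z => f z *: (z%:A - c)^-1).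
Proof.
apply: (curve_contP gc) => t t01 e e0; set r0 := ((g t)%:A - c)^-1.
have k0 : 0 < 2 * (nm r0 + 1) by rewrite mulr_gt0// ltr_wpDl// nm_ge0.
have l0 : 0 < 2 * (nm (f (g t)) + 1) by rewrite mulr_gt0// ltr_wpDl// nm_ge0.
have [|d1 d10 H1] := hol_cts (Gf (gGt t01)) (e := e / (2 * (nm r0 + 1))).
  by rewrite divr_gt0.
have [|d2 d20 H2] := resolvent_cts (gns t01) (e := Num.min 1 (e / (2 * (nm (f (g t)) + 1)))).
  by rewrite lt_min ltr01 divr_gt0.
exists (Num.min d1 d2); first by rewrite lt_min d10.
move=> z; rewrite lt_min => /andP[/H1 + /H2]; rewrite lt_min -/r0 !ltr_pdivlMr//.
move: (_^-1) => r h1 /andP[h2 h3].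
have -> : f z *: r - f (g t) *: r0 = (f z - f (g t)) *: r + f (g t) *: (r - r0).
  by rewrite scalerBl scalerBr addrA subrK.
apply: le_lt_trans (nmD _ _) _; rewrite !nmZ.
have hr : nm r <= nm r0 + 1 by have := nmD (r - r0) r0; rewrite subrK; lra.
have := ler_wpM2l (nm_ge0 (f z - f (g t))) hr.
have := nm_ge0 (r - r0); lra.
Qed.

Let kernel_osc e : 0 < e -> exists2 d, 0 < d &
  forall t, spectrum c t -> osc g (fun z => f z / (z - t)) d e.
Proof.
move=> e0; have [r r0 Hr] := curve_spectrum_dist; have [B B0 HB] := curve_bound fc.
have idc : curve_cont g (id : R[i] -> R[i]).
  by apply: (curve_contP gc) => t t01 e1 e10; exists e1.
have [|d1 d10 H1] := fc (e := e / 2 * r); first by rewrite mulr_gt0// divr_gt0.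
have [|d2 d20 H2] := idc (e / 2 / B * r ^+ 2); first by rewrite mulr_gt0 ?exprn_gt0// !divr_gt0.
exists (Num.min d1 d2); first by rewrite lt_min d10.
move=> t tc u w u01 w01; rewrite lt_min => /andP[uw1 uw2].
have -> : f (g u) / (g u - t) - f (g w) / (g w - t) = (f (g u) - f (g w)) / (g u - t) +
   f (g w) * ((g u - t)^-1 - (g w - t)^-1) by ring.
apply: le_trans (nmD _ _) _; rewrite !nmM nmV [e]splitr; apply: lerD.
  rewrite ler_pdivrMr ?(lt_le_trans r0 (Hr _ u01 _ tc))//.
  by apply: le_trans (H1 _ _ u01 w01 uw1) _; rewrite ler_wpM2l ?divr_ge0 ?(ltW e0)// Hr.
apply: le_trans (ler_pM (nm_ge0 _) (nm_ge0 _) (HB _ w01) (nm_invB r0 (Hr _ u01 _ tc) (Hr _ w01 _ tc))) _.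
have := H2 _ _ u01 w01 uw2; rewrite opprB addrA subrK /= => h.
have r20 : 0 < r ^+ 2 by rewrite exprn_gt0.
rewrite -ler_pdivlMl// -ler_pdivlMl ?invr_gt0// invrK.
by apply: le_trans h _; apply: le_of_eq; ring.
Qed.

(** One Riemann sum serves twice: it approximates [f(c)], and with [c] replaced by
    a point of the spectrum it approximates the value of [f] there, by Cauchy's
    formula. The latter holds uniformly because the trace is at positive distance
    from the spectrum. *)
Lemma riemann_approx y e : 0 < e ->
  y = (twopii R)^-1 *: curve_integral g (fun z => f z *: (z%:A - c)^-1) ->
  exists n (a z : 'I_n -> R[i]), [/\ forall k, ~ spectrum c (z k),
    nm (y - \sum_(k < n) a k *: ((z k)%:A - c)^-1) <= e &
    forall t, spectrum c t -> nm (\sum_(k < n) a k * (z k - t)^-1 - f t) <= e].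
Proof.
move=> e0 yE; have [v gv] := closed_curve_dominates gcr.
have L0 : 0 <= v 1 - v 0 := length_ge0 gv.
have p0 : 0 < nm (twopii R) by rewrite nm_gt0 twopii_neq0.
pose e' := e * nm (twopii R) / (v 1 - v 0 + 1).
have e'0 : 0 < e' by rewrite divr_gt0 ?mulr_gt0// ltr_wpDl.
have e'e : e' * (v 1 - v 0) <= e * nm (twopii R) by apply: mul_frac_le => //; rewrite ltW// mulr_gt0.
have [d1 d10 H1] := resolvent_curve e'0; have [d2 d20 H2] := kernel_osc e'0.
have [N HN] : exists N, tagged (upart N) (pt (@upart R N)) (Num.min d1 d2 / 2).
  have [|N HN] := @upart_mesh R (Num.min d1 d2 / 2); first by rewrite divr_gt0// lt_min d10.
  by exists N; exact: HN.
have N01 := @upart_itv R N.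
have [x Fx] := ci_exists gv resolvent_curve.
have le_osc (V : normedModType R[i]) (F : R[i] -> V) d : Num.min d1 d2 <= d -> osc g F d e' ->
    osc g F (Num.min d1 d2) e'.
  by move=> dd H u w u01 w01 uw; apply: H => //; exact: lt_le_trans uw dd.
have ti k : (k < size (@upart R N))%N -> 0 <= pt (@upart R N) k <= 1 by move=> _; exact: pt_itv.
have scale (V : normedModType R[i]) (s w : V) : nm (s - w) <= e' * (v 1 - v 0) ->
    nm ((twopii R)^-1 *: s - (twopii R)^-1 *: w) <= e.
  by move=> h; rewrite -scalerBr nmZ nmV mulrC ler_pdivrMr//; apply: le_trans h _.
exists (size (@upart R N)).
exists (fun k => (twopii R)^-1 * ((g (pt (upart N) k.+1) - g (pt (upart N) k)) * f (g (pt (upart N) k)))).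
exists (fun k => g (pt (upart N) k)); split.
- by move=> k; apply: gns; exact: ti.
- have -> : y = (twopii R)^-1 *: x by rewrite yE (curve_integralE Fx).
  have := ci_close gv (le_osc _ _ _ _ H1) Fx N01 HN.
  rewrite ge_min lexx => /(_ isT)/scale; rewrite nmB; congr (nm (_ - _) <= _).
  by rewrite scaler_sumr; apply: eq_bigr => k _; rewrite !scalerA mulrA.
move=> t tc; have Ft := @homology_cauchy R g G f gcr Gop Gf.
have {}Ft : is_curve_integral g (fun z => f z / (z - t)) (twopii R * f t).
  by case: gG => _ h1 h2 h3; apply: Ft => //; exact: h2.
have := ci_close gv (le_osc _ _ _ _ (H2 t tc)) Ft N01 HN.
rewrite ge_min lexx orbT => /(_ isT)/scale; congr (nm (_ - _) <= _).
  by rewrite scaler_sumr; apply: eq_bigr => k _; rewrite /GRing.scale/= !mulrA.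
by rewrite /GRing.scale/= mulrA mulVf ?mul1r// twopii_neq0.
Qed.

End Curve.

End Approximation.

(** * The Jensen-type inequality *)

Section Jensen.
Variables (R : realType) (A : banachStarAlgType R) (psi : {scalar A}).
Hypothesis herm : hermitian_algebra A.
Hypothesis pos : positive_functional psi.
Hypothesis psi1 : normalized psi.
Variables (c y : A) (f : R[i] -> R[i]).
Hypothesis sc : selfadjoint c.
Hypothesis yf : forall e : R, 0 < e -> exists n (a z : 'I_n -> R[i]),
  [/\ forall k, ~ spectrum c (z k),
    nm (y - \sum_(k < n) a k *: ((z k)%:A - c)^-1) <= e &
    forall t, spectrum c t -> nm (\sum_(k < n) a k * (z k - t)^-1 - f t) <= e].
Implicit Types (z w t : R[i]) (r : R) (b : A).

Let resolvent_comm z b : GRing.comm b c -> GRing.comm b (z%:A - c)^-1.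
Proof.
move=> bc; apply: commrV; apply: commrB => //.
by rewrite /GRing.comm -scalerAl -scalerAr mulr1 mul1r.
Qed.

Let sum_comm n (a z : 'I_n -> R[i]) b : GRing.comm b c ->
  GRing.comm b (\sum_(k < n) a k *: ((z k)%:A - c)^-1).
Proof.
move=> bc; apply: commr_sum => k _.
by rewrite /GRing.comm -scalerAr -scalerAl (resolvent_comm _ bc).
Qed.

Let y_comm b : GRing.comm b c -> GRing.comm b y.
Proof.
move=> bc; apply: nm_unique => e e0.
have K0 : 0 < 2 * (nm b + 1) by rewrite mulr_gt0// ltr_wpDl// nm_ge0.
have [|n [a [z [_ ys _]]]] := yf (e := e / (2 * (nm b + 1))); first by rewrite divr_gt0.
move: ys (sum_comm a z bc); rewrite ler_pdivlMr//.
move: (\sum_(k < n) _) => S ys bS.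
have -> : b * y - y * b = b * (y - S) - (y - S) * b.
  by rewrite mulrBr mulrBl bS opprB addrA subrK.
apply: le_trans (nm_sub _ _) _; have := nmMA b (y - S); have := nmMA (y - S) b.
have := nm_ge0 (y - S); lra.
Qed.

Let star_resolvent z : ~ spectrum c z ->
  ~ spectrum c (conjc z) /\ star (z%:A - c)^-1 = ((conjc z)%:A - c)^-1.
Proof.
move=> /negP/negPn zu; have E : star (z%:A - c) = (conjc z)%:A - c.
  by rewrite starB starZ star1 sc.
by rewrite star_inv// E; split => //; apply/negP/negPn; rewrite -E star_unit.
Qed.

(** For a Riemann sum in place of [y] this is [psi_rational_ge]. The error term
    commutes with whatever commutes with [c], hence with its own adjoint, so
    [psi_bound] applies to it. *)
Lemma psi_affine_ge w al be r : nm w = 1 ->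
  (forall t, spectrum c t -> r <= complex.Re (w * f t + al * t + be)) ->
  r <= complex.Re (w * psi y + al * psi c + be).
Proof.
move=> w1 H; apply/ler_addgt0Pr => e e0.
have [|n [a [z [zc ys fs]]]] := yf (e := e / 3); first by rewrite divr_gt0.
pose S := \sum_(k < n) a k *: ((z k)%:A - c)^-1.
pose s t := \sum_(k < n) a k * (z k - t)^-1.
pose s' t := \sum_(k < n) conjc (a k) * (conjc (z k) - t)^-1.
have sS : rational_value c S s.
  apply: rational_value_sum => k; apply: rational_valueZ.
  exact: rational_value_inv.
have sS' : rational_value c (star S) s'.
  rewrite /S star_sum; apply: rational_value_sum => k.
  have [zc' E] := star_resolvent (zc k); rewrite starZ E.
  by apply: rational_valueZ; exact: rational_value_inv.
have aff w' al' be' x phi : rational_value c x phi ->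
    rational_value c (w' *: x + al' *: c + be'%:A) (fun t => w' * phi t + al' * t + be').
  move=> xp; apply: rational_valueD; last exact: rational_value_alg.
  apply: rational_valueD; apply: rational_valueZ => //; exact: rational_value_id.
have := psi_rational_ge herm pos psi1 sc (aff w al be _ _ sS) (phi' := fun t =>
  conjc w * s' t + conjc al * t + conjc be) (r := r - e / 3).
rewrite !starD !starZ star1 sc => /(_ (aff _ _ _ _ _ sS')) X.
have {}X : r - e / 3 <= complex.Re (psi (w *: S + al *: c + be%:A)).
  apply: X => t tc.
    have /complex_realP[k tk] := herm sc tc.
    rewrite /= !rmorphD/= !rmorphM/= tk conjc_real; congr (_ * _ + _ + _).
    rewrite /s' /s rmorph_sum; apply: eq_bigr => i _.
    by rewrite rmorphM fmorphV rmorphB; congr (_ * (_ - _)^-1); apply/esym/conjc_real.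
  have := H t tc; have := fs t tc; have := Re_le_nm (w * (s t - f t)).
  rewrite nmM w1 mul1r -/(s t) => h1 h2.
  have := le_trans h1 h2; rewrite ler_norml => /andP[h3 _].
  have -> : w * s t + al * t + be = (w * f t + al * t + be) + w * (s t - f t) by ring.
  by move: h3; rewrite raddfD/=; lra.
have B : `|complex.Re (psi (w *: (y - S)))| <= e / 2.
  apply: (psi_bound herm pos psi1).
  - have ec b : GRing.comm b c -> GRing.comm b (w *: (y - S)).
      move=> bc; rewrite /GRing.comm -scalerAr -scalerAl; congr (_ *: _).
      by apply: commrB; [exact: y_comm|exact: sum_comm].
    have cc : GRing.comm c c by [].
    apply/esym/ec; rewrite /GRing.comm -[in LHS]sc -[in RHS]sc -!starM.
    by rewrite (ec c cc).
  - by rewrite divr_gt0.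
  - rewrite nmZ w1 mul1r; apply: le_lt_trans ys _.
    by rewrite ltr_pM2l// ltf_pV2 ?posrE// ltr_nat.
have E : psi (w *: (y - S)) = (w * psi y + al * psi c + be) -
    psi (w *: S + al *: c + be%:A).
  by rewrite linearZ/= linearB/= !linearD/= !linearZ/= psi1 /GRing.scale/=; ring.
by move: B; rewrite E ReB ler_norml => /andP[B _]; lra.
Qed.

End Jensen.

Theorem theorem4 (R : realType) (A : banachStarAlgType R)
    (psi : {scalar A}) (G : set R[i]) (f : R[i] -> R[i]) (I : interval R)
    (m M : R) (c : A) :
  hermitian_algebra A ->
  positive_functional psi ->
  normalized psi ->
  open G ->
  analytic_on G f ->
  (forall t : R, t \in I -> G t%:C) ->
  real_convex_on I f ->
  m < M ->
  {subset `[m, M] <= I} ->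
  selfadjoint c ->
  spectrum c `<=` [set l | m%:C <= l <= M%:C] ->
  let mid : R[i] := ((m + M) / 2)%:C in
  let fc : A := hol_calc G f c in
  [/\ 0 <= psi fc - f (psi c),
      psi fc - f (psi c) <=
        (1 + 2 * (`|psi c - mid| / (M - m)%:C)) *
        ((f m%:C + f M%:C) / 2 - f mid)
    & (1 + 2 * (`|psi c - mid| / (M - m)%:C)) *
        ((f m%:C + f M%:C) / 2 - f mid) <=
      f m%:C + f M%:C - 2 * f mid].
Proof.
move=> herm pos psi1 Go fan IG fconv mM mMI sc cs mid fc.
have Gop z : G z -> exists2 r : R, 0 < r & forall w, nm (w - z) < r -> G w.
  move: Go; rewrite openE => /[apply] /nbhs_nmP[r r0 Hr]; exists r => // w wz.
  by apply: Hr; rewrite nmB.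
have Gf z : G z -> hol f z by move=> /fan; exact: derivable_hol.
have Gm t : m <= t <= M -> G t%:C by move=> tm; apply/IG/mMI; rewrite in_itv.
have cs' t : spectrum c t -> exists2 k, m <= k <= M & t = k%:C.
  move=> tc; have /complex_realP[k tk] := herm c sc t tc; exists k => //.
  by have := cs t tc; rewrite /= tk !lecR.
have fcE : is_hol_calc G f c fc.
  have [g gG] := enclosing_curve (ltW mM) Gop Gm cs.
  rewrite /fc /hol_calc; case: xgetP => [//|].
  by move=> /(_ ((twopii R)^-1 *: curve_integral g (fun z => f z *: (z%:A - c)^-1))) []; exists g.
have jensen (w al be : R[i]) (r : R) : nm w = 1 ->
    (forall t, spectrum c t -> r <= complex.Re (w * f t + al * t + be)) ->
    r <= complex.Re (w * psi fc + al * psi c + be).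
  apply: psi_affine_ge => // e e0; have [g gG yE] := fcE.
  exact: (riemann_approx Gop Gf gG e0 yE).
pose fr t := complex.Re (f t%:C); pose s := complex.Re (psi c).
have fE t : m <= t <= M -> f t%:C = (fr t)%:C := convex_real fconv mMI (t := t).
have cE : psi c = s%:C by apply/eqP; rewrite eq_complex/= eqxx (psi_real herm pos psi1 sc) eqxx.
have sm : m <= s <= M.
  rewrite -!lecR -cE psi_ge ?psi_le// => t /cs'[k /andP[]]; by move=> ? ? ->.
(* [f] is real on the spectrum: the weights ['i] and [- 'i] bound the imaginary
   part of [psi fc] by 0 from both sides. *)
pose p := complex.Re (psi fc).
have pE : psi fc = p%:C.
  apply/eqP; rewrite eq_complex/= eqxx/=; apply/eqP/le_anti/andP; split.
    have := jensen 'i 0 0 0; rewrite !mul0r !addr0 => h.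
    have : 0 <= complex.Re ('i * psi fc).
      apply: h => [|t /cs'[k km ->]].
        by rewrite nmE2/= expr0n/= expr1n add0r sqrtr1.
      by rewrite fE// !mul0r !addr0 /= mul0r mul1r subrr.
    by case: (psi fc) => a b /=; lra.
  have := jensen (- 'i) 0 0 0; rewrite !mul0r !addr0 => h.
  have : 0 <= complex.Re (- 'i * psi fc).
    apply: h => [|t /cs'[k km ->]].
      by rewrite nmN nmE2/= expr0n/= expr1n add0r sqrtr1.
    by rewrite fE// !mul0r !addr0 /= oppr0; lra.
  by case: (psi fc) => a b /=; lra.
(* Comparison with the tangent at [s]. *)
have low : fr s <= p.
  have [l Hl] := convex_tangent fconv mMI (Gf _ (Gm _ sm)) sm.
  have := jensen 1 (- l)%:C (l * s - fr s)%:C 0 (nm1 R); rewrite cE pE => h.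
  have : 0 <= complex.Re (1 * p%:C + (- l)%:C * s%:C + (l * s - fr s)%:C).
    apply: h => t /cs'[k km ->]; have := Hl k km; rewrite fE//= -/(fr s) -/(fr k); lra.
  by rewrite /=; lra.
pose a := (fr M - fr m) / (M - m); pose b := (M * fr m - m * fr M) / (M - m).
have d0 : M - m != 0 by rewrite subr_eq0 gt_eqF.
have chordE k : ((M - k) * fr m + (k - m) * fr M) / (M - m) = a * k + b.
  by rewrite /a /b; field.
(* Comparison with the chord over [m, M]. *)
have upp : p <= ((M - s) * fr m + (s - m) * fr M) / (M - m).
  have := jensen (-1) a%:C b%:C 0; rewrite nmN nm1 cE pE chordE => /(_ erefl) h.
  have : 0 <= complex.Re (-1 * p%:C + a%:C * s%:C + b%:C).
    apply: h => t /cs'[k km ->]; have := convex_chord fconv mM mMI km.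
    by rewrite -/(fr m) -/(fr M) -/(fr k) chordE fE//=; lra.
  by rewrite /=; lra.
have mm : m <= m <= M by rewrite lexx ltW.
have MM : m <= M <= M by rewrite lexx ltW.
have midm : m <= (m + M) / 2 <= M by apply/andP; split; lra.
pose k := 1 + 2 * (`|s - (m + M) / 2| / (M - m)).
pose D := (fr m + fr M) / 2 - fr ((m + M) / 2).
have kE : 1 + 2 * (`|psi c - mid| / (M - m)%:C) = k%:C.
  rewrite cE /mid -(rmorphB (real_complex R)) nmE nmC /k.
  by rewrite (rmorphD (real_complex R) 1) (rmorphM (real_complex R) 2) fmorph_div rmorph1 rmorph_nat.
have DE : (f m%:C + f M%:C) / 2 - f mid = D%:C.
  rewrite !fE// /D (rmorphB (real_complex R)) fmorph_div rmorphD rmorph_nat//.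
have TE : f m%:C + f M%:C - 2 * f mid = (2 * D)%:C.
  by rewrite (rmorphM (real_complex R) 2 D) rmorph_nat /= -DE; field.
rewrite kE DE TE pE cE fE// -(rmorphB (real_complex R)) -(rmorphM (real_complex R)).
split; first by rewrite ler0c subr_ge0.
  rewrite lecR; have := convex_chord_gap fconv mM mMI sm.
  by rewrite -/(fr _) -/(fr _) -/(fr _) -/(fr _) -/k -/D => h; apply: le_trans h; rewrite lerB.
rewrite lecR ler_wpM2r//; first exact: (convex_mid fconv mM mMI).
exact: convex_factor_le2.
Qed.
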